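(* Let $(R,\mathfrak{m})$ be a local $F$-finite Gorenstein ring of prime characteristic $p$ and let $Q\subsetneq R$ be an ideal such that $\operatorname{pd}_R(R/Q)<\infty$. Then: (1) $R/Q$ is $F$-pure if and only if $\left(Q^{[p^e]}:Q\right)\nsubseteq I_e(\mathfrak{m})$ for some (equivalently every) $e>0$. (2) $R/Q$ is strongly $F$-regular if and only if for any $c\notin Q$ there exists $e>0$ such that $c\,(I_e(Q):Q)\nsubseteq I_e(\mathfrak{m})$.
   Context: All rings are commutative, Noetherian, with unity, of prime characteristic $p>0$. $F^e_*R$ denotes $R$ viewed as an $R$-module via the $e$-th iterate of Frobenius; its elements are written $F^e_*r$. $R$ is $F$-finite if $F^e_*R$ is a finite $R$-module. An $F$-finite ring $A$ is $F$-pure if the natural map $A\to F^e_*A$ splits as a map of $A$-modules for one (equivalently all) $e>0$. An $F$-finite ring $A$ is strongly $F$-regular if for every $c\in A$ not in any minimal prime of $A$ there is $e>0$ such that the $A$-linear map $A\to F^e_*A$ sending $1$ to $F^e_*c$ splits. For an ideal $Q$, $Q^{[p^e]}$ is the ideal generated by the $p^e$-th powers of elements of $Q$, and $I_e(Q)=\{r\in R:\varphi(F^e_*r)\in Q\text{ for all }\varphi\in\operatorname{Hom}_R(F^e_*R,R)\}$. *)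

(* Defs.v *)
From HB Require Import structures.
From mathcomp Require Import all_boot all_order all_algebra.
From mathcomp Require Import boolp classical_sets.

Set Implicit Arguments.
Unset Strict Implicit.
Unset Printing Implicit Defensive.

Import GRing.Theory.
Local Open Scope classical_set_scope.
Local Open Scope ring_scope.
Local Open Scope quotient_scope.

(* [idealr R] and [prime_idealr R] are the library's PROPER ideals and prime
   ideals, given by boolean predicates (every set is one, classically).  Ideals
   that may be the unit ideal are Prop-valued sets. *)

Section Ideals.
Variable R : comNzRingType.

Definition is_ideal (I : set R) : Prop :=
  [/\ I 0, forall x y, I x -> I y -> I (x + y) & forall a x, I x -> I (a * x)].

Definition ideal_gen (S : set R) : set R :=
  [set r | exists n (a s : 'I_n -> R),
     (forall i, S (s i)) /\ r = \sum_(i < n) a i * s i].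

Definition noetherian : Prop :=
  forall I : set R, is_ideal I -> exists s : seq R, I = ideal_gen [set` s].

Definition maximal_ideal (M : idealr R) : Prop :=
  forall J : idealr R, {subset M <= J} -> {subset J <= M}.

Definition local_ring (m : idealr R) : Prop :=
  maximal_ideal m /\ forall M : idealr R, maximal_ideal M -> M =i m.

Definition minimal_prime (P : prime_idealr R) : Prop :=
  forall P' : prime_idealr R, {subset P' <= P} -> {subset P <= P'}.

Definition colon (I J : set R) : set R :=
  [set r | forall x, J x -> I (r * x)].

End Ideals.

Section HomologicalDimensions.
Variable R : comNzRingType.

Definition fin_gen (M : lmodType R) : Prop :=
  exists n (g : 'I_n -> M),
    forall x, exists a : 'I_n -> R, x = \sum_(i < n) a i *: g i.

Definition splits (M N : lmodType R) (f : M -> N) : Prop :=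
  exists g : {linear N -> M}, cancel f g.

Definition projective (P : lmodType R) : Prop :=
  forall (M N : lmodType R) (g : {linear M -> N}) (f : {linear P -> N}),
    (forall y, exists x, g x = y) -> exists h : {linear P -> M}, g \o h =1 f.

Definition injective_module (E : lmodType R) : Prop :=
  forall (M N : lmodType R) (g : {linear M -> N}) (f : {linear M -> E}),
    injective g -> exists h : {linear N -> E}, h \o g =1 f.

(* There is an exact sequence ... -> P 1 -> P 0 -> M -> 0 with all P i
   projective and P i = 0 for i > n. *)
Definition proj_dim_le (n : nat) (M : lmodType R) : Prop :=
  exists (P : nat -> lmodType R)
         (d : forall i, {linear P i.+1 -> P i}) (eps : {linear P 0%N -> M}),
  [/\ forall i, projective (P i),
      forall i, (n < i)%N -> forall x : P i, x = 0,
      forall y, exists x, eps x = y,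
      forall x, eps x = 0 <-> exists y, d 0%N y = x
    & forall i x, d i x = 0 <-> exists y, d i.+1 y = x].

Definition finite_proj_dim (M : lmodType R) : Prop :=
  exists n, proj_dim_le n M.

(* There is an exact sequence 0 -> M -> E 0 -> E 1 -> ... with all E i
   injective and E i = 0 for i > n. *)
Definition inj_dim_le (n : nat) (M : lmodType R) : Prop :=
  exists (E : nat -> lmodType R)
         (eta : {linear M -> E 0%N}) (d : forall i, {linear E i -> E i.+1}),
  [/\ forall i, injective_module (E i),
      forall i, (n < i)%N -> forall x : E i, x = 0,
      injective eta,
      forall x, d 0%N x = 0 <-> exists y, eta y = x
    & forall i x, d i.+1 x = 0 <-> exists y, d i y = x].

Definition finite_inj_dim (M : lmodType R) : Prop :=
  exists n, inj_dim_le n M.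

End HomologicalDimensions.

(* The definition for Noetherian local rings. *)
Definition gorenstein (R : comNzRingType) : Prop := finite_inj_dim (R^o : lmodType R).

(* M viewed as an A-module through f. *)
Definition restrict_scalars (A B : comNzRingType) (f : {rmorphism A -> B})
  (M : lmodType B) : Type := M.

Section RestrictionOfScalars.
Variables (A B : comNzRingType) (f : {rmorphism A -> B}) (M : lmodType B).
Local Notation fM := (restrict_scalars f M).

HB.instance Definition _ := GRing.Zmodule.on fM.

Let scale (a : A) (x : fM) : fM := f a *: (x : M).

Let scaleA a b x : scale a (scale b x) = scale (a * b) x.
Proof. by rewrite /scale scalerA rmorphM. Qed.
Let scale1 : left_id 1 scale.
Proof. by move=> x; rewrite /scale rmorph1 scale1r. Qed.
Let scaleDr : right_distributive scale +%R.
Proof. by move=> a x y; rewrite /scale scalerDr. Qed.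
Let scaleDl x : {morph scale^~ x : a b / a + b}.
Proof. by move=> a b; rewrite /scale rmorphD scalerDl. Qed.

HB.instance Definition _ :=
  GRing.Zmodule_isLmodule.Build A fM scaleA scale1 scaleDr scaleDl.

End RestrictionOfScalars.

Section Frobenius.
Variables (R : comNzRingType) (p : nat) (charRp : p \in [pchar R]).

(* [charRp] is a phantom argument, on which the ring morphism instance relies. *)
Definition frob_iter (e : nat) : R -> R :=
  let _ := charRp in fun x => x ^+ (p ^ e).

Fact frob_iter_is_zmod_morphism e : zmod_morphism (frob_iter e).
Proof.
have pn : [pchar R].-nat (p ^ e)%N.
  by rewrite (eq_pnat _ (pcharf_eq charRp)) pnatX pnat_id ?orTb ?(pcharf_prime charRp).
by move=> x y; rewrite /frob_iter exprDn_pchar // exprNn_pchar.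
Qed.
Fact frob_iter_is_monoid_morphism e : monoid_morphism (frob_iter e).
Proof. by split=> [|x y]; rewrite /frob_iter ?expr1n ?exprMn. Qed.

HB.instance Definition _ e :=
  GRing.isZmodMorphism.Build R R (frob_iter e) (frob_iter_is_zmod_morphism e).
HB.instance Definition _ e :=
  GRing.isMonoidMorphism.Build R R (frob_iter e) (frob_iter_is_monoid_morphism e).

(* F^e_* R; the element F^e_* r is [r : Fpush e]. *)
Definition Fpush (e : nat) : lmodType R := restrict_scalars (frob_iter e) R^o.

(* Finiteness of F^e_* R does not depend on e > 0. *)
Definition F_finite : Prop := exists e, (0 < e)%N /\ fin_gen (Fpush e).

Definition frob_power (Q : set R) (e : nat) : set R :=
  ideal_gen [set x ^+ (p ^ e) | x in Q].

(* The set I_e(Q). *)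
Definition I_ (e : nat) (Q : set R) : set R :=
  [set r | forall phi : {linear Fpush e -> R^o}, Q (phi (r : Fpush e))].

(* The next two notions are meant for F-finite R, a property inherited by
   quotients.  Splitting of R -> F^e_* R does not depend on e > 0. *)
Definition F_pure : Prop :=
  exists e, (0 < e)%N /\ splits (frob_iter e : R^o -> Fpush e).

Definition strongly_F_regular : Prop :=
  forall c : R,
    (forall P : prime_idealr R, minimal_prime P -> c \notin P) ->
    exists e, (0 < e)%N /\
      splits (fun a : R^o => a *: (c : Fpush e)).

End Frobenius.

Section Quotient.
Variables (R : comNzRingType) (Q : idealr R).

Definition quot_lmod : lmodType R :=
  restrict_scalars (\pi_{ideal_quot Q} : {rmorphism R -> {ideal_quot Q}})
    {ideal_quot Q}^o.

Fact quot_pchar (p : nat) : p \in [pchar R] -> p \in [pchar {ideal_quot Q}].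
Proof. exact: (rmorph_pchar (\pi_{ideal_quot Q} : {rmorphism R -> {ideal_quot Q}})). Qed.

End Quotient.

(* Main.v *)
Require Import Defs.
From HB Require Import structures.
From mathcomp Require Import all_boot all_order all_algebra.
From mathcomp Require Import boolp classical_sets functions.
From mathcomp Require Import ring.
From mathcomp Require Import freeg.
Import GRing.Theory.
Local Open Scope classical_set_scope.
Local Open Scope ring_scope.
Local Open Scope quotient_scope.
Set Implicit Arguments.
Unset Strict Implicit.
Unset Printing Implicit Defensive.

(** Put q = p^e and M = F^e_* R, so that an R-linear map from M to R is an additive map
    f with f(a^q r) = a f(r).  Both criteria follow from two facts.  The dual M^* of M
    is free of rank one over F^e_* R, that is, there is a map Phi such that every f is
    r |-> Phi(s r) for a unique s.  And this persists modulo Q: every map from M to R/Q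
    is the reduction of some Phi(s -), and if Phi(r M) lies in Q, then r lies in
    Q M = Q^[q] ([frobenius_trace]).  So a map from F^e_*(R/Q) to R/Q is the reduction
    of a map Phi(s -) such that Phi(s -) sends Q to Q, which means that s Q lies in
    I_e(Q) = Q^[q]; and as R is local, some multiple of it sends c to 1 if and only if
    Phi(s c) is not in m, that is, some map sends s c outside m.

    The passage modulo Q is a matter of exact complexes.  Choose generators g_i of M
    and a free resolution of M.  The square matrix of the Phi(g_i g_j) splices the
    resolution with its dual into a complex of free modules, which is exact on both
    sides of that matrix because M^* is free on Phi, and to the right of them because
    Ext^i(M, R) = 0 for i > 0.  Tensoring with a module of finite projective
    dimension preserves this exactness, by induction along a projective resolution
    ([fpd_coexact]).  For R/Q, exactness on the two sides of the trace matrix is what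
    is claimed ([power_linear_quot], [trace_quot_nondegenerate]).

    That Ext^i(M, R) vanishes and that M^* is free are the properties of M that need R
    to be Gorenstein.  Let x be a maximal regular sequence in m, d its length, I the
    ideal that it generates, and J the ideal generated by the x_i^q, so that I M = J.
    Finiteness of the injective dimension gives Ext^i(-, R) = 0 for i > d, as R/I
    contains a copy of the residue field ([lifts_step]).  Hence R/I is self-injective,
    and so is R/J ([regseq_self_injective]).  As x is a regular sequence on M, the dual
    of a resolution of M is exact modulo I, thus exact by Nakayama's lemma
    ([coexact_mod_regseq]), and maps from M to R/I lift to R ([plin_extension]).  A
    self-injective local ring has at most a simple socle ([socle_simple]); Phi is
    chosen to send a generator of the socle of R/J to one of the socle of R/I.  It
    generates M^* by Nakayama's lemma over F^e_* R: modulo m, a functional is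
    determined by its restriction to the socle of R/J ([plin_vanishing_on_socle]),
    which is a copy of F^e_* k for the residue field k, and the dual of F^e_* k over k
    has dimension one over F^e_* k ([trace_on_socle]).  That multiplication by s on Phi
    vanishes only for s = 0 holds modulo J and I, since R/I cogenerates, and lifts
    ([trace_nondegenerate]).

    In the second criterion c runs over all nonzero elements of R/Q, while strong
    F-regularity concerns those outside the minimal primes.  If the criterion holds
    then R/Q is a domain, as c d = 0 implies d f(c) = f(c d^q) = 0.  Conversely, a
    strongly F-regular ring is reduced, so that a given c can be completed by some d
    with c d = 0 to a nonzerodivisor c + d ([reduced_complement]); if f(c + d) = 1 then
    f(c) is a unit because the ring is local. *)

(** * Submodules, linear combinations, Noetherian and local rings *)

Definition submodule (R : pzRingType) (V : lmodType R) (K : set V) : Prop :=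
  [/\ K 0, forall x y, K x -> K y -> K (x + y) & forall a x, K x -> K (a *: x)].

Section Submodules.
Variables (R : comNzRingType) (V : lmodType R) (K : set V).
Hypothesis subK : submodule K.

Lemma submod0 : K 0. Proof. by case: subK. Qed.
Lemma submodD x y : K x -> K y -> K (x + y). Proof. by case: subK => _ + _; exact. Qed.
Lemma submodZ a x : K x -> K (a *: x). Proof. by case: subK => _ _; exact. Qed.
Lemma submodN x : K x -> K (- x). Proof. by rewrite -scaleN1r; exact: submodZ. Qed.
Lemma submodB x y : K x -> K y -> K (x - y).
Proof. by move=> Kx Ky; apply: submodD => //; exact: submodN. Qed.
Lemma submod_sum (I : finType) (f : I -> V) : (forall i, K (f i)) -> K (\sum_i f i).
Proof. by move=> Kf; elim/big_ind: _ => //; [exact: submod0|exact: submodD]. Qed.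
Lemma submod_subl x y : K (x - y) -> K y -> K x.
Proof. by move=> h Ky; rewrite -(subrK y x); exact: submodD. Qed.

End Submodules.

Section Ideals.
Variables (R : comNzRingType) (I : set R).
Hypothesis idI : is_ideal I.

Lemma ideal_submod : @submodule R R^o I. Proof. exact: idI. Qed.
Lemma ideal0 : I 0. Proof. exact: submod0 ideal_submod. Qed.
Lemma idealD x y : I x -> I y -> I (x + y). Proof. exact: (submodD ideal_submod). Qed.
Lemma idealM a x : I x -> I (a * x). Proof. exact: (submodZ ideal_submod). Qed.
Lemma idealMl a x : I x -> I (x * a). Proof. by rewrite mulrC; exact: idealM. Qed.
Lemma idealN x : I x -> I (- x). Proof. exact: (submodN ideal_submod). Qed.
Lemma idealB x y : I x -> I y -> I (x - y). Proof. exact: (submodB ideal_submod). Qed.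
Lemma ideal_sum (T : finType) (f : T -> R) : (forall i, I (f i)) -> I (\sum_i f i).
Proof. exact: (submod_sum ideal_submod). Qed.
Lemma ideal_subl x y : I (x - y) -> I y -> I x.
Proof. exact: (submod_subl ideal_submod). Qed.

End Ideals.

Section LinearCombinations.
Variables (R : comNzRingType) (V : lmodType R).

(* The vectors come first, so that the ring of scalars is read off their module. *)
Definition lcomb (T : finType) (z : T -> V) (c : T -> R) : V := \sum_t c t *: z t.

Local Notation lc c z := (lcomb z c).

Lemma lcD (T : finType) (c d : T -> R) (z : T -> V) :
  lc (fun t => c t + d t) z = lc c z + lc d z.
Proof. by rewrite -big_split; apply: eq_bigr => t _; rewrite scalerDl. Qed.
Lemma lcZ (T : finType) a (c : T -> R) (z : T -> V) :
  lc (fun t => a * c t) z = a *: lc c z.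
Proof. by rewrite /lcomb scaler_sumr; apply: eq_bigr => t _; rewrite scalerA. Qed.
Lemma lc0 (T : finType) (z : T -> V) : lc (fun=> 0) z = 0.
Proof. by rewrite /lcomb big1 // => t _; rewrite scale0r. Qed.
Lemma lc1 (T : finType) (z : T -> V) t : lc (fun s => (s == t)%:R) z = z t.
Proof.
rewrite /lcomb (bigD1 t) //= eqxx scale1r big1 ?addr0 // => s /negbTE ->.
by rewrite scale0r.
Qed.
Lemma lcDr (T : finType) (c : T -> R) (y z : T -> V) :
  lc c (fun t => y t + z t) = lc c y + lc c z.
Proof. by rewrite -big_split; apply: eq_bigr => t _; rewrite scalerDr. Qed.
Lemma lcBr (T : finType) (c : T -> R) (y z : T -> V) :
  lc c (fun t => y t - z t) = lc c y - lc c z.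
Proof. by rewrite -sumrB; apply: eq_bigr => t _; rewrite scalerBr. Qed.
Lemma lcZr (T : finType) a (c : T -> R) (z : T -> V) :
  lc c (fun t => a *: z t) = a *: lc c z.
Proof.
by rewrite /lcomb scaler_sumr; apply: eq_bigr => t _; rewrite !scalerA mulrC.
Qed.
Lemma lc0r (T : finType) (c : T -> R) : lc c (fun=> 0) = 0.
Proof. by rewrite /lcomb big1 // => t _; rewrite scaler0. Qed.

Lemma eq_lc (T : finType) (c d : T -> R) (y z : T -> V) :
  c =1 d -> y =1 z -> lc c y = lc d z.
Proof. by move=> cd yz; apply: eq_bigr => t _; rewrite cd yz. Qed.

Lemma lc_sum_type (S T : finType) (c : S + T -> R) (z : S + T -> V) :
  lc c z = lc (c \o inl) (z \o inl) + lc (c \o inr) (z \o inr).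
Proof. exact: big_sumType. Qed.

Lemma submod_lc (K : set V) (T : finType) (c : T -> R) (z : T -> V) :
  submodule K -> (forall t, K (z t)) -> K (lc c z).
Proof. by move=> sK Kz; apply: submod_sum => // t; apply: submodZ. Qed.

Definition span (T : finType) (z : T -> V) : set V :=
  [set x | exists c, x = lc c z].

Lemma span_submod (T : finType) (z : T -> V) : submodule (span z).
Proof.
split; first by exists (fun=> 0); rewrite lc0.
- by move=> _ _ [c ->] [d ->]; exists (fun t => c t + d t); rewrite lcD.
- by move=> a _ [c ->]; exists (fun t => a * c t); rewrite lcZ.
Qed.

Lemma span_gen (T : finType) (z : T -> V) t : span z (z t).
Proof. by exists (fun s => (s == t)%:R); rewrite lc1. Qed.

Definition fgen (K : set V) : Prop :=
  exists (T : finType) (z : T -> V), (forall t, K (z t)) /\ K `<=` span z.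

End LinearCombinations.

Notation lc c z := (lcomb z c).

(** A matrix is a function of two finite indices: [mv A y] is the product with a
    column whose entries lie in any module, [vm v A] the product with a row of
    scalars. *)
Definition mv (R : comNzRingType) (V : lmodType R) (S T : finType)
  (A : S -> T -> R) (y : T -> V) : S -> V := fun s => lc (A s) y.

Definition vm (R : comNzRingType) (S T : finType) (v : S -> R) (A : S -> T -> R) :
  T -> R := fun t => \sum_s v s * A s t.

Section Matrices.
Variables (R : comNzRingType) (V : lmodType R).

Lemma lc_mv (S T : finType) (A : S -> T -> R) (v : S -> R) (y : T -> V) :
  lc v (mv A y) = lc (vm v A) y.
Proof.
rewrite /lcomb /mv /vm /lcomb; under eq_bigr do rewrite scaler_sumr.
rewrite exchange_big /=; apply: eq_bigr => t _; rewrite scaler_suml.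
by apply: eq_bigr => s _; rewrite scalerA.
Qed.

Lemma mvD (S T : finType) (A : S -> T -> R) (y z : T -> V) s :
  mv A (fun t => y t + z t) s = mv A y s + mv A z s.
Proof. exact: lcDr. Qed.
Lemma mvB (S T : finType) (A : S -> T -> R) (y z : T -> V) s :
  mv A (fun t => y t - z t) s = mv A y s - mv A z s.
Proof. exact: lcBr. Qed.
Lemma mvZ (S T : finType) (A : S -> T -> R) a (y : T -> V) s :
  mv A (fun t => a *: y t) s = a *: mv A y s.
Proof. exact: lcZr. Qed.
Lemma mv0 (S T : finType) (A : S -> T -> R) s : mv A (fun=> 0 : V) s = 0.
Proof. exact: lc0r. Qed.
Lemma mv_lc (S T U : finType) (A : S -> T -> R) (c : U -> R) (z : U -> T -> V) s :
  mv A (fun t => lc c (z^~ t)) s = lc c (fun u => mv A (z u) s).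
Proof.
rewrite /mv /lcomb; under eq_bigr do rewrite scaler_sumr.
rewrite exchange_big /=; apply: eq_bigr => t _; rewrite scaler_sumr.
by apply: eq_bigr => u _; rewrite !scalerA mulrC.
Qed.

Lemma vmB (S T : finType) (v w : S -> R) (A : S -> T -> R) t :
  vm (fun s => v s - w s) A t = vm v A t - vm w A t.
Proof. by rewrite -sumrB; apply: eq_bigr => s _; rewrite mulrBl. Qed.
Lemma vmZ (S T : finType) a (v : S -> R) (A : S -> T -> R) t :
  vm (fun s => a * v s) A t = a * vm v A t.
Proof. by rewrite /vm mulr_sumr; apply: eq_bigr => s _; rewrite mulrA. Qed.
Lemma vm_vm (S T U : finType) (v : S -> R) (A : S -> T -> R) (B : T -> U -> R) u :
  vm (vm v A) B u = vm v (fun s => vm (A s) B) u.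
Proof.
rewrite /vm; under eq_bigr do rewrite mulr_suml.
rewrite exchange_big /=; apply: eq_bigr => s _; rewrite mulr_sumr.
by apply: eq_bigr => t _; rewrite mulrA.
Qed.
Lemma vm1 (S T : finType) (A : S -> T -> R) s t :
  vm (fun s' => (s' == s)%:R) A t = A s t.
Proof.
rewrite /vm (bigD1 s) //= eqxx mul1r big1 ?addr0 // => i /negbTE ->.
by rewrite mul0r.
Qed.

End Matrices.

Lemma linear_lc (R : comNzRingType) (U V : lmodType R) (f : {linear U -> V})
  (T : finType) (c : T -> R) (z : T -> U) : f (lc c z) = lc c (f \o z).
Proof. by rewrite /lcomb linear_sum; apply: eq_bigr => t _; rewrite linearZ. Qed.

Lemma ideal_vm (R : comNzRingType) (I : set R) (S T : finType) (v : S -> R)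
  (A : S -> T -> R) t : is_ideal I -> (forall s, I (v s)) -> I (vm v A t).
Proof. by move=> iI Iv; apply: ideal_sum => // s; apply: idealMl. Qed.

Section Noetherian.
Variable R : comNzRingType.
Hypothesis nR : noetherian R.

Lemma noeth_fgen (I : set R) : is_ideal I -> @fgen R R^o I.
Proof.
move=> iI; have [s Is] := nR iI.
exists 'I_(size s), (fun i : 'I_(size s) => s`_(nat_of_ord i)); split=> [i|x].
  rewrite Is; exists 1%N, (fun=> 1), (fun=> s`_i); split=> [j|].
    by apply: mem_nth.
  by rewrite big_ord1 mul1r.
rewrite {1}Is => -[n [a [t [st ->]]]].
apply: (@submod_sum _ R^o) => [|i]; first exact: span_submod.
apply: (@submodZ _ R^o _ (@span_submod _ R^o _ _)).
have it : (index (t i) s < size s)%N by rewrite index_mem st.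
rewrite -(nth_index 0 (st i)).
exact: (@span_gen R R^o _ (fun i : 'I_(size s) => s`_(nat_of_ord i)) (Ordinal it)).
Qed.

Lemma noeth_max (F : set (set R)) I0 : (forall I, F I -> is_ideal I) -> F I0 ->
  exists2 I, F I & forall J, F J -> I `<=` J -> J `<=` I.
Proof.
move=> Fid FI0; apply: contrapT => hn.
have next : forall I : {I | F I}, {J : {I | F I} |
    sval I `<=` sval J /\ ~ (sval J `<=` sval I)}.
  move=> [I FI]; apply: cid; apply: contrapT => hJ; apply: hn; exists I => // J FJ IJ.
  by apply: contrapT => nJI; apply: hJ; exists (exist _ J FJ).
pose c k := iter k (fun I => sval (next I)) (exist _ I0 FI0).
have step k : sval (c k) `<=` sval (c k.+1) by case: (svalP (next (c k))).
have mono j k : (j <= k)%N -> sval (c j) `<=` sval (c k).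
  move=> /subnK <-; elim: (k - j)%N => [|i IH] x cx //.
  by rewrite addSn; apply: step; apply: IH.
have ci k : is_ideal (sval (c k)) by apply: Fid; exact: svalP (c k).
pose U : set R := [set x | exists k, sval (c k) x].
have iU : is_ideal U.
  split; first by exists 0%N; exact: ideal0.
  - move=> x y [j cx] [k cy]; exists (maxn j k); apply: idealD => //.
    + by apply: mono cx; exact: leq_maxl.
    + by apply: mono cy; exact: leq_maxr.
  - by move=> a x [k cx]; exists k; exact: idealM.
have [T [z [Uz Usp]]] := noeth_fgen iU.
have [k hk] := choice Uz.
pose N := \max_t k t.
have UN : U `<=` sval (c N).
  move=> x /Usp [a ->]; apply: (@submod_lc _ R^o); first exact: ci.
  move=> t; apply: mono (hk t); exact: leq_bigmax.
have [_ nN] := svalP (next (c N)); apply: nN => x cx; apply: UN.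
by exists N.+1.
Qed.

(** Submodules of the free module on a finite set [T] are finitely generated: if all
    their elements vanish outside [A], the coordinates at a point [t] of [A] form a
    finitely generated ideal, and the elements vanishing at [t] live on a smaller set. *)
Lemma noeth_fgen_vec (T : finType) (K : set (T -> R^o)) :
  submodule K -> fgen K.
Proof.
move=> sK; suff: forall n (A : {set T}) (K : set (T -> R^o)), #|A| = n ->
    submodule K -> (forall v, K v -> forall t, t \notin A -> v t = 0) -> fgen K.
  by move=> /(_ _ (finset.setT : {set T}) K erefl sK); apply=> v _ t; rewrite finset.in_setT.
elim=> [|n IH] A {}K cA {}sK suppK.
  exists void, (of_void _); split=> [[]|v Kv]; exists (of_void _).
  rewrite /lcomb big_pred0; last by case.
  by apply/funext => t; apply: (suppK v) => //; rewrite (cards0_eq cA) inE.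
have [t tA] : exists t, t \in A by apply/set0Pn; rewrite -card_gt0 cA.
pose J : set R := [set r | exists2 v, K v & v t = r].
have iJ : is_ideal J.
  split; first by exists 0 => //; exact: submod0.
  - by move=> _ _ [v Kv <-] [w Kw <-]; exists (v + w) => //; exact: submodD.
  - by move=> a _ [v Kv <-]; exists (a *: v) => //; exact: submodZ.
have [S [z [Jz Jsp]]] := noeth_fgen iJ.
have hu s : exists v : T -> R^o, K v /\ v t = z s by have [v] := Jz s; exists v.
have [u hu'] := choice hu; have Ku s := (hu' s).1; have ut s := (hu' s).2.
pose K' : set (T -> R^o) := [set v | K v /\ v t = 0].
have sK' : submodule K'.
  split; first by split => //; exact: submod0.
  - move=> x y [Kx x0] [Ky y0]; split; first exact: submodD.
    by rewrite addrfctE x0 y0 addr0.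
  - by move=> a x [Kx x0]; split; [exact: submodZ|rewrite scalrfctE x0 scaler0].
have [] := IH (A :\ t) K' _ sK'.
- by move: cA; rewrite (cardsD1 t) tA => -[].
- move=> v [Kv v0] s; rewrite !inE negb_and negbK => /orP[/eqP -> //|].
  exact: suppK.
move=> S' [z' [Kz' K'sp]].
exists (S + S')%type, (fun i => match i with inl s => u s | inr s => z' s end).
split=> [[s|s]|v Kv]; [exact: Ku|by case: (Kz' s)|].
have [c vc] := Jsp (v t) (ex_intro2 _ _ v Kv erefl).
have [|d vd] := K'sp (v - lc c u).
  split; first by apply: submodB => //; exact: submod_lc.
  rewrite addrfctE opprfctE /= vc /lcomb fct_sumE; apply/eqP; rewrite subr_eq0.
  by apply/eqP; apply: eq_bigr => s _; rewrite -ut scalrfctE.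
exists (fun i => match i with inl s => c s | inr s => d s end).
by rewrite lc_sum_type /= -[LHS](subrK (lc c u)) vd addrC.
Qed.

Lemma syzygies_exist (S T : finType) (A : S -> T -> R) :
  exists (U : finType) (B : U -> S -> R), forall v : S -> R,
    (forall t, vm v A t = 0) <-> exists c, v =1 vm c B.
Proof.
pose K : set (S -> R^o) := [set v | forall t, vm v A t = 0].
have sK : submodule K.
  split=> [t|x y Kx Ky t|a x Kx t].
  - by rewrite /vm big1 // => s _; rewrite mul0r.
  - rewrite -[RHS](addr0 0) -{1}(Kx t) -(Ky t) -big_split /=.
    by apply: eq_bigr => s _; rewrite mulrDl.
  - by rewrite -(mulr0 a) -(Kx t) -vmZ.
have [U [B [KB Ksp]]] := noeth_fgen_vec sK.
exists U, B => v; split=> [/Ksp[c ->]|[c vc]].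
  by exists c => s; rewrite /lcomb fct_sumE.
have -> : v = (lc c B : S -> R) by apply/funext => s; rewrite vc /lcomb fct_sumE.
exact: (submod_lc c sK KB).
Qed.

End Noetherian.

Section Local.
Variables (R : comNzRingType) (m : idealr R).
Hypotheses (nR : noetherian R) (lR : local_ring m).

Lemma local_unit x : x \notin m -> exists y, y * x = 1.
Proof.
move=> xm; apply: contrapT => nu.
pose F : set (set R) := [set I | [/\ is_ideal I, I x & ~ I 1]].
have FX : F [set r | exists y, r = y * x].
  split; last by move=> [y y1]; apply: nu; exists y.
    split; first by exists 0; rewrite mul0r.
    - by move=> _ _ [a ->] [b ->]; exists (a + b); rewrite mulrDl.
    - by move=> a _ [b ->]; exists (a * b); rewrite mulrA.
  by exists 1; rewrite mul1r.
have Fid I : F I -> is_ideal I by case.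
have [I [iI Ix I1] Imax] := noeth_max nR Fid FX.
pose p : R -> bool := fun r => `[< I r >].
have pc : idealr_closed p.
  split; rewrite ?unfold_in; [by apply/asboolP; exact: ideal0|by apply/negP => /asboolP|].
  move=> a u v /asboolP Iu /asboolP Iv; apply/asboolP.
  by apply: idealD => //; exact: idealM.
pose pI := isIdealr.Build R p pc.
pose M : idealr R := HB.pack p pI.
have memM r : (r \in M) = `[< I r >] by [].
have : maximal_ideal M.
  move=> J MJ r Jr; rewrite memM; apply/asboolP.
  apply: (Imax [set` J]) => //=.
  - split=> //=; [|by apply: MJ; rewrite memM; apply/asboolP|by rewrite idealr1].
    by split=> [|a b|a b]; rewrite /= ?idealr0 //; [exact: rpredD|exact: idealMr].
  - by move=> s Is; apply: MJ; rewrite memM; apply/asboolP.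
move=> /(lR.2) /(_ x) mx; move: xm; rewrite -mx memM.
by move/negP; apply; apply/asboolP.
Qed.

Lemma local_sub I x : is_ideal I -> ~ I 1 -> I x -> x \in m.
Proof.
move=> iI I1 Ix; apply: contrapT => /negP /local_unit [y yx].
by apply: I1; rewrite -yx; exact: idealM.
Qed.

Lemma max_ideal_set : is_ideal [set` m].
Proof.
by split=> [|a b|a b]; rewrite /= ?idealr0 //; [exact: rpredD|exact: idealMr].
Qed.

Lemma local_prime x y : x * y \in m -> (x \in m) \/ (y \in m).
Proof.
move=> xy; apply: contrapT => /not_orP[/negP nx /negP ny].
have [a ax] := local_unit nx; have [b yb] := local_unit ny.
have : (a * b) * (x * y) \in m by exact: idealMr.
have -> : a * b * (x * y) = (a * x) * (b * y) by ring.
by rewrite ax yb mulr1 idealr1.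
Qed.

Lemma local_primeX x n : x ^+ n \in m -> x \in m.
Proof.
elim: n => [|n IH]; first by rewrite expr0 idealr1.
by rewrite exprS => /local_prime[|/IH].
Qed.

Lemma local_1B c : c \in m -> exists u, u * (1 - c) = 1.
Proof.
move=> cm; apply: local_unit; apply/negP => h.
by have := rpredD h cm; rewrite subrK idealr1.
Qed.

(** Nakayama's lemma.  The relations are solved one generator at a time: in the
    relation of [z t] the coefficient [1 - c t] is a unit. *)
Lemma nakayama (V : lmodType R) (B : set V) (T : finType) (z : T -> V) :
  submodule B ->
  (forall k, exists c : T -> R, (forall l, c l \in m) /\ B (z k - lc c z)) ->
  forall k, B (z k).
Proof.
move=> sB hz; suff: forall n (A : {set T}), #|A| = n ->
    (forall k, k \in A -> exists c : T -> R, (forall l, c l \in m) /\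
        B (z k - \sum_(l in A) c l *: z l)) -> forall k, k \in A -> B (z k).
  move=> /(_ _ (finset.setT : {set T}) erefl) h k; apply: h => // {}k _.
  have [c [cm Bc]] := hz k; exists c; split=> //.
  by move: Bc; rewrite /lcomb; congr (B (_ - _)); apply: eq_bigl => l; rewrite inE.
elim=> [|n IH] A cA hA; first by move=> k; rewrite (cards0_eq cA) inE.
have [t tA] : exists t, t \in A by apply/set0Pn; rewrite -card_gt0 cA.
have [c [cm Bc]] := hA t tA.
have [u uc] := local_1B (cm t).
have Bt : B (z t - \sum_(l in A :\ t) (u * c l) *: z l).
  have := submodZ sB u Bc; rewrite (big_setD1 t) //= opprD addrA scalerBr.
  rewrite -{1}[z t]scale1r -scalerBl scalerA uc scale1r scaler_sumr.
  by congr (B (_ - _)); apply: eq_bigr => l _; rewrite scalerA.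
have BA : forall k, k \in A :\ t -> B (z k).
  apply: (IH (A :\ t)); first by move: cA; rewrite (cardsD1 t) tA => -[].
  move=> k; rewrite !inE => /andP[_ kA].
  have [d [dm Bd]] := hA k kA.
  exists (fun l => d l + d t * (u * c l)); split.
    by move=> l; rewrite rpredD // !idealMr.
  have cancel (x y v w : V) : x - (y + v) + (y - w) = x - (v + w).
    by rewrite !opprD !addrA (addrAC (x - y)) subrK.
  have := submodD sB Bd (submodZ sB (d t) Bt); rewrite (big_setD1 t) //=.
  rewrite scalerBr cancel; congr (B (_ - _)).
  rewrite scaler_sumr -big_split /=; apply: eq_bigr => l _.
  by rewrite scalerA scalerDl.
move=> k kA; have [->|kt] := eqVneq k t; last by apply: BA; rewrite !inE kt.
apply: (submod_subl sB Bt); elim/big_ind: _ => [||l lA].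
- exact: submod0.
- by move=> *; exact: submodD.
- by apply: submodZ => //; exact: BA.
Qed.

(** The form in which Nakayama's lemma kills a homology module Z/B. *)
Lemma nakayama_quot (V : lmodType R) (Z B : set V) (T : finType) (z : T -> V) :
  submodule Z -> submodule B ->
  (forall t, Z (z t)) -> (forall v, Z v -> exists2 w, span z w & B (v - w)) ->
  (forall v, Z v -> exists a w, [/\ a \in m, Z w & B (v - a *: w)]) ->
  Z `<=` B.
Proof.
move=> sZ sB Zz Zsp hdiv.
suff Bz : forall t, B (z t).
  move=> v /Zsp[w [c ->] Bvw]; apply: (submod_subl sB Bvw).
  exact: submod_lc.
apply: nakayama => // k; have [a [w [am Zw Bw]]] := hdiv _ (Zz k).
have [_ [c ->] Bc] := Zsp w Zw; exists (fun t => a * c t); split.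
  by move=> l; rewrite mulrC idealMr.
rewrite lcZ -[z k](subrK (a *: w)) -addrA -scalerBr.
by apply: submodD => //; exact: submodZ.
Qed.

End Local.

(** * Regular sequences and maximal ones in a local ring *)

Definition adj (R : comNzRingType) (K : set R) (x : R) : set R :=
  [set r | exists k s, K k /\ r = k + x * s].

Definition adjs (R : comNzRingType) (K : set R) (xs : seq R) : set R :=
  foldl (@adj R) K xs.

Definition ann_mod (R : comNzRingType) (K : set R) (b : R) : set R :=
  [set r | K (r * b)].

Definition nzd_mod (R : comNzRingType) (K : set R) (x : R) : Prop :=
  forall r, K (x * r) -> K r.

Fixpoint regseq (R : comNzRingType) (K : set R) (xs : seq R) : Prop :=
  if xs is x :: xs' then nzd_mod K x /\ regseq (adj K x) xs' else True.

Section RegularSequences.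
Variable R : comNzRingType.
Implicit Types (K : set R) (x : R) (xs : seq R).

Lemma ideal_zero : is_ideal [set 0 : R].
Proof. by split=> [|x y -> ->|a x ->] //=; rewrite ?addr0 ?mulr0. Qed.

Lemma adj_ideal K x : is_ideal K -> is_ideal (adj K x).
Proof.
move=> iK; split.
- by exists 0, 0; split; [exact: ideal0|rewrite mulr0 addr0].
- move=> _ _ [k [s [Kk ->]]] [l [t [Kl ->]]]; exists (k + l), (s + t).
  by split; [exact: idealD|ring].
- by move=> a _ [k [s [Kk ->]]]; exists (a * k), (a * s); split; [exact: idealM|ring].
Qed.

Lemma adj_sub K x : K `<=` adj K x.
Proof. by move=> k Kk; exists k, 0; rewrite mulr0 addr0. Qed.

Lemma adj_mem K x s : is_ideal K -> adj K x (x * s).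
Proof. by move=> iK; exists 0, s; split; [exact: ideal0|rewrite add0r]. Qed.

Lemma adj_self K x : is_ideal K -> adj K x x.
Proof. by move=> iK; have := adj_mem x 1 iK; rewrite mulr1. Qed.

Lemma adj_min K I x : is_ideal I -> K `<=` I -> I x -> adj K x `<=` I.
Proof.
move=> iI KI Ix _ [k [s [/KI Ik ->]]]; apply: idealD => //.
exact: idealMl.
Qed.

Lemma adjs_ideal K xs : is_ideal K -> is_ideal (adjs K xs).
Proof. by elim: xs K => //= x xs IH K iK; apply/IH/adj_ideal. Qed.

Lemma adjs_min K I xs : is_ideal I -> K `<=` I -> (forall x, x \in xs -> I x) ->
  adjs K xs `<=` I.
Proof.
move=> iI; elim: xs K => //= x xs IH K KI Ixs; apply: IH.
  by apply: adj_min => //; apply: Ixs; rewrite mem_head.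
by move=> y yxs; apply: Ixs; rewrite inE yxs orbT.
Qed.

Lemma adjs_rcons K xs x : adjs K (rcons xs x) = adj (adjs K xs) x.
Proof. by rewrite /adjs foldl_rcons. Qed.

Lemma regseq_rcons K xs x :
  regseq K (rcons xs x) <-> regseq K xs /\ nzd_mod (adjs K xs) x.
Proof.
elim: xs K => [|y xs IH] K /=; first by split=> [[]|[]].
by rewrite IH; split=> [[? [? ?]]|[[? ?] ?]].
Qed.

Lemma adjC K x y : adj (adj K x) y = adj (adj K y) x.
Proof.
have sub u v : adj (adj K u) v `<=` adj (adj K v) u.
  move=> _ [_ [s [[k [t [Kk ->]]] ->]]]; exists (k + v * s), t.
  by split; [exists k, s|ring].
by apply/seteqP; split; exact: sub.
Qed.

Lemma ann_mod_ideal K b : is_ideal K -> is_ideal (ann_mod K b).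
Proof.
move=> iK; rewrite /ann_mod; split=> /=.
- by rewrite mul0r; exact: ideal0.
- by move=> x y Kx Ky; rewrite mulrDl; exact: idealD.
- by move=> a x Kx; rewrite -mulrA; exact: idealM.
Qed.

(** A sequence regular on both ends of 0 -> R/(K : b) -> R/K -> R/(K + b) -> 0 is
    regular in the middle, and dividing by its first element keeps the sequence exact. *)
Lemma regseq_extension K b xs : is_ideal K ->
  regseq (ann_mod K b) xs -> regseq (adj K b) xs -> regseq K xs.
Proof.
elim: xs K => //= x xs IH K iK [x1 r1] [x2 r2].
have xK : nzd_mod K x.
  move=> r Kxr; have [k [s [Kk rE]]] := x2 r (adj_sub b Kxr).
  rewrite rE; apply: idealD => //; rewrite mulrC; apply: x1.
  rewrite /ann_mod /= -(_ : x * r - x * k = x * s * b); last by rewrite rE; ring.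
  by apply: idealB => //; exact: idealM.
split=> //; apply: IH; first exact: adj_ideal.
- suff -> : ann_mod (adj K x) b = adj (ann_mod K b) x by [].
  apply/seteqP; split=> r.
    move=> [k [s [Kk rb]]].
    have [|k' [t [Kk' sE]]] := x2 s.
      exists (- k), r; split; first exact: idealN.
      by rewrite [b * r]mulrC rb; ring.
    exists (r - x * t), t; split; last by ring.
    rewrite /ann_mod /= -(_ : k + x * k' = (r - x * t) * b).
      by apply: idealD => //; exact: idealM.
    by rewrite mulrBl rb sE; ring.
  move=> [k [s [Kk ->]]]; exists (k * b), (s * b); split=> //; ring.
- by rewrite adjC.
Qed.

(** By induction on the exponent: the multiples of x^(n+1) in R/(K + x^(n+2)) form a copy
    of R/(K + x), with quotient R/(K + x^(n+1)). *)
Lemma regseq_expr_head K x xs n : is_ideal K ->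
  regseq K (x :: xs) -> regseq K (x ^+ n.+1 :: xs).
Proof.
move=> iK [xK rxs]; have xnK k : nzd_mod K (x ^+ k).
  elim: k => [|k IH] r; first by rewrite mul1r.
  by rewrite exprS -mulrA => /xK/IH.
split=> //; elim: n => [|n IH] //.
apply: (@regseq_extension _ (x ^+ n.+1)); first exact: adj_ideal.
- suff -> : ann_mod (adj K (x ^+ n.+2)) (x ^+ n.+1) = adj K x by [].
  apply/seteqP; split=> r.
    move=> [k [s [Kk rE]]]; exists (r - x * s), s; split; last by ring.
    apply: (xnK n.+1); rewrite mulrBr [_ * r]mulrC rE [x ^+ n.+2]exprS.
    by rewrite (_ : _ - _ = k) //; ring.
  move=> [k [s [Kk ->]]]; exists (k * x ^+ n.+1), s.
  by split; [exact: idealMl|rewrite [x ^+ n.+2]exprS; ring].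
- suff -> : adj (adj K (x ^+ n.+2)) (x ^+ n.+1) = adj K (x ^+ n.+1) by [].
  apply/seteqP; split.
    apply: adj_min; first exact: adj_ideal.
    + apply: adj_min; [exact: adj_ideal|exact: adj_sub|].
      by rewrite [x ^+ n.+2]exprSr; exact: adj_mem.
    + by rewrite -[X in adj _ _ X]mulr1; exact: adj_mem.
  by move=> _ [k [s [Kk ->]]]; exists k, s; split=> //; exact: adj_sub.
Qed.

Lemma regseq_expr K xs n : is_ideal K ->
  regseq K xs -> regseq K [seq x ^+ n.+1 | x <- xs].
Proof.
elim: xs K => //= x xs IH K iK rx.
have [xK rxs] := regseq_expr_head n iK rx.
by split=> //; apply: IH => //; exact: adj_ideal.
Qed.

End RegularSequences.

Definition primeset (R : comNzRingType) (P : set R) : Prop :=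
  [/\ is_ideal P, ~ P 1 & forall a b, P (a * b) -> P a \/ P b].

Lemma primeset_prod (R : comNzRingType) (P : set R) (T : finType) (A : {set T})
    (f : T -> R) :
  primeset P -> P (\prod_(s in A) f s) -> exists2 s, s \in A & P (f s).
Proof.
move=> [_ P1 pP]; apply: contraPP => nA; elim/big_ind: _ => [//||s sA].
  by move=> x y nx ny /pP[].
by move=> Pf; apply: nA; exists s.
Qed.

Section PrimeAvoidance.
Variables (R : comNzRingType) (T : finType) (P : T -> set R).
Hypothesis pP : forall t, primeset (P t).

Let iP t : is_ideal (P t). Proof. by case: (pP t). Qed.

Lemma prime_avoidance (M : set R) : is_ideal M ->
  M `<=` [set r | exists t, P t r] -> exists t, M `<=` P t.
Proof.
move=> iM MP; suff: forall n (A : {set T}), (#|A| <= n)%N ->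
    M `<=` [set r | exists2 t, t \in A & P t r] -> exists t, M `<=` P t.
  move=> /(_ _ (finset.setT : {set T}) (leqnn _)); apply=> r /MP[t Pt].
  by exists t; rewrite ?finset.in_setT.
elim=> [|n IH] A cA MA.
  have [t] := MA 0 (ideal0 iM).
  by move: cA; rewrite leqn0 cards_eq0 => /eqP ->; rewrite inE.
have [[t [tA Mt]]|h] := pselect (exists t, t \in A /\
    M `<=` [set r | exists2 s, s \in A :\ t & P s r]).
  by apply: (IH (A :\ t)) => //; move: cA; rewrite (cardsD1 t) tA.
have hx t : exists r, t \in A -> M r /\ forall s, s \in A -> s != t -> ~ P s r.
  have [tA|tA] := boolP (t \in A); last by exists 0.
  apply: contrapT => nr; apply: h; exists t; split=> // r Mr.
  apply: contrapT => nP; apply: nr; exists r => _; split=> // s sA st Ps.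
  by apply: nP; exists s; rewrite // !inE st.
have [[t [tA sing]]|h2] := pselect (exists t, t \in A /\ forall s, s \in A -> s = t).
  by exists t => r /MA[s sA]; rewrite (sing s sA).
have [x hx'] := choice hx.
have xP t : t \in A -> P t (x t).
  move=> tA; have [Mx nP] := hx' t tA; have [s sA Ps] := MA _ Mx.
  by have [st|st] := eqVneq s t; [rewrite st in Ps|case: (nP s sA st)].
have [t tA Pt0] := MA 0 (ideal0 iM).
have [u uA ut] : exists2 u, u \in A & u != t.
  apply: contrapT => nu; apply: h2; exists t; split=> // s sA.
  by apply: contrapT => /eqP st; apply: nu; exists s.
(* the sum avoids [P t] because of its second term, and the other primes because of
   the first *)
pose y := x t + \prod_(s in A :\ t) x s.
have My : M y.
  apply: idealD => //; first by case: (hx' t tA).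
  rewrite (big_setD1 u) /= ?inE ?ut //; apply: idealMl => //.
  by case: (hx' u uA).
have [v vA Pv] := MA y My.
have [vt|vt] := eqVneq v t.
  rewrite vt in Pv; have : P t (\prod_(s in A :\ t) x s).
    by have := idealB (iP t) Pv (xP t tA); rewrite /y addrC addKr.
  move=> /(primeset_prod (pP t))[s]; rewrite !inE => /andP[st sA].
  have [_ /(_ t tA)] := hx' s sA; rewrite eq_sym st => /(_ isT) nP Pts.
  by case: nP.
have : P v (x t).
  have Pprod : P v (\prod_(s in A :\ t) x s).
    rewrite (big_setD1 v) /= ?inE ?vt //; apply: idealMl => //; exact: xP.
  by have := idealB (iP v) Pv Pprod; rewrite /y addrK.
by have [_ /(_ v vA vt)] := hx' t tA.
Qed.

End PrimeAvoidance.

Section Depth.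
Variables (R : comNzRingType) (m : idealr R).
Hypothesis nR : noetherian R.

Definition socle_mod (I : set R) (s : R) : Prop :=
  ~ I s /\ forall a, a \in m -> I (a * s).

(** The annihilators of elements of R/I that are maximal among such are prime, they
    cover the zero divisors, and there are finitely many of them: once the submodule
    generated by elements [z t] with maximal annihilators is as large as possible, any
    further such annihilator contains the intersection of those of the [z t].  By
    prime avoidance, if m consists of zero divisors then it is one of them. *)
Lemma nzd_or_socle (I : set R) : is_ideal I -> ~ I 1 ->
  (exists2 a, a \in m & nzd_mod I a) \/ exists s, socle_mod I s.
Proof.
move=> iI I1; have [[a am na]|hn] := pselect (exists2 a, a \in m & nzd_mod I a).
  by left; exists a.
right; pose maxann z := ~ I z /\
  forall r, ~ I r -> ann_mod I z `<=` ann_mod I r -> ann_mod I r `<=` ann_mod I z.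
have iann z := ann_mod_ideal z iI.
have exmax r : ~ I r -> exists z, maxann z /\ ann_mod I r `<=` ann_mod I z.
  move=> Ir; pose F : set (set R) := [set L | exists z,
    [/\ ~ I z, ann_mod I r `<=` ann_mod I z & L = ann_mod I z]].
  have idF L : F L -> is_ideal L by move=> [z [_ _ ->]].
  have Fr : F (ann_mod I r) by exists r; split.
  have [_ [z [Iz rz ->]] zmax] := noeth_max nR idF Fr.
  exists z; split=> //; split=> // w Iw zw; apply: zmax => //.
  by exists w; split=> // a /rz/zw.
have prime z : maxann z -> primeset (ann_mod I z).
  move=> [Iz zmax]; split=> //; first by rewrite /ann_mod /= mul1r.
  move=> a b abz; have [Ib|Ib] := pselect (I (b * z)); first by right.
  left; apply: (zmax (b * z)) => //; last by rewrite /ann_mod /= mulrA.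
  move=> r rz; rewrite /ann_mod /= (_ : r * (b * z) = b * (r * z)); last by ring.
  exact: idealM.
(* finite families with maximal annihilators, represented by the ideals they generate *)
pose F : set (set R) := [set L | exists (T : finType) (z : T -> R^o),
  (forall t, maxann (z t)) /\ L = span z].
have idF L : F L -> is_ideal L.
  by move=> [T [z [_ ->]]]; exact: (@span_submod _ R^o).
have F0 : F (span (of_void R^o)) by exists void, (of_void R^o); split=> // [[]].
have [_ [T [z [zmax ->]]] Fmax] := noeth_max nR idF F0.
have cover w : maxann w -> exists t, ann_mod I w `<=` ann_mod I (z t).
  move=> wmax; pose z' (t : option T) : R^o := if t is Some t then z t else w.
  have Fz' : F (span z').
    by exists (option T : finType), z'; split=> // -[t|] /=; [exact: zmax|].
  have zz' : span z `<=` span z'.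
    move=> _ [c ->]; apply: (@submod_lc _ R^o); first exact: span_submod.
    by move=> t; apply: (@span_gen R R^o _ z' (Some t)).
  have [c wE] := Fmax _ Fz' zz' w (@span_gen R R^o _ z' None).
  have [t zw] : exists t, ann_mod I (z t) `<=` ann_mod I w.
    apply: contrapT => nt.
    have /choice[a ha] : forall t, exists a, ann_mod I (z t) a /\ ~ ann_mod I w a.
      move=> t; apply: contrapT => na; apply: nt; exists t => a az.
      by apply: contrapT => aw; apply: na; exists a.
    have : ann_mod I w (\prod_(t in (finset.setT : {set T})) a t).
      rewrite /ann_mod /= wE /lcomb mulr_sumr; apply: ideal_sum => // t.
      rewrite (bigD1 t) /= ?finset.in_setT //.
      set b := \prod_(_ | _) _; rewrite (_ : _ * _ = (b * c t) * (a t * z t)).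
        by apply: idealM => //; case: (ha t).
      by rewrite /GRing.scale /=; ring.
    by move=> /(primeset_prod (prime w wmax))[t _]; case: (ha t).
  by exists t; apply: (zmax t).2 => //; exact: wmax.1.
have mcover : [set` m] `<=` [set r | exists t, ann_mod I (z t) r].
  move=> a /= am; have [b [Iab Ib]] : exists b, I (a * b) /\ ~ I b.
    apply: contrapT => nb; apply: hn; exists a => // b Iab.
    by apply: contrapT => Ib; apply: nb; exists b.
  have [w [wmax bw]] := exmax b Ib; have [t wt] := cover w wmax.
  by exists t; apply/wt/bw.
have [t mt] := prime_avoidance (fun t => prime _ (zmax t)) (max_ideal_set m) mcover.
by exists (z t); split; [case: (zmax t)|exact: mt].
Qed.

Lemma maximal_regseq : exists xs : seq R,
  [/\ regseq [set 0] xs, forall x, x \in xs -> x \in m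
    & exists s, socle_mod (adjs [set 0] xs) s].
Proof.
pose F : set (set R) := [set L | exists xs : seq R,
  [/\ regseq [set 0] xs, forall x, x \in xs -> x \in m & L = adjs [set 0] xs]].
have idF L : F L -> is_ideal L.
  by move=> [xs [_ _ ->]]; apply/adjs_ideal/ideal_zero.
have F0 : F [set 0] by exists [::].
have [_ [xs [rxs xsm ->]] Lmax] := noeth_max nR idF F0.
have iL : is_ideal (adjs [set 0] xs) by apply/adjs_ideal/ideal_zero.
have L1 : ~ adjs [set 0] xs 1.
  have Lm : adjs [set 0] xs `<=` [set` m].
    by apply: adjs_min => //; [exact: max_ideal_set|move=> _ ->; exact: idealr0].
  by move=> /Lm /=; rewrite idealr1.
exists xs; split=> //; have [[a am na]|//] := nzd_or_socle iL L1.
have Fa : F (adj (adjs [set 0] xs) a).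
  exists (rcons xs a); rewrite adjs_rcons; split=> //; first exact/regseq_rcons.
  by move=> x; rewrite mem_rcons inE => /orP[/eqP ->//|/xsm].
case: L1; apply: na; rewrite mulr1; apply: (Lmax _ Fa); first exact: adj_sub.
exact: adj_self.
Qed.

End Depth.

(** * Injective modules *)

Section SubmoduleType.
Variables (R : comNzRingType) (W : lmodType R) (K : set W) (sK : submodule K).

(* The proof that [K] is a submodule is a phantom argument of the predicate, so that
   the instances below can be inferred from the type. *)
Definition submod_pred : {pred W} := let _ := sK in fun x => `[< K x >].

Fact submod_pred_closed : submod_closed submod_pred.
Proof.
split; first by rewrite unfold_in; apply/asboolP; exact: submod0.
move=> a x y; rewrite !unfold_in => /asboolP Kx /asboolP Ky; apply/asboolP.
by apply: submodD => //; exact: submodZ.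
Qed.

HB.instance Definition _ :=
  GRing.isSubmodClosed.Build R W submod_pred submod_pred_closed.

Record submod_type := SubmodType {submod_val : W; _ : submod_val \in submod_pred}.

HB.instance Definition _ := [isSub for submod_val].
HB.instance Definition _ := [Choice of submod_type by <:].
HB.instance Definition _ := [SubChoice_isSubLmodule of submod_type by <:].

Lemma submod_valP (x : submod_type) : K (submod_val x).
Proof. by case: x => x px; apply/asboolP; exact: px. Qed.

Lemma submod_lift x : K x -> exists u : submod_type, submod_val u = x.
Proof.
move=> Kx; have kx : x \in submod_pred by rewrite unfold_in; apply/asboolP.
by exists (SubmodType kx).
Qed.

End SubmoduleType.

Section InjectiveModules.
Variables (R : comNzRingType) (E : lmodType R).
Hypothesis iE : injective_module E.

(** The graph G is the source of the two maps to which injectivity applies: its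
    projection to V is injective, and its projection to E is the map to extend. *)
Lemma injective_graph (V : lmodType R) (G : set (V * E)) : submodule G ->
  (forall e, G (0, e) -> e = 0) ->
  exists h : {linear V -> E}, forall v e, G (v, e) -> h v = e.
Proof.
move=> sG G0.
pose M : lmodType R := submod_type sG.
pose g : {linear M -> V} := (fst \o (val : M -> (V * E)%type))%FUN.
pose f : {linear M -> E} := (snd \o (val : M -> (V * E)%type))%FUN.
have ig : injective g.
  move=> x y gxy; apply/eqP; rewrite -subr_eq0; apply/eqP; apply: val_inj.
  rewrite linear0 [val _]surjective_pairing.
  have g0 : (val (x - y)).1 = 0 by rewrite -[LHS]/(g (x - y)) linearB gxy subrr.
  have := submod_valP (x - y); rewrite [submod_val _]surjective_pairing.
  rewrite -[submod_val _]/(val (x - y)) g0 => /G0 ->; exact: erefl.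
have [h hg] := iE f ig.
exists h => v e Gve; have [u ue] := submod_lift sG Gve.
by have := hg u; rewrite /= /g /f /= /val /= ue.
Qed.

Lemma injective_vec (T : finType) (G : set ((T -> R^o) * E)) : submodule G ->
  (forall e, G (0, e) -> e = 0) ->
  exists y : T -> E, forall v e, G (v, e) -> lc v y = e.
Proof.
move=> sG G0; have [h hG] := injective_graph sG G0.
exists (fun t => h (fun s => (s == t)%:R)) => v e /hG <-.
rewrite -[in RHS](_ : lc v (fun t s => (s == t)%:R : R^o) = v) ?linear_lc //.
apply/funext => s; rewrite /lcomb fct_sumE (bigD1 s) //= scalrfctE eqxx.
rewrite big1 => [|t ts]; first by rewrite addr0; exact: mulr1.
by rewrite scalrfctE eq_sym (negbTE ts) scaler0.
Qed.

(** A functional on the row space of [A] is the same as a column orthogonal to the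
    relations [B] between the rows. *)
Lemma injective_coexact (S T U : finType) (A : S -> T -> R) (B : U -> S -> R)
    (w : S -> E) :
  (forall v, (forall t, vm v A t = 0) -> exists c, v =1 vm c B) ->
  (forall u, mv B w u = 0) -> exists y : T -> E, forall s, mv A y s = w s.
Proof.
move=> syz Bw.
pose G : set ((T -> R^o) * E) := [set p | exists v, p.1 = vm v A /\ p.2 = lc v w].
have sG : submodule G.
  split.
  - exists (fun=> 0); split; last by rewrite lc0.
    by apply/funext => t; rewrite /vm big1 // => s _; rewrite mul0r.
  - move=> [p e] [p' e'] [v /= [-> ->]] [v' /= [-> ->]].
    exists (fun s => v s + v' s); split; last by rewrite lcD.
    apply/funext => t; rewrite /= /GRing.add /= /vm -big_split.
    by apply: eq_bigr => s _; rewrite mulrDl.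
  - move=> a [p e] [v /= [-> ->]]; exists (fun s => a * v s).
    by split; [apply/funext => t; rewrite vmZ|rewrite lcZ].
have [|y hy] := injective_vec sG.
  move=> e [v /= [v0 ->]].
  have [|c vc] := syz v; first by move=> t; rewrite -v0.
  rewrite (eq_lc vc (fun=> erefl)) -lc_mv (eq_lc (fun=> erefl) Bw).
  exact: lc0r.
exists y => s; apply: hy; exists (fun s' => (s' == s)%:R); split; last by rewrite lc1.
by apply/funext => t; rewrite vm1.
Qed.

(** Extends the map from K + a to E that kills K and sends [a] to [e].  In particular a
    nonzerodivisor modulo K acts surjectively on the part of E killed by K. *)
Lemma injective_div (K : set R) (a : R) (e : E) : is_ideal K ->
  (forall r, K (r * a) -> r *: e = 0) ->
  exists e', a *: e' = e /\ forall k, K k -> k *: e' = 0.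
Proof.
move=> iK Ke.
pose G : set (R^o * E) := [set p | exists r, K (p.1 - r * a) /\ p.2 = r *: e].
have sG : submodule G.
  split.
  - by exists 0; split; rewrite ?scale0r //= mul0r subr0; exact: ideal0.
  - move=> [p f] [p' f'] [r /= [Kr ->]] [r' /= [Kr' ->]].
    exists (r + r'); split; last by rewrite /= scalerDl.
    rewrite /= (_ : _ - _ = (p - r * a) + (p' - r' * a)); first exact: idealD.
    by rewrite mulrDl opprD addrACA.
  - move=> b [p f] [r /= [Kr ->]]; exists (b * r); split; last by rewrite /= scalerA.
    by rewrite /= -mulrA -mulrBr; exact: idealM.
have [|h hG] := injective_graph sG.
  by move=> f [r /= [Kr ->]]; apply: Ke; have := idealN iK Kr; rewrite sub0r opprK.
exists (h 1); split.
  rewrite -linearZ; apply: hG; exists 1; split; last by rewrite scale1r.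
  by rewrite /= /GRing.scale /= mulr1 mul1r subrr; exact: ideal0.
move=> k Kk; rewrite -linearZ; apply: hG; exists 0; split; last by rewrite scale0r.
by rewrite /= /GRing.scale /= mulr1 mul0r subr0.
Qed.

End InjectiveModules.

(** * Vanishing of Ext in a finite injective resolution *)

Definition syz (R : comNzRingType) (S T U : finType) (B : U -> S -> R) (A : S -> T -> R) :=
  forall v : S -> R, (forall t, vm v A t = 0) <-> exists c, v =1 vm c B.

Section SyzTheory.
Variables (R : comNzRingType) (S T U : finType) (B : U -> S -> R) (A : S -> T -> R).
Hypothesis BA : syz B A.

Lemma syz_row u t : vm (B u) A t = 0.
Proof. by have [_ h] := BA (B u); apply: h; exists (fun u' => (u' == u)%:R) => s; rewrite vm1. Qed.

Lemma syz_mv (V : lmodType R) (y : T -> V) u : mv B (mv A y) u = 0.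
Proof.
rewrite {1}/mv lc_mv (eq_lc (d := fun=> 0) (z := y)) ?lc0 // => t.
exact: syz_row.
Qed.

End SyzTheory.

Section InjectiveResolution.
Variables (R : comNzRingType) (m : idealr R).
Hypotheses (nR : noetherian R) (lR : local_ring m).
Variables (n : nat) (E : nat -> lmodType R) (eta : {linear R^o -> E 0%N}).
Variable d : forall i, {linear E i -> E i.+1}.
Hypotheses (iE : forall i, injective_module (E i))
  (E0 : forall i, (n < i)%N -> forall x : E i, x = 0) (eta_inj : injective eta)
  (ex0 : forall x, d 0%N x = 0 <-> exists y, eta y = x)
  (exS : forall i x, d i.+1 x = 0 <-> exists y, d i y = x).

Definition killed (V : lmodType R) (J : set R) (e : V) : Prop :=
  forall j, J j -> j *: e = 0.

(** [lifts s J] says that Ext^(s+1)(R/J, R) = 0: the elements of E(s+1) that are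
    cocycles killed by J come from elements of E(s) killed by J. *)
Definition lifts (s : nat) (J : set R) : Prop :=
  forall y : E s.+1, d s.+1 y = 0 -> killed J y ->
    exists e : E s, killed J e /\ d s e = y.

Lemma killed_lin (V W : lmodType R) (f : {linear V -> W}) J x :
  killed J x -> killed J (f x).
Proof. by move=> Jx j /Jx jx; rewrite -linearZ jx linear0. Qed.
Lemma killedD (V : lmodType R) J (x y : V) : killed J x -> killed J y -> killed J (x + y).
Proof. by move=> Jx Jy j Jj; rewrite scalerDr Jx // Jy // addr0. Qed.
Lemma killedZ (V : lmodType R) J a (x : V) : killed J x -> killed J (a *: x).
Proof. by move=> Jx j Jj; rewrite scalerA mulrC -scalerA Jx // scaler0. Qed.
Lemma killedB (V : lmodType R) J (x y : V) : killed J x -> killed J y -> killed J (x - y).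
Proof. by move=> Jx Jy j Jj; rewrite scalerBr Jx // Jy // subr0. Qed.
Lemma killed_adj (V : lmodType R) J a (x : V) :
  killed J x -> a *: x = 0 -> killed (adj J a) x.
Proof.
move=> Jx ax _ [k [s [Jk ->]]].
by rewrite scalerDl Jx // mulrC -scalerA ax scaler0 addr0.
Qed.

Lemma dd s (x : E s) : d s.+1 (d s x) = 0.
Proof. by apply/exS; exists x. Qed.

Lemma lifts_zero s : lifts s [set 0].
Proof.
by move=> y /exS[e ey] _; exists e; split=> // _ ->; rewrite scale0r.
Qed.

(** From the exact sequence
    Ext^(s+1)(R/K, R) -> Ext^(s+2)(R/(K + x), R) -> Ext^(s+2)(R/K, R). *)
Lemma lifts_regular s (K : set R) x : is_ideal K -> nzd_mod K x ->
  lifts s K -> lifts s.+1 K -> lifts s.+1 (adj K x).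
Proof.
move=> iK xK Xs Xs1 y dy Jy.
have Ky : killed K y by move=> k /(@adj_sub _ K x); exact: Jy.
have [e [Ke dey]] := Xs1 y dy Ky.
have dxe : d s.+1 (x *: e) = 0.
  by rewrite linearZ /= dey; apply: Jy; exact: adj_self.
have [f [Kf df]] := Xs _ dxe (killedZ x Ke).
have [|f' [xf' Kf']] := injective_div (@iE s) (a := x) (e := f) iK.
  by move=> r; rewrite mulrC => /xK; exact: Kf.
exists (e - d s f'); split; last by rewrite linearB /= dd subr0.
apply: killed_adj; first by apply: killedB => //; exact: killed_lin.
by rewrite scalerBr -linearZ xf' df subrr.
Qed.

Lemma lifts_regseq xs (K : set R) k : is_ideal K -> regseq K xs ->
  (forall s, (k <= s)%N -> lifts s K) ->
  forall s, (k + size xs <= s)%N -> lifts s (adjs K xs).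
Proof.
elim: xs K k => [|x xs IH] K k iK /=; first by move=> _ h s; rewrite addn0; exact: h.
move=> [xK rxs] h s; rewrite addnS -addSn; apply: IH => //.
  exact: adj_ideal.
by move=> [//|t] kt; apply: lifts_regular => //; apply: h; rewrite // ltnW.
Qed.

(** The image of the part of E(j-1) killed by K; in degree 0, where the cocycles are the
    copy of R in E(0), it is zero. *)
Definition coboundary (j : nat) (K : set R) : E j -> Prop :=
  match j with
  | 0 => fun b => b = 0
  | j'.+1 => fun b => exists e : E j', killed K e /\ d j' e = b
  end.

Lemma coboundary_submod j K : @submodule R (E j) (@coboundary j K).
Proof.
case: j => [|j] /=; first by split=> [|x y -> ->|a x ->] //; rewrite ?addr0 ?scaler0.
split; first by exists 0; split; rewrite ?linear0 // => k _; rewrite scaler0.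
- move=> _ _ [e [Ke <-]] [f [Kf <-]]; exists (e + f).
  by split; [exact: killedD|rewrite linearD].
- by move=> a _ [e [Ke <-]]; exists (a *: e); split; [exact: killedZ|rewrite linearZ].
Qed.

Lemma coboundary_div j (K : set R) x b : is_ideal K -> nzd_mod K x ->
  @coboundary j K b -> exists b', coboundary K b' /\ x *: b' = b.
Proof.
move=> iK xK; case: j b => [|j] b /=.
  by move=> ->; exists 0; rewrite scaler0.
move=> [e [Ke <-]]; have [|e' [xe' Ke']] := injective_div (@iE j) (a := x) (e := e) iK.
  by move=> r; rewrite mulrC => /xK; exact: Ke.
by exists (d j e'); split; [exists e'|rewrite -linearZ xe'].
Qed.

(** [ext_generator j K eps] says that Ext^j(R/K, R) is isomorphic to R/K, generated by
    the class of [eps]. *)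
Definition ext_generator (j : nat) (K : set R) (eps : E j) : Prop :=
  [/\ d j eps = 0, killed K eps, forall r, coboundary K (r *: eps) -> K r
    & forall y, d j y = 0 -> killed K y -> exists u, coboundary K (y - u *: eps)].

Lemma ext_generator0 : ext_generator [set 0] (eta 1).
Proof.
split.
- by apply/ex0; exists 1.
- by move=> _ ->; rewrite scale0r.
- move=> r /= h; apply: eta_inj; rewrite linear0 -h -linearZ; congr (eta _).
  by rewrite /GRing.scale /= mulr1.
- move=> y /ex0[u uy] _; exists u; rewrite /= -uy -linearZ.
  by rewrite /GRing.scale /= mulr1 subrr.
Qed.

(** The connecting map of 0 -> R/K -> R/K -> R/(K + x) -> 0: divide the generator by [x]
    in E(j), then apply the differential. *)
Lemma ext_generatorS j (K : set R) x (eps : E j) : is_ideal K -> nzd_mod K x ->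
  lifts j K -> ext_generator K eps ->
  exists eps' : E j.+1, ext_generator (adj K x) eps'.
Proof.
move=> iK xK Xj [deps Keps inj gen].
have [|e [xe Ke]] := injective_div (@iE j) (a := x) (e := eps) iK.
  by move=> r; rewrite mulrC => /xK; exact: Keps.
have sB := coboundary_submod j K.
exists (d j e); split.
- exact: dd.
- apply: killed_adj; first exact: killed_lin.
  by rewrite -linearZ xe.
- move=> r /= [f [Jf df]].
  have Kf : killed K f by move=> k /(@adj_sub _ K x); exact: Jf.
  have [||u hu] := gen (r *: e - f).
  + by rewrite linearB linearZ /= df subrr.
  + by apply: killedB => //; exact: killedZ.
  have xf : x *: f = 0 by apply: Jf; exact: adj_self.
  have : coboundary K ((r - x * u) *: eps).
    have := submodZ sB x hu; congr (coboundary K _).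
    rewrite !scalerBr xf subr0 !scalerA mulrC -!scalerA xe scalerBl.
    by rewrite scalerA.
  move=> /inj Kr; exists (r - x * u), u; split=> //; ring.
- move=> y dy Jy.
  have Ky : killed K y by move=> k /(@adj_sub _ K x); exact: Jy.
  have [f [Kf df]] := Xj y dy Ky.
  have [||u hu] := gen (x *: f).
  + by rewrite linearZ /= df; apply: Jy; exact: adj_self.
  + exact: killedZ.
  have [b [hb xb]] := coboundary_div iK xK hu.
  have [db Kb] : d j b = 0 /\ killed K b.
    clear -hb exS; case: j b hb => [|j] b /=.
      by move=> ->; rewrite linear0; split=> // k _; rewrite scaler0.
    by move=> [g [Kg <-]]; split; [rewrite dd|exact: killed_lin].
  exists u; exists (f - u *: e - b); split.
    apply: killed_adj; first by do 2![apply: killedB => //]; exact: killedZ.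
    rewrite !scalerBr xb scalerA [x * u]mulrC -scalerA xe; exact: subrr.
  by rewrite !linearB linearZ /= df db subr0.
Qed.

Lemma ext_generator_regseq xs j (K : set R) (eps : E j) : is_ideal K -> regseq K xs ->
  (forall s, (j <= s)%N -> lifts s K) -> ext_generator K eps ->
  exists eps' : E (j + size xs)%N, ext_generator (adjs K xs) eps'.
Proof.
elim: xs j K eps => [|x xs IH] j K eps iK /=.
  by move=> _ _ h; rewrite addn0; exists eps.
move=> [xK rxs] Xj heps; rewrite addnS -addSn.
have [eps' heps'] := ext_generatorS iK xK (Xj j (leqnn j)) heps.
apply: (IH _ _ eps') => //; first exact: adj_ideal.
by move=> [//|t] kt; apply: lifts_regular => //; apply: Xj; rewrite // ltnW.
Qed.

(** Ext is finitely generated: shifting along the injective resolution, generators of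
    the cocycles with values in R of a free resolution yield generators of the Ext
    group computed with values in E(j). *)
Lemma cocycles_fgen j (S T U : finType) (A : S -> T -> R) (B : U -> S -> R) :
  syz B A -> exists (P : finType) (z : P -> S -> E j),
    (forall p, (forall s, d j (z p s) = 0) /\ forall u, mv B (z p) u = 0) /\
    forall y : S -> E j, (forall s, d j (y s) = 0) -> (forall u, mv B y u = 0) ->
      exists c (b : T -> E j), (forall t, d j (b t) = 0) /\
        forall s, y s = lc c (z^~ s) + mv A b s.
Proof.
elim: j S T U A B => [|j IH] S T U A B BA.
  pose K : set (S -> R^o) := [set w | forall u, mv B w u = 0].
  have sK : submodule K.
    split; first by move=> u; exact: mv0.
    - by move=> x y Kx Ky u; rewrite (mvD B x y) Kx Ky addr0.
    - by move=> a x Kx u; rewrite (mvZ B a x) Kx scaler0.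
  have [P [z [Kz Ksp]]] := noeth_fgen_vec nR sK.
  have eta_mv (w : S -> R^o) u : mv B (fun s => eta (w s)) u = eta (mv B w u).
    by rewrite /mv linear_lc.
  exists P, (fun p s => eta (z p s)); split.
    move=> p; split=> [s|u]; first by apply/ex0; exists (z p s).
    by rewrite eta_mv (Kz p) linear0.
  move=> y dy By.
  have /choice[w hw] : forall s, exists w, eta w = y s by move=> s; apply/ex0.
  have [|c wc] := Ksp w.
    move=> u; apply: eta_inj; rewrite linear0 -eta_mv -(By u).
    exact: eq_lc.
  exists c, (fun=> 0); split=> [t|s]; first by rewrite linear0.
  rewrite mv0 addr0 -hw wc; rewrite {1}/lcomb fct_sumE /= linear_sum.
  by apply: eq_bigr => p _; rewrite scalrfctE linearZ.
have [W [C CB]] := syzygies_exist nR B.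
have [P [w [hw wgen]]] := IH U S W B C CB.
have /choice[e he] : forall p, exists e : S -> E j, forall u, mv B e u = w p u.
  move=> p; have [_ Cw] := hw p; apply: (injective_coexact (@iE j)) Cw.
  by move=> v /CB.
exists P, (fun p s => d j (e p s)); split.
  move=> p; split=> [s|u]; first exact: dd.
  have -> : mv B (fun s => d j (e p s)) u = d j (mv B (e p) u) by rewrite /mv linear_lc.
  by rewrite he; case: (hw p).
move=> y dy By.
have /choice[f hf] : forall s, exists f, d j f = y s by move=> s; apply/exS.
have [||c [b [db hb]]] := wgen (mv B f).
- move=> u; rewrite -[RHS](By u) /mv linear_lc; exact: eq_lc.
- exact: syz_mv.
have [|a ha] := @injective_coexact R _ (@iE j) _ _ _ A B
    (fun s => f s - lc c (e^~ s) - b s) (fun v => (BA v).1).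
  move=> u; rewrite (mvB B _ b) (mvB B f) mv_lc hb.
  by rewrite (eq_lc (fun=> erefl) (fun p => he p u)) addrAC addrK subrr.
exists c, (fun t => d j (a t)); split=> [t|s]; first exact: dd.
have -> : mv A (fun t => d j (a t)) s = d j (mv A a s) by rewrite /mv linear_lc.
rewrite ha !linearB /= db subr0 hf linear_lc addrC subrK //.
Qed.

Lemma ext_fgen s (J : set R) : is_ideal J ->
  exists (P : finType) (z : P -> E s.+1),
    (forall p, d s.+1 (z p) = 0 /\ killed J (z p)) /\
    forall y, d s.+1 y = 0 -> killed J y ->
      exists c, @coboundary s.+1 J (y - lc c z).
Proof.
move=> iJ; have [S [g [Jg gJ]]] := noeth_fgen nR iJ.
pose A (i : S) (_ : unit) : R := g i.
have [U [B BA]] := syzygies_exist nR A.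
have mvA (e : E s) i : mv A (fun=> e) i = g i *: e.
  by rewrite /mv /lcomb (bigD1 tt) //= big1 ?addr0 // => -[].
have killedA (V : lmodType R) (e : V) : (forall i, g i *: e = 0) -> killed J e.
  move=> h _ /gJ[c ->]; rewrite /lcomb scaler_suml big1 // => i _.
  by rewrite -scalerA h scaler0.
have [P [w [hw wgen]]] := cocycles_fgen s BA.
have /choice[e he] : forall p, exists e : unit -> E s, forall i, mv A e i = w p i.
  move=> p; have [_ Bw] := hw p; apply: (injective_coexact (@iE s)) Bw.
  by move=> v /BA.
have eE p i : mv A (e p) i = g i *: e p tt.
  by rewrite -mvA; apply: eq_lc => // -[].
exists P, (fun p => d s (e p tt)); split.
  move=> p; split; first exact: dd.
  apply: killedA => i; rewrite -linearZ -eE he.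
  by case: (hw p).
move=> y dy Jy; have /exS[f hf] := dy.
have [||c [b [db hb]]] := wgen (mv A (fun=> f)).
- by move=> i; rewrite mvA linearZ /= hf; exact: Jy.
- exact: syz_mv.
exists c; exists (f - lc c (fun p => e p tt) - b tt); split.
  apply: killedA => i; rewrite !scalerBr -mvA hb -lcZr.
  rewrite [X in _ + _ - X - _](_ : _ = lc c (w^~ i)); last first.
    by apply: eq_lc => // p; rewrite -eE he.
  have -> : g i *: b tt = mv A b i by rewrite -mvA; apply: eq_lc => // -[].
  by rewrite addrAC addrK subrr.
by rewrite !linearB /= db subr0 hf linear_lc.
Qed.

Section Bass.
Variable s : nat.
Hypothesis liftsS : forall J, is_ideal J -> lifts s.+1 J.

(** The module Y of cocycles in E(s+1) is injective with respect to ideals, because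
    Ext^1(R/J', Y) = Ext^(s+2)(R/J', R) = 0 for all ideals J'. *)
Lemma cocycle_div (J : set R) a (y : E s.+1) : is_ideal J -> d s.+1 y = 0 ->
  (forall r, J (r * a) -> r *: y = 0) ->
  exists y', [/\ d s.+1 y' = 0, killed J y' & a *: y' = y].
Proof.
move=> iJ dy Jy; have [e [ae Je]] := injective_div (@iE s.+1) iJ Jy.
have [|||f [Jf df]] := @liftsS (adj J a) _ (d s.+1 e).
- exact: adj_ideal.
- exact: dd.
- by apply: killed_adj; [exact: killed_lin|rewrite -linearZ ae].
exists (e - f); split.
- by rewrite linearB /= df subrr.
- by apply: killedB => // j /(@adj_sub _ J a); exact: Jf.
- by rewrite scalerBr ae Jf ?subr0 //; exact: adj_self.
Qed.

(** From the exact sequence 0 -> R/(J : a) -> R/J -> R/(J + a) -> 0. *)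
Lemma lifts_extension (J : set R) a : is_ideal J ->
  lifts s (ann_mod J a) -> lifts s (adj J a) -> lifts s J.
Proof.
move=> iJ X1 X2 y dy Jy.
have [||e [Je de]] := X1 (a *: y).
- by rewrite linearZ /= dy scaler0.
- by move=> r Jr; rewrite scalerA; exact: Jy.
have [f [af Jf]] := injective_div (@iE s) iJ Je.
have [||g [Jg dg]] := X2 (y - d s f).
- by rewrite linearB /= dy dd subrr.
- apply: killed_adj; first by apply: killedB => //; exact: killed_lin.
  by rewrite scalerBr -linearZ af de subrr.
exists (f + g); split; last by rewrite linearD /= dg addrC subrK.
by apply: killedD => // j /(@adj_sub _ J a); exact: Jg.
Qed.

(** Bass' theorem, one degree at a time: if all Ext^(s+2)(R/J, R) vanish, and
    Ext^(s+1)(R/I, R) = 0 for an ideal I such that R/I contains a copy of the residue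
    field, then all Ext^(s+1)(R/J, R) vanish.  A maximal J for which this fails is
    prime by the preceding lemma; it contains m since otherwise the finitely generated
    module Ext^(s+1)(R/J, R) is divisible by an element of m; and for J = m the
    vanishing comes from that for I, as Ext^(s+1)(-, R) is right exact. *)
Lemma lifts_step (I : set R) u : is_ideal I -> socle_mod m I u -> lifts s I ->
  forall J, is_ideal J -> lifts s J.
Proof.
move=> iI [Iu mu] XI J iJ; apply: contrapT => nJ.
pose F : set (set R) := [set J | is_ideal J /\ ~ lifts s J].
have idF L : F L -> is_ideal L by case.
have [{nJ iJ}L [iL nL] Lmax] := noeth_max nR idF (conj iJ nJ).
have big J' : is_ideal J' -> L `<=` J' -> ~ (J' `<=` L) -> lifts s J'.
  move=> iJ' LJ' nJ'; apply: contrapT => nX.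
  by apply: nJ'; exact: (Lmax _ (conj iJ' nX)).
have L1 : ~ L 1.
  move=> L1; apply: nL => y dy Ly; exists 0; rewrite linear0.
  by split; [move=> k _; rewrite scaler0|rewrite -(Ly 1 L1) scale1r].
have prime a b : L (a * b) -> L a \/ L b.
  move=> Lab; apply: contrapT => /not_orP[La Lb]; apply: nL.
  apply: (@lifts_extension L a) => //; apply: big.
  - exact: ann_mod_ideal.
  - by move=> r Lr; exact: idealMl.
  - by move=> /(_ b); apply: contra_not Lb; apply; rewrite /ann_mod /= mulrC.
  - exact: adj_ideal.
  - exact: adj_sub.
  - by move=> /(_ a (adj_self a iL)).
have mL : [set` m] `<=` L.
  move=> a /= am; apply: contrapT => La; apply: nL.
  have [P [z [hz zgen]]] := ext_fgen s iL.
  pose Z : set (E s.+1) := [set y | d s.+1 y = 0 /\ killed L y].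
  have sZ : submodule Z.
    split; first by split; [exact: linear0|move=> k _; rewrite scaler0].
    - by move=> x y [dx Lx] [dy Ly]; split; [rewrite linearD /= dx dy addr0|exact: killedD].
    - by move=> b x [dx Lx]; split; [rewrite linearZ /= dx scaler0|exact: killedZ].
  have sB := coboundary_submod s.+1 L.
  have ZB : Z `<=` @coboundary s.+1 L.
    apply: (nakayama_quot nR lR (z := z)) => //.
    - by move=> v [dv Lv]; have [c hc] := zgen v dv Lv; exists (lc c z) => //; exists c.
    - move=> v [dv Lv].
      have [|w [dw Lw aw]] := cocycle_div (a := a) iL dv.
        by move=> r /prime[/Lv|].
      exists a, w; split=> //; rewrite aw subrr; exact: submod0.
  by move=> y dy Ly; exact: (ZB y (conj dy Ly)).
have Lm j : L j -> j \in m by exact: (local_sub nR lR).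
apply: nL => y dy Ly.
have [|w [dw Iw uw]] := cocycle_div (a := u) iI dy.
  move=> r Iru; apply: Ly; apply: mL; apply: contrapT => /negP /(local_unit nR lR)[v vr].
  by apply: Iu; rewrite -[u]mul1r -vr -mulrA; exact: idealM.
have [f [If df]] := XI w dw Iw.
exists (u *: f); split; last by rewrite linearZ /= df uw.
by move=> j /Lm jm; rewrite scalerA; apply: If; exact: mu.
Qed.

End Bass.

(** Passing from cyclic to finitely generated modules, by induction on the support of
    [y]: the coordinate at a point [t] is lifted first, and the other coordinates of
    the lift are chosen so as to cancel what this contributes on elements of [K]. *)
Lemma lifts_vec s : (forall J, is_ideal J -> lifts s J) ->
  forall (T : finType) (K : set (T -> R^o)) (y : T -> E s.+1), submodule K ->
  (forall t, d s.+1 (y t) = 0) -> (forall v, K v -> lc v y = 0) ->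
  exists e : T -> E s, (forall v, K v -> lc v e = 0) /\ forall t, d s (e t) = y t.
Proof.
move=> X T K y sK dy Ky; suff: forall k (A : {set T}) (y : T -> E s.+1), #|A| = k ->
    (forall t, d s.+1 (y t) = 0) -> (forall t, t \notin A -> y t = 0) ->
    (forall v, K v -> lc v y = 0) ->
    exists e : T -> E s, (forall v, K v -> lc v e = 0) /\ forall t, d s (e t) = y t.
  move=> /(_ _ (finset.setT : {set T}) y erefl dy); apply=> // t.
  by rewrite finset.in_setT.
elim=> [|k IH] A {dy Ky}y cA dy suppy Ky.
  exists (fun=> 0); split=> [v _|t]; first exact: lc0r.
  by rewrite linear0 suppy // (cards0_eq cA) inE.
have [t tA] : exists t, t \in A by apply/set0Pn; rewrite -card_gt0 cA.
pose J : set R := [set r | exists v : T -> R^o,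
  [/\ K v, v t = r & forall t', t' \in A -> t' != t -> v t' = 0]].
have iJ : is_ideal J.
  split.
  - by exists 0; split=> //; exact: submod0.
  - move=> _ _ [v [Kv <- v0]] [w [Kw <- w0]]; exists (v + w).
    by split=> //; [exact: submodD|move=> t' t'A t't; rewrite addrfctE v0 // w0 // addr0].
  - move=> a _ [v [Kv <- v0]]; exists (a *: v).
    by split=> //; [exact: submodZ|move=> t' t'A t't; rewrite scalrfctE v0 // scaler0].
have lcy (v : T -> R) : (forall t', t' \in A -> t' != t -> v t' = 0) -> lc v y = v t *: y t.
  move=> v0; rewrite /lcomb (bigD1 t) //= big1 ?addr0 // => t' t't.
  have [t'A|t'A] := boolP (t' \in A); first by rewrite v0 // scale0r.
  by rewrite suppy // scaler0.
have [|et [Jet det]] := X J iJ (y t) (dy t).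
  by move=> _ [v [Kv <- v0]]; rewrite -(lcy v) // Ky.
pose off (v : T -> R) : T -> R := fun t' => if (t' \in A) && (t' != t) then v t' else 0.
pose G : set ((T -> R^o) * E s) :=
  [set p | exists v, [/\ K v, p.1 = off v & p.2 = - (v t *: et)]].
have [||c hc] := @injective_vec R _ (@iE s) T G.
- split.
  + exists 0; split; [exact: submod0| |by rewrite /= scale0r oppr0].
    by apply/funext => t'; rewrite /off; case: ifP.
  + move=> [p e] [p' e'] [v /= [Kv -> ->]] [v' /= [Kv' -> ->]]; exists (v + v').
    split; [exact: submodD| |by rewrite /= scalerDl opprD].
    apply/funext => t'; rewrite -[LHS]/(off v t' + off v' t') /off addrfctE.
    by case: ifP => // _; rewrite addr0.
  + move=> a [p e] [v /= [Kv -> ->]]; exists (a *: v).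
    split; [exact: submodZ| |by rewrite /= scalerN scalerA].
    apply/funext => t'; rewrite -[LHS]/(a * off v t') /off scalrfctE.
    by case: ifP => // _; rewrite mulr0.
- move=> e [v /= [Kv v0 ->]]; rewrite Jet ?oppr0 //; exists v; split=> // t' t'A t't.
  by have := congr1 (@^~ t') v0; rewrite /off t'A t't.
pose e0 t' := if (t' \in A) && (t' != t) then c t' else if t' == t then et else 0.
have Ke0 v : K v -> lc v e0 = 0.
  move=> Kv; have := hc (off v) (- (v t *: et)) (ex_intro _ v (And3 Kv erefl erefl)).
  move=> h; rewrite /lcomb (bigD1 t) //= {1}/e0 eqxx andbF -[v t *: et]opprK -h.
  rewrite {1}/lcomb (bigD1 t) //= {1}/off eqxx andbF scale0r add0r addrC.
  apply/eqP; rewrite subr_eq0; apply/eqP; apply: eq_bigr => t' t't.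
  by rewrite /e0 /off t't andbT (negbTE t't); case: ifP => // _; rewrite scale0r scaler0.
have [||||e [Ke de]] := IH (A :\ t) (fun t' => y t' - d s (e0 t')).
- by move: cA; rewrite (cardsD1 t) tA => -[].
- by move=> t'; rewrite linearB /= dy dd subrr.
- move=> t'; rewrite !inE negb_and negbK => /orP[/eqP ->|t'A].
    by rewrite /e0 eqxx andbF det subrr.
  rewrite suppy // /e0 (negbTE t'A) /=; case: eqP t'A => [->|_ _]; first by rewrite tA.
  by rewrite linear0 subrr.
- move=> v Kv; rewrite lcBr Ky // sub0r.
  have -> : lc v (fun t0 => d s (e0 t0)) = d s (lc v e0) by rewrite linear_lc.
  by rewrite Ke0 // linear0 oppr0.
exists (fun t' => e0 t' + e t'); split=> [v Kv|t'].
  by rewrite lcDr Ke0 // Ke // addr0.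
by rewrite linearD /= de addrC subrK.
Qed.

Variables (xs : seq R).
Hypothesis (rxs : regseq [set 0] xs).
Hypothesis (soc : exists u, socle_mod m (adjs [set 0] xs) u).

(** Descending induction on the degree, starting beyond the length of the resolution. *)
Lemma lifts_above_depth s J : (size xs <= s)%N -> is_ideal J -> lifts s J.
Proof.
suff: forall k s, (size xs <= s)%N -> (n <= s + k)%N -> forall J, is_ideal J -> lifts s J.
  by move=> h ds iJ; apply: (h n) => //; exact: leq_addl.
elim=> [|k IH] {}s ds.
  rewrite addn0 => ns J' iJ' y _ _; exists 0; split; first by move=> j _; rewrite scaler0.
  by rewrite linear0; apply/esym; exact: E0.
move=> nsk; have [u hu] := soc.
apply: (lifts_step _ _ hu).
- by move=> J' iJ'; apply: IH => //; [exact: leqW|rewrite addSn -addnS].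
- by apply: adjs_ideal; exact: ideal_zero.
- apply: (lifts_regseq (k := 0)) => //; first exact: ideal_zero.
  by move=> t _; exact: lifts_zero.
Qed.

(** R/I is self-injective for the ideal I of a regular sequence of maximal length.
    With [eps] as in [ext_generator], the functional [w] on the span of the rows of [a]
    modulo I becomes a functional [w *: eps] with values in the cocycles of E(d), which
    extends to the free module since Ext^(d+1) vanishes; modulo coboundaries the
    extension is a multiple [u *: eps]. *)
Lemma regseq_self_injective ys : regseq [set 0] ys -> size ys = size xs ->
  forall (S T : finType) (a : S -> T -> R) (w : S -> R),
  (forall v : S -> R, (forall t, adjs [set 0] ys (vm v a t)) ->
     adjs [set 0] ys (\sum_s v s * w s)) ->
  exists u : T -> R, forall s, adjs [set 0] ys (w s - \sum_t a s t * u t).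
Proof.
set I := adjs _ _ => rys szys S T a w haw.
have iI : is_ideal I by apply: adjs_ideal; exact: ideal_zero.
pose D := size xs.
have [eps [deps Ieps inj gen]] : exists eps : E D, ext_generator I eps.
  have [] := @ext_generator_regseq ys 0 [set 0] (eta 1) (@ideal_zero R) rys.
  - by move=> s _; exact: lifts_zero.
  - exact: ext_generator0.
  - by rewrite add0n szys => eps heps; exists eps.
pose G : set ((T -> R^o) * E D) := [set p | exists v : S -> R,
  (forall t, I (p.1 t - vm v a t)) /\ p.2 = (\sum_s v s * w s) *: eps].
have sG : submodule G.
  split.
  - exists (fun=> 0); split=> [t|] /=.
      by rewrite /vm big1 ?subr0 => [|s _]; [exact: ideal0|rewrite mul0r].
    by rewrite big1 ?scale0r // => s _; rewrite mul0r.
  - move=> [p e] [p' e'] [v /= [hp ->]] [v' /= [hp' ->]]; exists (fun s => v s + v' s).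
    split=> [t|]; last first.
      by rewrite /= -scalerDl -big_split; congr (_ *: _); apply: eq_bigr => s _; rewrite mulrDl.
    rewrite (_ : _ - _ = (p t - vm v a t) + (p' t - vm v' a t)); first exact: idealD.
    rewrite addrACA -opprD; congr (_ - _); rewrite /vm -big_split.
    by apply: eq_bigr => s _; rewrite mulrDl.
  - move=> b [p e] [v /= [hp ->]]; exists (fun s => b * v s).
    split=> [t|]; last first.
      by rewrite /= scalerA mulr_sumr; congr (_ *: _); apply: eq_bigr => s _; rewrite mulrA.
    rewrite vmZ (_ : _ - _ = b * (p t - vm v a t)); first exact: idealM.
    by rewrite mulrBr.
have [|y0 hy0] := injective_vec (@iE D) sG.
  move=> e [v /= [Iv ->]]; apply: Ieps; apply: haw => t.
  by have := idealN iI (Iv t); rewrite opprB subr0.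
pose K : set (T -> R^o) := [set p | exists e, G (p, e)].
have sK : submodule K.
  split; first by exists 0; exact: submod0 sG.
  - by move=> x y [e Gx] [f Gy]; exists (e + f); exact: submodD sG _ _ Gx Gy.
  - by move=> b x [e Gx]; exists (b *: e); exact: submodZ sG b _ Gx.
have [|||e [Ke de]] := lifts_vec (s := D) _ (y := fun t => d D (y0 t)) sK.
- by move=> J; exact: lifts_above_depth.
- by move=> t; exact: dd.
- move=> v [e Gve].
  have -> : lc v (fun t => d D (y0 t)) = d D (lc v y0) by rewrite linear_lc.
  rewrite (hy0 _ _ Gve).
  by case: Gve => v' [_ /= ->]; rewrite linearZ /= deps scaler0.
have /choice[u hu] : forall t, exists u, coboundary I (y0 t - e t - u *: eps).
  move=> t; apply: gen; first by rewrite linearB /= de subrr.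
  move=> k Ik; pose p : T -> R^o := fun t' => if t' == t then k else 0.
  have Gp : G (p, 0).
    exists (fun=> 0); split=> [t'|] /=; last by rewrite big1 ?scale0r // => s _; rewrite mul0r.
    rewrite /vm big1 ?subr0 => [|s _]; last by rewrite mul0r.
    by rewrite /p; case: eqP => // _; exact: ideal0.
  have lcp (z : T -> E D) : lc p z = k *: z t.
    rewrite /lcomb (bigD1 t) //= {1}/p eqxx big1 ?addr0 // => t' t't.
    by rewrite /p (negbTE t't) scale0r.
  by rewrite scalerBr -!lcp (hy0 _ _ Gp) Ke ?subr0 //; exists 0.
exists u => s; apply: inj.
have Gs : G (a s, w s *: eps).
  exists (fun s' => (s' == s)%:R); split=> [t|] /=.
    by rewrite vm1 subrr; exact: ideal0.
  rewrite (bigD1 s) //= eqxx mul1r big1 ?addr0 // => s' /negbTE ->.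
  by rewrite mul0r.
have -> : (w s - \sum_t a s t * u t) *: eps = lc (a s) (fun t => y0 t - e t - u t *: eps).
  rewrite !lcBr (hy0 _ _ Gs) Ke; last by exists (w s *: eps).
  rewrite subr0 scalerBl; congr (_ - _); rewrite scaler_suml.
  by apply: eq_bigr => t _; rewrite scalerA.
by apply: submod_lc => //; exact: coboundary_submod.
Qed.

End InjectiveResolution.

Definition self_injective_mod (R : comNzRingType) (I : set R) : Prop :=
  forall (S T : finType) (a : S -> T -> R) (w : S -> R),
  (forall v : S -> R, (forall t, I (vm v a t)) -> I (\sum_s v s * w s)) ->
  exists u : T -> R, forall s, I (w s - \sum_t a s t * u t).

Lemma gorenstein_self_injective (R : comNzRingType) (m : idealr R) (xs ys : seq R) :
  noetherian R -> local_ring m -> gorenstein R ->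
  regseq [set 0] xs -> (exists u, socle_mod m (adjs [set 0] xs) u) ->
  regseq [set 0] ys -> size ys = size xs -> self_injective_mod (adjs [set 0] ys).
Proof.
move=> nR lR [n [E [eta [d [iE E0 eta_inj ex0 exS]]]]] rxs soc rys szys.
exact: (regseq_self_injective nR lR iE E0 eta_inj ex0 exS rxs soc).
Qed.

(** * Exactness of dual complexes along a regular sequence *)

Section DualExactness.
Variables (R : comNzRingType) (m : idealr R).
Hypotheses (nR : noetherian R) (lR : local_ring m).

Definition row_mod (S T : finType) (K : set R) (A : S -> T -> R) (z : T -> R) : Prop :=
  exists c : S -> R, forall t, K (z t - vm c A t).

(** [xs] is a regular sequence on the cokernel of [A] modulo [K]. *)
Fixpoint coker_regseq (S T : finType) (K : set R) (xs : seq R) (A : S -> T -> R) : Prop :=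
  if xs is x :: xs' then
    (forall z, row_mod K A (fun t => x * z t) -> row_mod K A z) /\
    coker_regseq (adj K x) xs' A
  else True.

Definition exact_mod (S T U : finType) (K : set R) (B : U -> S -> R) (A : S -> T -> R) :=
  forall v : S -> R, (forall t, K (vm v A t)) -> row_mod K B v.

(** For a zero ideal [K] and the relations [B] between the rows of [A], this is the
    vanishing of Ext^1(C, R), with C the cokernel of [A]. *)
Definition coexact_mod (S T U : finType) (K : set R) (B : U -> S -> R) (A : S -> T -> R) :=
  forall w : S -> R^o, (forall u, K (mv B w u)) ->
    exists y : T -> R^o, forall s, K (w s - mv A y s).

(** Tor_1 of the cokernel of [A] with R/x vanishes modulo K. *)
Lemma exact_mod_adj (S T U : finType) (K : set R) x (B : U -> S -> R) (A : S -> T -> R) :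
  is_ideal K -> (forall z, row_mod K A (fun t => x * z t) -> row_mod K A z) ->
  exact_mod K B A -> exact_mod (adj K x) B A.
Proof.
move=> iK xA BA v /choice[k /choice[z kz]].
have [|c hc] := xA z.
  exists v => t; have [Kk ->] := kz t.
  by rewrite (_ : _ - _ = - k t); [exact: idealN|ring].
have [|b hb] := BA (fun s => v s - x * c s).
  move=> t; rewrite vmB vmZ; have [Kk ->] := kz t.
  rewrite (_ : _ - _ = k t + x * (z t - vm c A t)); last by ring.
  by apply: idealD => //; apply: idealM.
exists b => s; exists (v s - x * c s - vm b B s), (c s); split=> //; ring.
Qed.

Lemma exact_mod_regseq (S T U : finType) (K : set R) xs (B : U -> S -> R) (A : S -> T -> R) :
  is_ideal K -> coker_regseq K xs A -> exact_mod K B A -> exact_mod (adjs K xs) B A.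
Proof.
elim: xs K => //= x xs IH K iK [xA rA] BA; apply: IH => //; first exact: adj_ideal.
exact: exact_mod_adj.
Qed.

(** The cokernel of [B] embeds in a free module. *)
Lemma coker_regseq_syz (S T U : finType) (K : set R) xs (B : U -> S -> R) (A : S -> T -> R) :
  is_ideal K -> regseq K xs -> coker_regseq K xs A -> (forall u t, vm (B u) A t = 0) ->
  exact_mod K B A -> coker_regseq K xs B.
Proof.
move=> + + + BA0; elim: xs K => //= x xs IH K iK [xK rxs] [xA rA] BA; split.
  move=> z [c hc]; apply: BA => t; apply: xK; rewrite -vmZ.
  have : K (vm (fun s => x * z s - vm c B s) A t) by apply: ideal_vm.
  rewrite vmB vm_vm (_ : vm c _ t = 0) ?subr0 //.
  by rewrite /vm big1 // => u _; rewrite -/(vm (B u) A t) BA0 mulr0.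
apply: IH => //; [exact: adj_ideal|exact: exact_mod_adj].
Qed.

Lemma self_injective_coexact (S T U : finType) (K : set R) (B : U -> S -> R)
    (A : S -> T -> R) : is_ideal K ->
  self_injective_mod K -> exact_mod K B A -> coexact_mod K B A.
Proof.
move=> iK sK BA w Bw; have [|y hy] := sK S T A w; last by exists y.
move=> v /BA[c hc].
have : K (\sum_s (v s - vm c B s) * w s) by apply: ideal_sum => // s; apply: idealMl.
have -> : \sum_s (v s - vm c B s) * w s = \sum_s v s * w s - lc c (mv B w).
  rewrite lc_mv /lcomb -sumrB; apply: eq_bigr => s _.
  by rewrite mulrBl.
move=> h; apply: (ideal_subl iK h); apply: (@submod_lc _ R^o) => //.
Qed.

(** If the dual complex is exact modulo [x], then x acts surjectively on its homology,
    which vanishes by Nakayama's lemma. *)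
Lemma coexact_mod_regseq (S T U : finType) (K : set R) xs (B : U -> S -> R)
    (A : S -> T -> R) : is_ideal K -> (forall x, x \in xs -> x \in m) -> regseq K xs ->
  (forall u t, vm (B u) A t = 0) ->
  coexact_mod (adjs K xs) B A -> coexact_mod K B A.
Proof.
move=> + + + BA0; have BAy (y : T -> R^o) u : mv B (mv A y) u = 0.
  by rewrite /mv lc_mv (eq_lc (BA0 u) (fun=> erefl)) lc0.
elim: xs K => //= x xs IH K iK xsm [xK rxs] hK.
have {}IH : coexact_mod (adj K x) B A.
  apply: IH => //; first exact: adj_ideal.
  by move=> y yxs; apply: xsm; rewrite inE yxs orbT.
pose Z : set (S -> R^o) := [set w : S -> R^o | forall u, K (mv B w u)].
pose N : set (S -> R^o) := [set w : S -> R^o | exists y : T -> R^o, forall s, K (w s - mv A y s)].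
have sZ : submodule Z.
  split; first by move=> u; rewrite (mv0 _ B u); exact: ideal0.
  - by move=> v w Zv Zw u; rewrite (mvD B v w); exact: idealD.
  - by move=> a v Zv u; rewrite (mvZ B a v); exact: idealM.
have sN : submodule N.
  split; first by exists (fun=> 0) => s; rewrite (mv0 _ A s) subrr; exact: ideal0.
  - move=> v w [y hy] [z hz]; exists (fun t => y t + z t) => s.
    by rewrite mvD opprD -[(v + w) s]/(v s + w s) addrACA; exact: idealD.
  - move=> a v [y hy]; exists (fun t => a *: y t) => s.
    by rewrite mvZ -[(a *: v) s]/(a *: v s) -scalerBr; exact: idealM.
have [P [z [Zz Zsp]]] := noeth_fgen_vec nR sZ.
have ZN : Z `<=` N.
  apply: (nakayama_quot nR lR (z := z)) => //.
    move=> v Zv; exists v; first exact: Zsp.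
    by rewrite subrr; exact: submod0.
  move=> v Zv; have [|y hy] := IH v; first by move=> u; apply/adj_sub/Zv.
  have /choice[k /choice[w kw]] := hy.
  exists x, w; split; first by apply: xsm; rewrite mem_head.
    move=> u; apply: xK; rewrite -[x * _]/(x *: _) -mvZ.
    have -> : mv B (fun s => x *: (w s : R^o)) u =
        mv B v u - mv B (fun s => k s : R^o) u.
      rewrite -[mv B v u]subr0 -(BAy y u) -!mvB; apply: eq_lc => // s.
      by have [_ ->] := kw s; rewrite addrAC subrr add0r.
    apply: idealB => //; apply: (@submod_lc _ R^o) => // s.
    by case: (kw s).
  exists y => s; have [Kk e] := kw s.
  rewrite -[(v - _) s]/(v s - x * w s) (_ : _ - _ - _ = k s) //.
  by rewrite addrAC e addrK.
by move=> w; exact: ZN.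
Qed.

(** Maps from the cokernel of [A] to R/K lift to R. *)
Definition lifting_mod (S T : finType) (K : set R) (A : S -> T -> R) : Prop :=
  forall w : T -> R^o, (forall s, K (mv A w s)) ->
    exists w' : T -> R^o, (forall s, mv A w' s = 0) /\ forall t, K (w t - w' t).

Lemma lifting_mod_adj (S T U : finType) (K : set R) x (B : U -> S -> R) (A : S -> T -> R) :
  is_ideal K -> nzd_mod K x -> (forall u t, vm (B u) A t = 0) ->
  coexact_mod K B A -> lifting_mod K A -> lifting_mod (adj K x) A.
Proof.
move=> iK xK BA0 hBA hA w /choice[k /choice[z kz]].
have [|y hy] := hBA (z : S -> R^o).
  move=> u; apply: xK; rewrite -[x * _]/(x *: _) -mvZ.
  have -> : mv B (fun s => x *: (z s : R^o)) u =
      mv B (mv A w) u - mv B (fun s => k s : R^o) u.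
    by rewrite -mvB; apply: eq_lc => // s; have [_ ->] := kz s; rewrite addrAC subrr add0r.
  rewrite {1}/mv lc_mv (eq_lc (BA0 u) (fun=> erefl)) lc0 sub0r; apply: idealN => //.
  by apply: (@submod_lc _ R^o) => // s; case: (kz s).
have [|w' [Aw' ww']] := hA (fun t => w t - x *: y t).
  move=> s; rewrite (mvB A w) mvZ; have [Kk ->] := kz s.
  rewrite -[x *: _]/(x * _) (_ : _ - _ = k s + x * (z s - mv A y s)); last by ring.
  by apply: idealD => //; apply: idealM.
exists w'; split=> // t; exists (w t - x * y t - w' t), (y t); split; first exact: ww'.
by ring.
Qed.

(** The submodule m C^* of the dual of the cokernel C of [A]. *)
Definition dual_m (S T : finType) (A : S -> T -> R) (w : T -> R^o) : Prop :=
  exists (P : finType) (y : P -> R) (z : P -> T -> R^o),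
    [/\ forall p, y p \in m, forall p s, mv A (z p) s = 0
      & forall t, w t = \sum_p y p * z p t].

(** A functional with values in K + x is, modulo K, a multiple x z; as x is a nonzerodivisor
    modulo K, [z] is a functional modulo K, and lifts. *)
Lemma dual_m_adj (S T : finType) (K : set R) x (A : S -> T -> R) :
  is_ideal K -> nzd_mod K x -> x \in m -> lifting_mod K A ->
  (forall w : T -> R^o, (forall s, mv A w s = 0) -> (forall t, K (w t)) -> dual_m A w) ->
  forall w : T -> R^o, (forall s, mv A w s = 0) -> (forall t, adj K x (w t)) -> dual_m A w.
Proof.
move=> iK xK xm hA hK w Aw /choice[k /choice[z kz]].
have [|w' [Aw' ww']] := hA (z : T -> R^o).
  move=> s; apply: xK; rewrite -[x * _]/(x *: _) -mvZ.
  have -> : mv A (fun t => x *: (z t : R^o)) s = mv A w s - mv A (fun t => k t : R^o) s.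
    by rewrite -mvB; apply: eq_lc => // t; have [_ ->] := kz t; rewrite addrAC subrr add0r.
  rewrite Aw sub0r; apply: idealN => //.
  by apply: (@submod_lc _ R^o) => // t; case: (kz t).
have [||P [y [v [ym Av hv]]]] := hK (fun t => w t - x *: w' t).
- by move=> s; rewrite (mvB A w) mvZ Aw Aw' scaler0 subr0.
- move=> t; have [Kk ->] := kz t; rewrite -[x *: _]/(x * _).
  rewrite (_ : _ - _ = k t + x * (z t - w' t)); last by ring.
  by apply: idealD => //; apply: idealM.
exists (P + unit)%type, (fun o => if o is inl p then y p else x),
  (fun o => if o is inl p then v p else w').
split=> [[p|] //|[p|] //|t].
rewrite big_sumType /= -hv (bigD1 tt) //= big1 ?addr0 ?subrK //.
Qed.

Lemma regseq_lifting (S T U : finType) (K : set R) xs (B : U -> S -> R) (A : S -> T -> R) :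
  is_ideal K -> (forall x, x \in xs -> x \in m) -> regseq K xs ->
  (forall u t, vm (B u) A t = 0) -> coexact_mod (adjs K xs) B A ->
  lifting_mod K A ->
  (forall w : T -> R^o, (forall s, mv A w s = 0) -> (forall t, K (w t)) -> dual_m A w) ->
  lifting_mod (adjs K xs) A /\
  forall w : T -> R^o, (forall s, mv A w s = 0) -> (forall t, adjs K xs (w t)) -> dual_m A w.
Proof.
move=> + + + BA0; elim: xs K => //= x xs IH K iK xsm [xK rxs] hB hA hK.
have xm : x \in m by apply: xsm; rewrite mem_head.
apply: IH => //; first exact: adj_ideal.
- by move=> y yxs; apply: xsm; rewrite inE yxs orbT.
- by apply: lifting_mod_adj (hA) => //; apply: (coexact_mod_regseq (xs := x :: xs)).
- exact: dual_m_adj hK.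
Qed.

Definition exact_pair (S T U : finType) (A : S -> T -> R) (B : U -> S -> R) : Prop :=
  (forall u t, vm (B u) A t = 0) /\
  forall w : S -> R^o, (forall u, mv B w u = 0) ->
    exists y : T -> R^o, forall s, w s = mv A y s.

(** Induction along a projective resolution of length n uses n + 2 further maps. *)
Fixpoint right_exact (k : nat) : forall S T : finType, (S -> T -> R) -> Prop :=
  if k is k'.+1 then fun S T A =>
    exists (U : finType) (B : U -> S -> R), exact_pair A B /\ right_exact k' B
  else fun _ _ _ => True.

(** The dual of a free resolution of the cokernel of [A] is exact: the regularity of [xs]
    passes to all syzygies. *)
Lemma coker_regseq_right_exact xs k (S T : finType) (A : S -> T -> R) :
  (forall x, x \in xs -> x \in m) -> regseq [set 0] xs ->
  self_injective_mod (adjs [set 0] xs) ->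
  coker_regseq [set 0] xs A -> right_exact k A.
Proof.
move=> xsm rxs sI; have iI0 := @ideal_zero R.
elim: k S T A => //= k IH S T A rA.
have [U [B BA]] := syzygies_exist nR A.
have BA0 u t : vm (B u) A t = 0 by exact: syz_row BA u t.
have BAex : exact_mod [set 0] B A.
  by move=> v /(BA v).1[c vc]; exists c => s; rewrite vc subrr.
have hc : coexact_mod [set 0] B A.
  apply: (coexact_mod_regseq (xs := xs)) => //.
  apply: self_injective_coexact => //; first exact: adjs_ideal.
  exact: exact_mod_regseq.
exists U, B; split; last by apply: IH; exact: coker_regseq_syz BAex.
split=> // w /hc[y hy]; exists y => s; apply/eqP; rewrite -subr_eq0; apply/eqP.
exact: hy.
Qed.

End DualExactness.

(** * The trace of the Frobenius *)

Section LocalLinearAlgebra.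
Variables (R : comNzRingType) (m : idealr R).
Hypotheses (nR : noetherian R) (lR : local_ring m).

(** Gaussian elimination with pivots outside m; it replaces linear algebra over the
    residue field. *)
Lemma left_kernel_mod (S T : finType) (A : {set T}) (B : {set S}) (L : S -> T -> R) :
  (#|A| < #|B|)%N -> exists v : S -> R, [/\ forall s, s \notin B -> v s = 0,
    exists s, v s \notin m & forall t, t \in A -> vm v L t \in m].
Proof.
suff h : forall k (A : {set T}) (B : {set S}) (L : S -> T -> R), #|A| = k ->
    (k < #|B|)%N -> exists v : S -> R, [/\ forall s, s \notin B -> v s = 0,
      exists s, v s \notin m & forall t, t \in A -> vm v L t \in m].
  exact: h.
move=> {A B L} k; elim: k => [|k IH] A B L cA cB.

  have /set0Pn[s0 s0B] : B != finset.set0 by rewrite -card_gt0.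
  exists (fun s => (s == s0)%:R); split.
  - by move=> s; case: eqP => // ->; rewrite s0B.
  - by exists s0; rewrite eqxx idealr1.
  - by move=> t; rewrite (cards0_eq cA) inE.
have [t0 t0A] : exists t, t \in A by apply/set0Pn; rewrite -card_gt0 cA.
have cA' : #|A :\ t0| = k by move: cA; rewrite (cardsD1 t0) t0A => -[].
have [[s0 [s0B Lst]]|hn] := pselect (exists s0, s0 \in B /\ L s0 t0 \notin m).
  have [b bL] := local_unit nR lR Lst.
  have [|v [v0 [s1 vs1] hv]] :=
    IH (A :\ t0) (B :\ s0) (fun s t => L s t - L s t0 * b * L s0 t) cA'.
    by move: cB; rewrite (cardsD1 s0) s0B.
  have vs0 : v s0 = 0 by apply: v0; rewrite !inE eqxx.
  pose w := - \sum_s v s * (L s t0 * b).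
  exists (fun s => if s == s0 then w else v s).
  have vmE t : vm (fun s => if s == s0 then w else v s) L t =
      vm v (fun s t => L s t - L s t0 * b * L s0 t) t.
    rewrite /vm (bigD1 s0) //= eqxx [RHS](eq_bigr (fun s => v s * L s t -
      (v s * (L s t0 * b)) * L s0 t)); last by move=> s _; ring.
    rewrite sumrB -mulr_suml addrC /w mulNr; congr (_ - _).
    rewrite [RHS](bigD1 s0) //= vs0 mul0r add0r; apply: eq_bigr => s /negbTE.
    by move=> ->.
  split.
  - move=> s sB; case: eqP => [es|/eqP ns]; first by rewrite es s0B in sB.
    by apply: v0; rewrite !inE negb_and sB orbT.
  - exists s1; case: eqP => // es; by rewrite es vs0 idealr0 in vs1.
  - move=> t tA; rewrite vmE; have [->|tt0] := eqVneq t t0; last first.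
      by apply: hv; rewrite !inE tt0.
    rewrite /vm big1 ?idealr0 // => s _.
    by rewrite -mulrA bL mulr1 subrr mulr0.
have [|v [v0 vs hv]] := IH (A :\ t0) B L cA'; first exact: ltnW.
exists v; split=> // t tA; have [->|tt0] := eqVneq t t0; last first.
  by apply: hv; rewrite !inE tt0.
apply: (ideal_sum (max_ideal_set m)) => s.
have [sB|sB] := boolP (s \in B); last by rewrite v0 // mul0r /= idealr0.
by apply: idealMr; apply: contrapT => /negP Lm; apply: hn; exists s.
Qed.

End LocalLinearAlgebra.

(** The additive endomorphisms of R, with R acting by multiplication on the source.
    This is the R-module in which the dual of F_* R is a submodule over F_* R. *)
Section AdditiveMaps.
Variable R : comNzRingType.

Definition additive_pred : {pred R -> R} :=
  fun f => `[< forall r s, f (r + s) = f r + f s >].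

Fact additive_pred_closed : zmod_closed additive_pred.
Proof.
split; first by rewrite unfold_in; apply/asboolP => r s; rewrite addr0.
move=> f h; rewrite !unfold_in => /asboolP fD /asboolP hD; apply/asboolP => r s.
by rewrite !addrfctE !opprfctE fD hD opprD addrACA.
Qed.

HB.instance Definition _ :=
  GRing.isZmodClosed.Build (R -> R) additive_pred additive_pred_closed.

Record addmap := AddMap {addmap_val : R -> R; _ : addmap_val \in additive_pred}.

HB.instance Definition _ := [isSub for addmap_val].
HB.instance Definition _ := [Choice of addmap by <:].
HB.instance Definition _ := [SubChoice_isSubZmodule of addmap by <:].

Lemma addmapP (f : addmap) r s :
  addmap_val f (r + s) = addmap_val f r + addmap_val f s.
Proof. by have := valP f; rewrite unfold_in => /asboolP; exact. Qed.

Fact addmap_scale_subproof a (f : addmap) :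
  (fun t => addmap_val f (a * t)) \in additive_pred.
Proof. by rewrite unfold_in; apply/asboolP => r s; rewrite mulrDr addmapP. Qed.

Let scale a f : addmap := AddMap (addmap_scale_subproof a f).

Let scaleA a b f : scale a (scale b f) = scale (a * b) f.
Proof. by apply/val_inj/funext => t /=; rewrite mulrA [b * a]mulrC. Qed.
Let scale1 : left_id 1 scale.
Proof. by move=> f; apply/val_inj/funext => t /=; rewrite mul1r. Qed.
Let scaleDr : right_distributive scale +%R.
Proof. by move=> a f h; apply/val_inj/funext. Qed.
Let scaleDl f : {morph scale^~ f : a b / a + b}.
Proof. by move=> a b; apply/val_inj/funext => t /=; rewrite mulrDl addmapP. Qed.

HB.instance Definition _ :=
  GRing.Zmodule_isLmodule.Build R addmap scaleA scale1 scaleDr scaleDl.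

Lemma addmap_scaleE a (f : addmap) t : addmap_val (a *: f) t = addmap_val f (a * t).
Proof. by []. Qed.
Lemma addmapD (f h : addmap) t : addmap_val (f + h) t = addmap_val f t + addmap_val h t.
Proof. by []. Qed.
Lemma addmapB (f h : addmap) t : addmap_val (f - h) t = addmap_val f t - addmap_val h t.
Proof. by []. Qed.
Lemma addmap_lc (T : finType) (c : T -> R) (F : T -> addmap) t :
  addmap_val (lc c F) t = \sum_i addmap_val (F i) (c i * t).
Proof.
by apply: (big_morph (fun f : addmap => addmap_val f t)) => // f h.
Qed.
Lemma addmap_exists (f : R -> R) : (forall r s, f (r + s) = f r + f s) ->
  exists h : addmap, addmap_val h = f.
Proof.
move=> fD; have Pf : f \in additive_pred by rewrite unfold_in; apply/asboolP.
by exists (AddMap Pf).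
Qed.

End AdditiveMaps.

Section FrobeniusDuality.
Variables (R : comNzRingType) (m : idealr R).
Hypotheses (nR : noetherian R) (lR : local_ring m).
Variable q' : nat.
Local Notation q := q'.+1.
Hypothesis qD : forall x y : R, (x + y) ^+ q = x ^+ q + y ^+ q.
Variables (S : finType) (g : S -> R).
Hypothesis gen : forall r, exists a : S -> R, r = \sum_s a s ^+ q * g s.

Lemma q0 : 0 ^+ q = 0 :> R. Proof. by rewrite expr0n. Qed.
Lemma qB (x y : R) : (x - y) ^+ q = x ^+ q - y ^+ q.
Proof. by apply/eqP; rewrite eq_sym subr_eq -qD subrK. Qed.
Lemma q_sum (T : finType) (f : T -> R) : (\sum_t f t) ^+ q = \sum_t f t ^+ q.
Proof. by apply: (big_morph (fun x => x ^+ q) qD q0). Qed.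

(** Additive maps that are linear when the source is seen as an R-module through the
    [q]-th power map. *)
Definition plin (f : R -> R) : Prop :=
  (forall r s, f (r + s) = f r + f s) /\ forall a r, f (a ^+ q * r) = a * f r.

Lemma plin0 f : plin f -> f 0 = 0.
Proof. by move=> [_ /(_ 0 0)]; rewrite mulr0 mul0r. Qed.
Lemma plinB f r s : plin f -> f (r - s) = f r - f s.
Proof. by move=> [fD _]; apply/eqP; rewrite eq_sym subr_eq -fD subrK. Qed.
Lemma plin_sum f (T : finType) (h : T -> R) : plin f -> f (\sum_t h t) = \sum_t f (h t).
Proof. by move=> lf; apply: (big_morph f lf.1 (plin0 lf)). Qed.
Lemma plinD f f' : plin f -> plin f' -> plin (fun t => f t + f' t).
Proof.
move=> [fD fZ] [fD' fZ']; split=> [r s|a r]; first by rewrite fD fD' addrACA.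
by rewrite fZ fZ' mulrDr.
Qed.
Lemma plin_mul f r : plin f -> plin (fun t => f (r * t)).
Proof.
move=> [fD fZ]; split=> [s t|a s]; first by rewrite mulrDr fD.
by rewrite mulrCA fZ.
Qed.
Lemma plin_zero : plin (fun=> 0).
Proof. by split=> *; rewrite ?addr0 ?mulr0. Qed.
Lemma plin_opp f : plin f -> plin (fun t => - f t).
Proof. by move=> [fD fZ]; split=> *; rewrite ?fD ?fZ ?opprD ?mulrN. Qed.
Lemma plin_add_sum (T : finType) (f : T -> R -> R) :
  (forall t, plin (f t)) -> plin (fun r => \sum_t f t r).
Proof.
move=> lf; split=> [r s|a r].
  by rewrite -big_split; apply: eq_bigr => t _; case: (lf t).
by rewrite mulr_sumr; apply: eq_bigr => t _; case: (lf t).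
Qed.

Definition comb (z : S -> R) : R := \sum_s z s ^+ q * g s.

Lemma combB z w : comb (fun s => z s - w s) = comb z - comb w.
Proof. by rewrite -sumrB; apply: eq_bigr => s _; rewrite qB mulrBl. Qed.
Lemma combD z w : comb (fun s => z s + w s) = comb z + comb w.
Proof. by rewrite -big_split; apply: eq_bigr => s _; rewrite qD mulrDl. Qed.
Lemma combZ a z : comb (fun s => a * z s) = a ^+ q * comb z.
Proof. by rewrite mulr_sumr; apply: eq_bigr => s _; rewrite exprMn mulrA. Qed.
Lemma comb_vm (T : finType) (v : T -> R) (A : T -> S -> R) :
  comb (vm v A) = \sum_t v t ^+ q * comb (A t).
Proof.
rewrite /comb /vm; under eq_bigr do rewrite q_sum mulr_suml.
rewrite exchange_big /=; apply: eq_bigr => t _; rewrite mulr_sumr.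
by apply: eq_bigr => s _; rewrite exprMn mulrA.
Qed.
Lemma plin_comb f z : plin f -> f (comb z) = \sum_s z s * f (g s).
Proof. by move=> lf; rewrite plin_sum //; apply: eq_bigr => s _; rewrite lf.2. Qed.

Lemma comb_surj r : exists z, r = comb z. Proof. exact: gen. Qed.

(** The presentation of R, seen as a module through the [q]-th power map. *)
Lemma relations_exist : exists (U : finType) (A : U -> S -> R), forall v : S -> R,
  comb v = 0 <-> exists c, v =1 vm c A.
Proof.
pose K : set (S -> R^o) := [set v : S -> R^o | comb v = 0].
have sK : submodule K.
  split; first by rewrite /K /= /comb big1 // => s _; rewrite q0 mul0r.
  - by move=> v w Kv Kw; rewrite /K /= combD Kv Kw addr0.
  - by move=> a v Kv; rewrite /K /= combZ Kv mulr0.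
have [U [A [KA Ksp]]] := noeth_fgen_vec nR sK.
exists U, A => v; split=> [/Ksp[c ->]|[c vc]].
  by exists c => s; rewrite /lcomb fct_sumE.
have -> : v = (lc c A : S -> R) by apply/funext => s; rewrite vc /lcomb fct_sumE.
exact: (submod_lc c sK KA).
Qed.

Variables (U : finType) (A : U -> S -> R).
Hypothesis relA : forall v : S -> R, comb v = 0 <-> exists c, v =1 vm c A.

Lemma comb_rel c : comb (vm c A) = 0. Proof. by apply/relA; exists c. Qed.

Lemma comb_row u : comb (A u) = 0.
Proof.
rewrite -(comb_rel (fun u' => (u' == u)%:R)); apply: eq_bigr => s _.
by rewrite vm1.
Qed.

Lemma plin_of_dual (w : S -> R^o) : (forall u, mv A w u = 0) ->
  exists f, plin f /\ forall z, f (comb z) = \sum_s z s * w s.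
Proof.
move=> Aw; have [c hc] := choice gen.
have wd (z z' : S -> R) : comb z = comb z' -> \sum_s z s * w s = \sum_s z' s * w s.
  move=> zz'; have /relA[b hb] : comb (fun s => z s - z' s) = 0 by rewrite combB zz' subrr.
  apply/eqP; rewrite -subr_eq0 -sumrB; apply/eqP.
  rewrite (eq_bigr (fun s => vm b A s *: w s)) => [|s _]; last by rewrite -hb -mulrBl.
  have : lc b (mv A w) = 0 by rewrite /lcomb big1 // => u _; rewrite Aw scaler0.
  by rewrite lc_mv.
have hc' z : \sum_s c (comb z) s * w s = \sum_s z s * w s by apply: wd; exact/esym/hc.
have rc r : r = comb (c r) := hc r.
exists (fun r => \sum_s c r s * w s); split; last exact: hc'.
split=> [r s|a r].
  have -> : r + s = comb (fun t => c r t + c s t) by rewrite combD -!rc.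
  rewrite hc' -big_split; apply: eq_bigr => t _.
  exact: mulrDl.
have -> : a ^+ q * r = comb (fun t => a * c r t) by rewrite combZ -rc.
rewrite hc' mulr_sumr; apply: eq_bigr => t _.
by rewrite mulrA.
Qed.

Lemma dual_of_plin f : plin f -> forall u, mv A (fun s => f (g s) : R^o) u = 0.
Proof. by move=> lf u; rewrite -[LHS](plin_comb (A u) lf) comb_row plin0. Qed.

(** An element x acts on F_* R as x^q; the ideal [L] stands for the submodule K F_* R. *)
Lemma coker_regseq_frobenius (K L : set R) xs : is_ideal K -> is_ideal L ->
  regseq L [seq x ^+ q | x <- xs] ->
  (forall v, L (comb v) -> row_mod K A v) ->
  (forall v, (forall s, K (v s)) -> L (comb v)) ->
  coker_regseq K xs A.
Proof.
elim: xs K L => //= x xs IH K L iK iL [xL rxs] LK KL.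
have KA z c : (forall s, K (z s - vm c A s)) -> L (comb z).
  by move=> /KL; rewrite combB comb_rel subr0.
split.
  move=> z [c hc]; apply: LK; apply: xL; rewrite -combZ; exact: KA hc.
apply: (IH _ (adj L (x ^+ q))) => //; try exact: adj_ideal.
- move=> v [l [r [Ll e]]]; have [z rz] := gen r.
  have [c hc] : row_mod K A (fun s => v s - x * z s).
    by apply: LK; rewrite combB combZ e rz addrK.
  exists c => s; exists (v s - x * z s - vm c A s), (z s); split=> //; ring.
- move=> v /choice[k /choice[z hz]]; exists (comb k), (comb z); split.
    by apply: KL => s; case: (hz s).
  by rewrite -combZ -combD; apply: eq_bigr => s _; case: (hz s) => _ ->.
Qed.

Lemma comb_adjs (K L : set R) xs : is_ideal K ->
  (forall r, L r <-> exists2 z, (forall s, K (z s)) & r = comb z) ->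
  forall r, adjs L [seq x ^+ q | x <- xs] r <->
    exists2 z, (forall s, adjs K xs (z s)) & r = comb z.
Proof.
elim: xs K L => //= x xs IH K L iK KL; apply: IH; first exact: adj_ideal.
move=> r; split.
  move=> [l [t [/KL[z Kz ->] ->]]]; have [w ->] := gen t.
  exists (fun s => z s + x * w s); last by rewrite combD combZ.
  by move=> s; exists (z s), (w s).
move=> [z /choice[k /choice[w hw]] ->].
exists (comb k), (comb w); split.
  by apply/KL; exists k => // s; case: (hw s).
by rewrite -combZ -combD; apply: eq_bigr => s _; case: (hw s) => _ ->.
Qed.

(** The map from (u) to R/I with image (v) extends to R, hence is a multiplication. *)
Lemma socle_simple (I : set R) u v : self_injective_mod I -> is_ideal I ->
  socle_mod m I u -> (forall a, a \in m -> I (a * v)) -> exists r, I (v - u * r).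
Proof.
move=> sI iI [Iu _] mv_.
have [|r hr] := sI unit unit (fun _ _ => u) (fun=> v); last first.
  by exists (r tt); have := hr tt; rewrite (bigD1 tt) //= big1 ?addr0 // => -[].
move=> c /(_ tt); rewrite /vm (bigD1 tt) //= big1 ?addr0; last by case.
rewrite (bigD1 tt) //= big1 ?addr0 => [Icu|]; last by case.
apply: mv_; apply: contrapT => /negP /(local_unit nR lR)[b bc].
by apply: Iu; rewrite -[u]mul1r -bc -mulrA; exact: idealM.
Qed.

(** A nonzerodivisor modulo I is a unit modulo I, since the map dividing by it extends. *)
Lemma self_injective_socle (I : set R) : self_injective_mod I -> is_ideal I -> ~ I 1 ->
  exists u, socle_mod m I u.
Proof.
move=> sI iI I1; have [[a am na]|//] := nzd_or_socle m nR iI I1.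
have [|r hr] := sI unit unit (fun _ _ => a) (fun=> 1).
  move=> c /(_ tt); rewrite /vm (bigD1 tt) //= big1 ?addr0; last by case.
  rewrite mulrC => /na Ic; apply: ideal_sum => // -[].
  by rewrite mulr1.
have : [set` m] 1.
  have Im x : I x -> x \in m := local_sub nR lR iI I1 (x := x).
  apply: (ideal_subl (max_ideal_set m) (Im _ (hr tt))).
  apply: (ideal_sum (max_ideal_set m)) => i.
  by rewrite /= mulrC idealMr.
by rewrite /= idealr1.
Qed.

Variable xs : seq R.
Hypotheses (xsm : forall x, x \in xs -> x \in m) (rxs : regseq [set 0] xs).
Local Notation I := (adjs [set 0] xs).
Local Notation J := (adjs [set 0] [seq x ^+ q | x <- xs]).
Hypotheses (sI : self_injective_mod I) (sJ : self_injective_mod J).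

Let iI : is_ideal I. Proof. by apply: adjs_ideal; exact: ideal_zero. Qed.
Let iJ : is_ideal J. Proof. by apply: adjs_ideal; exact: ideal_zero. Qed.

Let Im x : I x -> x \in m.
Proof.
apply: (adjs_min (I := [set` m])) => //; first exact: max_ideal_set.
by move=> _ ->; exact: idealr0.
Qed.

Let Jm x : J x -> x \in m.
Proof.
apply: (adjs_min (I := [set` m])) => //; first exact: max_ideal_set.
  by move=> _ ->; exact: idealr0.
by move=> _ /mapP[y ym ->] /=; rewrite exprSr idealMr // xsm.
Qed.

Let rys : regseq [set 0] [seq x ^+ q | x <- xs].
Proof. by apply: regseq_expr => //; exact: ideal_zero. Qed.

Let combJ r : J r <-> exists2 z, (forall s, I (z s)) & r = comb z.
Proof.
apply: comb_adjs; first exact: ideal_zero.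
move=> t; split=> [->|[z z0 ->]].
  by exists (fun=> 0) => //; rewrite /comb big1 // => s _; rewrite q0 mul0r.
by rewrite /comb big1 // => s _; rewrite z0 q0 mul0r.
Qed.

Lemma plin_J f r : plin f -> J r -> I (f r).
Proof.
move=> lf /combJ[z Iz ->]; rewrite plin_comb //.
by apply: ideal_sum => // s; exact: idealMl.
Qed.

Lemma coker_regseq_rel : coker_regseq [set 0] xs A.
Proof.
apply: (@coker_regseq_frobenius [set 0] [set 0]) => //; try exact: ideal_zero.
  by move=> v /relA[c vc]; exists c => s; rewrite vc subrr.
by move=> v v0; rewrite /= /comb big1 // => s _; rewrite v0 q0 mul0r.
Qed.

Let lifting : lifting_mod I A /\
  forall w : S -> R^o, (forall u, mv A w u = 0) -> (forall s, I (w s)) -> dual_m m A w.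
Proof.
have [V [B BA]] := syzygies_exist nR A.
have BA0 v s : vm (B v) A s = 0 by exact: syz_row BA v s.
have BAex : exact_mod [set 0] B A.
  by move=> v /(BA v).1[c vc]; exists c => s; rewrite vc subrr.
apply: (regseq_lifting nR lR (B := B)) => //.
- exact: ideal_zero.
- apply: self_injective_coexact => //.
  apply: exact_mod_regseq => //; [exact: ideal_zero|exact: coker_regseq_rel].
- by move=> w Aw; exists w; split=> [u|t]; [exact: Aw|rewrite subrr].
- move=> w _ w0; exists void, (of_void _), (of_void _); split=> [[]|[]|t].
  by rewrite big_pred0 //; exact: w0.
Qed.

Lemma sum_prod_delta (P V : finType) (p : P) (F : P * V -> R) (G : V -> R) :
  (forall p' v, F (p', v) = if p' == p then G v else 0) -> \sum_i F i = \sum_v G v.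
Proof.
move=> FG; rewrite (eq_bigr (fun i => if i.1 == p then G i.2 else 0)); last by case.
rewrite -(pair_bigA _ (fun p' v => if p' == p then G v else 0)) /= (bigD1 p) //=.
rewrite [X in _ + X]big1 ?addr0; last by move=> p' /negbTE ->; rewrite big1.
by apply: eq_bigr => v _; rewrite eqxx.
Qed.

(** R/I is injective on modules killed by I, and maps to R/I lift to R: a functional
    with values in R/I on a submodule of a power of F_* (R/I) extends to a map that is
    the reduction of a linear map to R. *)
Lemma plin_extension (T P : finType) (a : T -> P -> R) (w : T -> R) :
  (forall v : T -> R, (forall p, J (\sum_t v t ^+ q * a t p)) -> I (\sum_t v t * w t)) ->
  exists f : P -> R -> R, (forall p, plin (f p)) /\
    forall t, I (w t - \sum_p f p (a t p)).
Proof.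
move=> hw; have /choice[al hal] : forall tp, exists z, a tp.1 tp.2 = comb z.
  by move=> tp; exact: gen.
(* the rows of [a] in coordinates, then the relations, on which the functional is 0 *)
pose M (i : T + P * U) (j : P * S) : R := match i with
  | inl t => al (t, j.1) j.2
  | inr pu => if pu.1 == j.1 then A pu.2 j.2 else 0
  end.
pose W (i : T + P * U) : R := if i is inl t then w t else 0.
have [|y hy] := sI (a := M) (w := W).
  move=> v hv; rewrite big_sumType /= [X in _ + X]big1 ?addr0; last first.
    by move=> i _; rewrite mulr0.
  apply: hw => p; apply/combJ.
  exists (fun s => vm v M (p, s)) => [s|]; first exact: hv.
  have -> : (fun s => vm v M (p, s)) =
    (fun s => vm (v \o inl) (fun t => al (t, p)) s +
              vm (fun u => v (inr (p, u))) A s).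
    apply/funext => s; rewrite /vm big_sumType; congr (_ + _).
    apply: (sum_prod_delta (p := p)) => p' u /=.
    by case: eqP => [->|_]; rewrite ?mulr0.
  rewrite combD comb_rel addr0 comb_vm; apply: eq_bigr => t _.
  by rewrite -hal.
have /choice[y' hy'] : forall p, exists y' : S -> R^o, (forall u, mv A y' u = 0) /\
    forall s, I (y (p, s) - y' s).
  move=> p; apply: (lifting.1 (fun s => y (p, s))) => u.
  have := idealN iI (hy (inr (p, u))); rewrite sub0r opprK.
  rewrite (sum_prod_delta (p := p) (G := fun s => A u s * y (p, s))) // => p' s /=.
  by rewrite eq_sym; case: eqP => [->|_]; rewrite ?mul0r.
have /choice[f hf] : forall p, exists f, plin f /\ forall z, f (comb z) = \sum_s z s * y' p s.
  by move=> p; apply: plin_of_dual; case: (hy' p).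
exists f; split=> [p|t]; first by case: (hf p).
have fE : \sum_p f p (a t p) = \sum_p \sum_s al (t, p) s * y' p s.
  by apply: eq_bigr => p _; have [_ <-] := hf p; rewrite -hal.
have := hy (inl t); rewrite /= fE.
rewrite (eq_bigr (fun j => al (t, j.1) j.2 * y (j.1, j.2))); last by case.
rewrite -(pair_bigA _ (fun p s => al (t, p) s * y (p, s))) /= => h.
have -> : w t - \sum_p \sum_s al (t, p) s * y' p s =
    (w t - \sum_p \sum_s al (t, p) s * y (p, s)) +
    \sum_p \sum_s al (t, p) s * (y (p, s) - y' p s).
  rewrite -addrA; congr (_ + _); apply/eqP; rewrite eq_sym addrC subr_eq addrC.
  rewrite -sumrB; apply/eqP; apply: eq_bigr => p _; rewrite -sumrB.
  by apply: eq_bigr => s _; rewrite mulrBr.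
apply: idealD => //; apply: ideal_sum => // p; apply: ideal_sum => // s.
by apply: idealM; case: (hy' p).
Qed.

Section Trace.
Variables (u sg : R) (Phi : R -> R).
Hypotheses (hu : socle_mod m I u) (hsg : socle_mod m J sg) (lPhi : plin Phi).
Hypothesis Phi_sg : I (u - Phi sg).

Lemma plin_socle_m f t : plin f -> t \in m -> I (f (sg * t)).
Proof. by move=> lf tm; apply: plin_J => //; rewrite mulrC; exact: hsg.2. Qed.

Lemma plin_socle f t : plin f -> exists l, I (f (sg * t) - u * l).
Proof.
move=> lf; apply: socle_simple hu _ => // a am; rewrite -lf.2.
apply: plin_J => //; rewrite (_ : _ * _ = (t * a ^+ q) * sg); last by ring.
by apply: hsg.2; apply: idealMr; rewrite exprSr idealMr.
Qed.

(** A unit [r] cannot kill the socle generator, as Phi does not. *)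
Lemma Phi_socle_faithful r : (forall t, I (Phi (sg * (r * t)))) -> r \in m.
Proof.
move=> hr; apply: contrapT => /negP /(local_unit nR lR)[b br].
have := hr b; rewrite [r * b]mulrC br mulr1 => IPhi.
by apply: hu.1; exact: (ideal_subl iI Phi_sg).
Qed.

(** The [g s] with [s] in [B] form, modulo m, a basis of F_* k over the residue field k. *)
Lemma residue_basis : exists B : {set S},
  (forall r, exists a : S -> R, r - \sum_(s in B) a s ^+ q * g s \in m) /\
  forall v : S -> R, \sum_(s in B) v s ^+ q * g s \in m -> forall s, s \in B -> v s \in m.
Proof.
suff h : forall k (B : {set S}), (#|B| <= k)%N ->
    (forall r, exists a : S -> R, r - \sum_(s in B) a s ^+ q * g s \in m) ->
    exists B : {set S},
  (forall r, exists a : S -> R, r - \sum_(s in B) a s ^+ q * g s \in m) /\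
  forall v : S -> R, \sum_(s in B) v s ^+ q * g s \in m -> forall s, s \in B -> v s \in m.
  apply: (h _ (finset.setT : {set S}) (leqnn _)) => r; have [a ra] := gen r; exists a.
  rewrite (eq_bigl predT) => [|s]; last exact: finset.in_setT.
  by rewrite -ra subrr idealr0.
elim=> [|k IH] B cB genB.
  by exists B; split=> // v _ s; move: cB; rewrite leqn0 cards_eq0 => /eqP ->; rewrite inE.
have [indep|dep] := pselect (forall v : S -> R, \sum_(s in B) v s ^+ q * g s \in m ->
  forall s, s \in B -> v s \in m); first by exists B.
have [v [s0 [vm0 s0B vs0]]] : exists v s0,
    [/\ \sum_(s in B) v s ^+ q * g s \in m, s0 \in B & v s0 \notin m].
  apply: contrapT => nv; apply: dep => v hv s sB; apply: contrapT => /negP vs.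
  by apply: nv; exists v, s.
apply: (IH (B :\ s0)); first by move: cB; rewrite (cardsD1 s0) s0B.
move=> r; have [a ha] := genB r; have [b bv] := local_unit nR lR vs0.
exists (fun s => a s - a s0 * b * v s).
have -> : r - \sum_(s in B :\ s0) (a s - a s0 * b * v s) ^+ q * g s =
  (r - \sum_(s in B) a s ^+ q * g s) +
  (a s0 * b) ^+ q * \sum_(s in B) v s ^+ q * g s.
  rewrite !(big_setD1 s0 s0B) /= mulrDr mulrA -exprMn -mulrA bv mulr1 mulr_sumr.
  rewrite (eq_bigr (fun s => a s ^+ q * g s - (a s0 * b) ^+ q * (v s ^+ q * g s))).
    by rewrite sumrB; ring.
  by move=> s _; rewrite qB exprMn; ring.
by apply: rpredD => //; exact: idealMr.
Qed.

(** Let k be the residue field.  The maps from F_* k to the socle of R/I form the dual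
    of F_* k over k, which is one-dimensional over F_* k.  Concretely, if b is the
    dimension of F_* k, then the values on a basis of the multiples of [Phi] by the
    elements of that basis and of [f] are the b + 1 rows of a matrix with b columns;
    the coefficient of [f] in a relation between them is a unit. *)
Lemma trace_on_socle f : plin f -> exists r, forall t, I (f (sg * t) - Phi (r * (sg * t))).
Proof.
move=> lf; have [B [genB indB]] := residue_basis.
have /choice[L0 hL0] : forall ss, exists l, I (Phi (sg * (g ss.1 * g ss.2)) - u * l).
  by move=> ss; exact: plin_socle.
have /choice[c hc] : forall s, exists l, I (f (sg * g s) - u * l).
  by move=> s; exact: plin_socle.
(* multiples of Phi in the rows of [S], then [f] in the last row *)
pose L (i : S + unit) (t : S) : R := if i is inl s then L0 (s, t) else c t.
pose B' : {set S + unit} := [set i | if i is inl s then s \in B else true]%SET.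
have cB : (#|B| < #|B'|)%N.
  rewrite -(card_imset (mem B) (f := @inl S unit)); last by move=> x y [].
  apply: proper_card; apply/properP; split.
    by apply/fintype.subsetP => _ /imsetP[s sB ->]; rewrite inE.
  by exists (inr tt); rewrite ?inE //; apply/imsetP => -[].
have [v [vB [i0 vi0] hv]] := left_kernel_mod nR lR L cB.
have v0 s : s \notin B -> v (inl s) = 0 by move=> sB; apply: vB; rewrite inE.
pose rr := \sum_s v (inl s) ^+ q * g s; pose w := v (inr tt).
have rrB : rr = \sum_(s in B) v (inl s) ^+ q * g s.
  rewrite /rr (bigID (mem B)) /= [X in _ + X]big1 ?addr0 // => s /v0 ->.
  by rewrite q0 mul0r.
pose F t := Phi (sg * (rr * t)) + w * f (sg * t).
have lF : plin F.
  split=> [x y|a x].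
    by rewrite /F !mulrDr lPhi.1 lf.1; ring.
  have -> : F (a ^+ q * x) = Phi (a ^+ q * (sg * (rr * x))) + w * f (a ^+ q * (sg * x)).
    by rewrite /F; congr (Phi _ + w * f _); ring.
  by rewrite lPhi.2 lf.2 /F; ring.
have Fm t : t \in m -> I (F t).
  move=> tm; apply: idealD => //; last by apply: idealM => //; exact: plin_socle_m.
  by apply: plin_socle_m => //; exact: idealMr.
have Fg t : t \in B -> I (F (g t)).
  move=> tB; have -> : F (g t) = \sum_s v (inl s) * (Phi (sg * (g s * g t)) - u * L0 (s, t))
      + w * (f (sg * g t) - u * c t) + vm v L t * u.
    have -> : vm v L t = \sum_s v (inl s) * L0 (s, t) + w * c t.
      rewrite /vm big_sumType /=; congr (_ + _).
      by rewrite (bigD1 tt) //= big1 ?addr0 // => -[].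
    rewrite /F /rr mulr_suml mulr_sumr plin_sum //.
    rewrite (eq_bigr (fun s => v (inl s) * (Phi (sg * (g s * g t)) - u * L0 (s, t)) +
       v (inl s) * L0 (s, t) * u)); last first.
      move=> s _; have -> : sg * (v (inl s) ^+ q * g s * g t) =
        v (inl s) ^+ q * (sg * (g s * g t)) by ring.
      by rewrite lPhi.2; ring.
    by rewrite big_split /= -mulr_suml /w; ring.
  apply: idealD => //; last by apply: hu.2; exact: hv.
  apply: idealD => //; last by apply: idealM => //; exact: hc.
  by apply: ideal_sum => // s; apply: idealM => //; exact: (hL0 (s, t)).
have FI t : I (F t).
  have [a ha] := genB t; rewrite -(subrK (\sum_(s in B) a s ^+ q * g s) t) lF.1.
  apply: idealD => //; first exact: Fm.
  rewrite (big_morph F lF.1 (plin0 lF)); elim/big_ind: _ => [||s sB].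
  - exact: ideal0.
  - by move=> *; exact: idealD.
  - by rewrite lF.2; apply: idealM => //; exact: Fg.
(* otherwise the relation involves the multiples of Phi alone *)
have wm : w \notin m.
  apply/negP => wm; have : rr \in m.
    apply: Phi_socle_faithful => t; have [l hl] := plin_socle t lf.
    apply: (ideal_subl iI (y := - (w * f (sg * t)))); first by rewrite opprK; exact: FI.
    apply: idealN => //; apply: (ideal_subl iI (y := w * (u * l))).
      by rewrite -mulrBr; exact: idealM.
    by rewrite mulrA; apply: idealMl => //; exact: hu.2.
  rewrite rrB => /indB hB; move: vi0; case: i0 => [s|[]]; last by rewrite wm.
  by have [/hB ->//|/v0 ->] := boolP (s \in B); rewrite idealr0.
have [b bw] := local_unit nR lR wm.
exists (- (b ^+ q * rr)) => t.
have -> : - (b ^+ q * rr) * (sg * t) = 0 - b ^+ q * (sg * (rr * t)) by ring.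
rewrite plinB // plin0 // lPhi.2.
have -> : f (sg * t) - (0 - b * Phi (sg * (rr * t))) = b * F t.
  transitivity (b * Phi (sg * (rr * t)) + (b * w) * f (sg * t)); last by rewrite /F; ring.
  by rewrite bw; ring.
exact: idealM.
Qed.

(** A functional that vanishes on the socle of R/J factors through multiplication by
    the generators of m, whose common kernel in R/J is the socle. *)
Lemma plin_vanishing_on_socle f : plin f -> (forall t, I (f (sg * t))) ->
  exists (P : finType) (y : P -> R) (h : P -> R -> R),
    [/\ forall p, y p \in m, forall p, plin (h p)
      & forall t, I (f t - \sum_p h p (y p * t))].
Proof.
move=> lf fsg; have [P [y [ym yP]]] := noeth_fgen nR (max_ideal_set m).
have [|h [lh hh]] := @plin_extension S P (fun s p => y p * g s) (fun s => f (g s)).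
  move=> v hv; rewrite -plin_comb //.
  have [|r hr] := socle_simple sJ iJ hsg (v := comb v).
    move=> _ /yP[c ->]; rewrite /lcomb mulr_suml; apply: ideal_sum => // p.
    rewrite -[_ *: _]/(c p * y p) -mulrA; apply: idealM => //.
    have := hv p; congr J; rewrite mulr_sumr; apply: eq_bigr => s _; ring.
  rewrite -(subrK (sg * r) (comb v)) lf.1; apply: idealD => //.
  exact: plin_J.
exists P, y, h; split=> // t; have [z ->] := comb_surj t.
have lfh : plin (fun t => f t - \sum_p h p (y p * t)).
  apply: plinD => //; apply: plin_opp; apply: plin_add_sum => p; exact: plin_mul.
rewrite (plin_comb z lfh); apply: ideal_sum => // s; apply: idealM => //.
Qed.

(** Nakayama's lemma over F_* R: by the three preceding lemmas and the lifting of maps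
    to R/I, the multiples of [Phi] generate the dual of F_* R modulo m. *)
Lemma plin_trace f : plin f -> exists r, forall t, f t = Phi (r * t).
Proof.
pose Z : set (addmap R) := [set f | plin (addmap_val f)].
pose B : set (addmap R) := [set f | exists r, forall t, addmap_val f t = Phi (r * t)].
have sZ : submodule Z.
  split; first exact: plin_zero.
  - by move=> h k lh lk; exact: plinD.
  - by move=> a h lh; exact: plin_mul.
have sB : submodule B.
  split; first by exists 0 => t; rewrite mul0r plin0.
  - by move=> h k [r hr] [s hs]; exists (r + s) => t; rewrite addmapD hr hs mulrDl lPhi.1.
  - by move=> a h [r hr]; exists (r * a) => t; rewrite addmap_scaleE hr mulrA.
have plin_addmap h : plin h -> exists2 k, Z k & addmap_val k = h.
  by move=> lh; have [k kh] := addmap_exists lh.1; exists k; rewrite // /Z /= kh.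
pose K : set (S -> R^o) := [set w : S -> R^o | forall i, mv A w i = 0].
have sK : submodule K.
  split; first by move=> i; exact: mv0.
  - by move=> x y Kx Ky i; rewrite (mvD A x y) Kx Ky addr0.
  - by move=> a x Kx i; rewrite (mvZ A a x) Kx scaler0.
have [P [w [Kw Ksp]]] := noeth_fgen_vec nR sK.
have /choice[F hF] : forall p, exists h : addmap R, Z h /\
    forall z, addmap_val h (comb z) = \sum_s z s * w p s.
  move=> p; have [h [lh hh]] := plin_of_dual (Kw p).
  by have [k Zk kh] := plin_addmap h lh; exists k; rewrite kh.
have span_F h : Z h -> exists c, h = lc c F.
  move=> lh; have [c hc] := Ksp _ (dual_of_plin lh).
  exists (fun p => c p ^+ q); apply/val_inj/funext => t; have [z ->] := comb_surj t.
  rewrite -[LHS]/(addmap_val h (comb z)) -[RHS]/(addmap_val _ (comb z)) addmap_lc.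
  rewrite (plin_comb z lh) [RHS](eq_bigr (fun p => \sum_s z s * (c p * w p s))).
    rewrite exchange_big /=; apply: eq_bigr => s _; rewrite -mulr_sumr; congr (_ * _).
    by have := congr1 (@^~ s) hc; rewrite /lcomb fct_sumE.
  move=> p _; rewrite -combZ (hF p).2; apply: eq_bigr => s _; ring.
pose mZ (h : addmap R) := exists c : P -> R, (forall p, c p \in m) /\ h = lc c F.
have mZ_sum (T : finType) (y : T -> R) (h : T -> addmap R) :
    (forall i, y i \in m) -> (forall i, Z (h i)) -> mZ (lc y h).
  move=> ym Zh; have /choice[c hc] : forall i, exists c, h i = lc c F.
    by move=> i; exact: span_F.
  exists (vm y c); split.
    by move=> p; apply: (ideal_sum (max_ideal_set m)) => i; rewrite /= mulrC idealMr.
  by rewrite -lc_mv; exact: eq_lc.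
have mZD h k : mZ h -> mZ k -> mZ (h + k).
  move=> [c [cm ->]] [d [dm ->]]; exists (fun p => c p + d p); rewrite lcD.
  by split=> // p; exact: rpredD.
have main h : Z h -> exists2 k, mZ k & B (h - k).
  move=> lh; have [r hr] := trace_on_socle lh.
  have lh1 : plin (fun t => addmap_val h t - Phi (r * t)).
    by apply: plinD => //; apply: plin_opp; exact: plin_mul.
  have [P1 [y1 [h1 [y1m lh1' hh1]]]] := plin_vanishing_on_socle lh1 hr.
  pose rho t := addmap_val h t - Phi (r * t) - \sum_p h1 p (y1 p * t).
  have lrho : plin rho.
    by apply: plinD => //; apply: plin_opp; apply: plin_add_sum => p; exact: plin_mul.
  have [P2 [y2 [v [y2m Av hv]]]] := lifting.2 _ (dual_of_plin lrho) (fun s => hh1 (g s)).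
  have /choice[H1 hH1] : forall p, exists k : addmap R, Z k /\ addmap_val k = h1 p.
    by move=> p; have [k Zk kh] := plin_addmap _ (lh1' p); exists k.
  have /choice[H2 hH2] : forall p, exists k : addmap R, Z k /\
      forall z, addmap_val k (comb z) = \sum_s z s * v p s.
    move=> p; have [k [lk hk]] := plin_of_dual (Av p).
    by have [k' Zk' kk'] := plin_addmap k lk; exists k'; rewrite kk'.
  exists (lc y1 H1 + lc (fun p => y2 p ^+ q) H2).
    apply: mZD; apply: mZ_sum => // p; [by case: (hH1 p)| |by case: (hH2 p)].
    by rewrite exprSr idealMr.
  exists r => t; rewrite addmapB addmapD !addmap_lc.
  have rhoE : rho t = \sum_p addmap_val (H2 p) (y2 p ^+ q * t).
    have [z ->] := comb_surj t; rewrite (plin_comb z lrho).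
    rewrite [RHS](eq_bigr (fun p => \sum_s z s * (y2 p * v p s))).
      by rewrite exchange_big /=; apply: eq_bigr => s _; rewrite -mulr_sumr -hv.
    by move=> p _; rewrite -combZ (hH2 p).2; apply: eq_bigr => s _; ring.
  rewrite -rhoE /rho [X in _ - (X + _)](eq_bigr (fun p => h1 p (y1 p * t))).
    by ring.
  by move=> p _; case: (hH1 p) => _ ->.
have BF : forall p, B (F p).
  apply: (nakayama nR lR) => // p; have [_ [c [cm ->]] Bc] := main _ (hF p).1.
  by exists c.
move=> lf; have [h Zh hf] := plin_addmap f lf; have [c hc] := span_F h Zh.
have [r hr] : B h by rewrite hc; exact: submod_lc.
by exists r => t; rewrite -hf.
Qed.

(** If [s] is not in J then some map sends it to the socle of R/I, and it is a multiple
    of Phi. *)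
Lemma trace_nondegenerate_mod s : (forall t, I (Phi (s * t))) -> J s.
Proof.
move=> hs; apply: contrapT => Js.
have [|f [lf hf]] := @plin_extension unit unit (fun _ _ => s) (fun=> u).
  move=> v hv; have := hv tt; rewrite (bigD1 tt) //= big1 ?addr0 => [Jv|]; last by case.
  apply: ideal_sum => // -[]; apply: hu.2; apply: contrapT => /negP vm_.
  have /(local_unit nR lR)[b bv] : v tt ^+ q \notin m.
    by apply: contra vm_ => /(local_primeX nR lR).
  by apply: Js; rewrite -[s]mul1r -bv -mulrA; exact: idealM.
have [r hr] := plin_trace (lf tt).
apply: hu.1; apply: (ideal_subl iI (hf tt)).
by apply: ideal_sum => // -[]; rewrite hr mulrC; exact: hs.
Qed.

(** Injectivity of multiplication from R/J to the dual of F_* (R/I) is lifted from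
    ideals K + x to K: what is killed modulo K is divisible by x^q modulo the
    corresponding ideal L, with a quotient that is killed again. *)
Lemma trace_nondegenerate : (forall s, (forall t, Phi (s * t) = 0) -> s = 0).
Proof.
suff h : forall ys (K L : set R), is_ideal K -> is_ideal L ->
    (forall l, L l -> K (Phi l)) -> (forall x, x \in ys -> x \in m) -> regseq K ys ->
    (forall s, (forall t, adjs K ys (Phi (s * t))) -> adjs L [seq x ^+ q | x <- ys] s) ->
    forall s, (forall t, K (Phi (s * t))) -> L s.
  move=> s hs; apply: (h xs [set 0] [set 0]) => //; try exact: ideal_zero.
    by move=> _ ->; rewrite /= plin0.
  exact: trace_nondegenerate_mod.
elim=> [//|x ys IH] K L iK iL LK ysm /= [xK rys'] hK.
have xm : x \in m by apply: ysm; rewrite mem_head.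
have {}IH : forall s, (forall t, adj K x (Phi (s * t))) -> adj L (x ^+ q) s.
  apply: IH => //; try exact: adj_ideal.
    move=> _ [l [r [Ll ->]]]; rewrite lPhi.1 lPhi.2; exists (Phi l), (Phi r).
    by split=> //; exact: LK.
  by move=> y yys; apply: ysm; rewrite inE yys orbT.
pose Z : set R^o := [set s : R^o | forall t, K (Phi (s * t))].
have iZ : @submodule R R^o Z.
  split; first by move=> t; rewrite mul0r plin0 //; exact: ideal0.
  - by move=> s s' Zs Zs' t; rewrite mulrDl lPhi.1; exact: idealD.
  - by move=> a s Zs t; rewrite -[a *: s]/(a * s) [a * s]mulrC -mulrA; exact: Zs.
have [P [z [Zz Zsp]]] := noeth_fgen nR iZ.
apply: (@nakayama_quot R m nR lR R^o Z L P z) => //.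
  by move=> v Zv; exists v; [exact: Zsp|rewrite subrr; exact: ideal0].
move=> s Zs; have [|l [r [Ll sE]]] := IH s.
  by move=> t; exists (Phi (s * t)), 0; split; [exact: Zs|rewrite mulr0 addr0].
exists (x ^+ q), r; split; first by rewrite exprSr idealMr.
  move=> t; apply: xK; rewrite -lPhi.2.
  have -> : x ^+ q * (r * t) = s * t - l * t by rewrite sE; ring.
  by rewrite plinB //; apply: idealB => //; apply: LK; exact: idealMl.
by rewrite sE -[_ *: _]/(x ^+ q * r) addrK.
Qed.

End Trace.

Lemma trace_exists : (exists u, socle_mod m I u) -> exists Phi,
  [/\ plin Phi, forall f, plin f -> exists r, forall t, f t = Phi (r * t)
    & forall s, (forall t, Phi (s * t) = 0) -> s = 0].
Proof.
move=> [u hu]; have [sg hsg] : exists sg, socle_mod m J sg.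
  by apply: self_injective_socle => // /Jm; rewrite idealr1.
have [|Phi [lPhi hPhi]] := @plin_extension unit unit (fun _ _ => sg) (fun=> u).
  move=> v hv; have := hv tt; rewrite (bigD1 tt) //= big1 ?addr0 => [Jv|]; last by case.
  apply: ideal_sum => // -[]; apply: hu.2; apply: contrapT => /negP vm_.
  have /(local_unit nR lR)[b bv] : v tt ^+ q \notin m.
    by apply: contra vm_ => /(local_primeX nR lR).
  by apply: hsg.1; rewrite -[sg]mul1r -bv -mulrA; exact: idealM.
have Phi_sg : I (u - Phi tt sg).
  by have := hPhi tt; rewrite (bigD1 tt) //= big1 ?addr0 // => -[].
exists (Phi tt); split=> //.
- exact: (plin_trace hu hsg (lPhi tt) Phi_sg).
- exact: (trace_nondegenerate hu hsg (lPhi tt) Phi_sg).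
Qed.

End FrobeniusDuality.

(** * Exact complexes of free modules and finite projective dimension *)

Section FreeModule.
Variables (R : comNzRingType) (V : lmodType R).

(** The free module on the elements of V maps onto V. *)
Definition fgeval (D : {freeg V / R}) : V := fglift id D.

Fact fgeval_is_zmod_morphism : zmod_morphism fgeval.
Proof. exact: lift_is_additive. Qed.

HB.instance Definition _ :=
  GRing.isZmodMorphism.Build {freeg V / R} V fgeval fgeval_is_zmod_morphism.

Fact fgeval_is_scalable : scalable fgeval.
Proof.
move=> a D; have -> : fgeval D = \sum_(x <- dom D) coeff x D *: x.
  rewrite -[LHS]/(fgeval D) -{1}(freeg_sumE D) raddf_sum.
  by apply: eq_bigr => x _; exact: liftU.
rewrite scaler_sumr -[a *: D]/(fgscale a D) /fgscale raddf_sum; apply: eq_bigr => x _.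
by rewrite /= /fgeval liftU scalerA.
Qed.

HB.instance Definition _ :=
  GRing.isScalable.Build R {freeg V / R} V *:%R fgeval fgeval_is_scalable.

Lemma fgeval_gen x : fgeval << 1 *g x >> = x.
Proof. by rewrite /fgeval liftU scale1r. Qed.

Lemma coeff_mv (S T : finType) (A : S -> T -> R) (D : T -> {freeg V / R}) x s :
  coeff x (mv A D s) = mv A (fun t => coeff x (D t) : R^o) s.
Proof. by rewrite /mv /lcomb raddf_sum; apply: eq_bigr => t _; exact: coeffZ. Qed.

Lemma coeff_uniq_sum (r : seq V) (c : V -> R) z : uniq r ->
  coeff z (\sum_(x <- r) << c x *g x >>) = if z \in r then c z else 0.
Proof.
move=> ur; rewrite raddf_sum; case: ifP => [zr|zr].
  rewrite (bigD1_seq z) //= coeffU eqxx mulr1 big1 ?addr0 // => x xz.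
  by rewrite coeffU (negbTE xz) mulr0.
rewrite big1_seq // => x /andP[_ xr]; rewrite /= coeffU.
by case: eqP => [xz|_]; [rewrite -xz xr in zr|rewrite mulr0].
Qed.

End FreeModule.

Section FlatBaseChange.
Variable R : comNzRingType.

Lemma complex_mv (V : lmodType R) (S T U : finType) (A : S -> T -> R) (B : U -> S -> R)
    (y : T -> V) u : (forall u t, vm (B u) A t = 0) -> mv B (mv A y) u = 0.
Proof. by move=> BA; rewrite {1}/mv lc_mv (eq_lc (BA u) (fun=> erefl)) lc0. Qed.

Lemma linear_mv (V W : lmodType R) (f : {linear V -> W}) (S T : finType)
    (A : S -> T -> R) (y : T -> V) s : f (mv A y s) = mv A (f \o y) s.
Proof. exact: linear_lc. Qed.

Definition coexact_in (V : lmodType R) (S T U : finType) (A : S -> T -> R)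
    (B : U -> S -> R) : Prop :=
  forall w : S -> V, (forall u, mv B w u = 0) -> exists y : T -> V, forall s, w s = mv A y s.

(** A projective module is a direct summand of a free one, where the equations are
    solved coordinatewise. *)
Lemma projective_coexact (P : lmodType R) (S T U : finType) (A : S -> T -> R)
    (B : U -> S -> R) : projective P -> exact_pair A B -> coexact_in P A B.
Proof.
move=> pP [_ AB] w Bw; pose F : lmodType R := {freeg P / R}.
pose pi : {linear F -> P} := @fgeval R P.
have [|h hh] := pP F P pi idfun; first by move=> x; exists << 1 *g x >>; exact: fgeval_gen.
have Bhw u : mv B (h \o w) u = 0 by rewrite -linear_mv Bw linear0.
have /choice[y hy] : forall x : P, exists y : T -> R^o,
    forall s, coeff x (h (w s)) = mv A y s.
  move=> x; apply: (AB (fun s => coeff x (h (w s)))) => u.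
  by rewrite -(coeff_mv B (h \o w)) Bhw coeff0.
pose r := undup (flatten [seq dom (h (w s)) | s <- enum S]).
have ur : uniq r by exact: undup_uniq.
pose Y (t : T) : F := \sum_(x <- r) << y x t *g x >>.
exists (fun t => pi (Y t)) => s.
have -> : w s = pi (h (w s)) by rewrite -[LHS](hh (w s)).
rewrite -[RHS]linear_mv; congr (pi _); apply/eqP/freeg_eqP => z.
rewrite coeff_mv hy; have [zr|zr] := boolP (z \in r).
  by apply: eq_bigr => t _; rewrite coeff_uniq_sum // zr.
rewrite -hy [RHS]big1 => [|t _]; last by rewrite coeff_uniq_sum // (negbTE zr) scaler0.
apply: coeff_outdom; apply: contra zr => zs.
rewrite mem_undup; apply/flattenP; exists (dom (h (w s))) => //.
by apply: map_f; rewrite mem_enum.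
Qed.

(** Induction along a projective resolution 0 -> P n -> ... -> P 0 -> N: a cycle with
    values in N lifts to P 0, where its boundary has values in the first syzygy and is
    a cycle for the next map of the complex. *)
Lemma fpd_coexact (N : lmodType R) n k (S T U : finType) (A : S -> T -> R)
    (B : U -> S -> R) : proj_dim_le n N -> (n < k)%N ->
  exact_pair A B -> right_exact k.+1 B -> coexact_in N A B.
Proof.
move=> [P [d [eps [pP P0 epsS eps0 dS]]]] nk.
pose Z j : P j -> Prop :=
  match j with 0 => fun x => eps x = 0 | j'.+1 => fun x => d j' x = 0 end.
have ZE j x : @Z j x <-> exists y, d j y = x by case: j x => [|j] x; [exact: eps0|exact: dS].
have Z0 j x : @Z j (d j x) by apply/ZE; exists x.
have claim : forall k j, (n < k + j)%N -> forall (S T U : finType) (A : S -> T -> R)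
    (B : U -> S -> R), exact_pair A B -> right_exact k B ->
    forall y : S -> P j, (forall s, Z j (y s)) -> (forall u, mv B y u = 0) ->
    exists z : T -> P j, (forall t, Z j (z t)) /\ forall s, y s = mv A z s.
  elim=> [|{nk}k' IH] j nkj {}S {}T {}U {}A {}B AB rB y Zy By.
    exists (fun=> 0); split=> [t|s]; last by rewrite mv0; exact: P0.
    by apply/ZE; exists 0; rewrite linear0.
  have [V [C [BC rC]]] := rB.
  have /choice[x hx] : forall s, exists x, d j x = y s by move=> s; apply/ZE.
  have [|||z [Zz hz]] := IH j.+1 _ U S V B C BC rC (mv B x).
  - by rewrite addnS -addSn.
  - by move=> u; rewrite /= linear_mv -[RHS](By u); apply: eq_lc.
  - by move=> v; apply: complex_mv; case: BC.
  have [|w hw] := projective_coexact (pP j.+1) AB (w := fun s => x s - z s).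
    by move=> u; rewrite mvB hz subrr.
  exists (fun t => d j (w t)); split=> // s.
  rewrite -[RHS](linear_mv (d j)) -hw linearB /= hx.
  by have /= -> := Zz s; rewrite subr0.
move=> AB [V [C [BC rC]]] y By.
have /choice[x hx] : forall s, exists x, eps x = y s by move=> s; exact: epsS.
have [|||z [Zz hz]] := claim k 0%N _ U S V B C BC rC (mv B x).
- by rewrite addn0.
- by move=> u; rewrite /= linear_mv -[RHS](By u); apply: eq_lc.
- by move=> v; apply: complex_mv; case: BC.
have [|w hw] := projective_coexact (pP 0%N) AB (w := fun s => x s - z s).
  by move=> u; rewrite mvB hz subrr.
exists (fun t => eps (w t)) => s.
by rewrite -[RHS](linear_mv eps) -hw linearB /= hx; have /= -> := Zz s; rewrite subr0.
Qed.

End FlatBaseChange.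

(** * Maps to quotients of finite projective dimension *)

Definition power_gen (R : comNzRingType) (q : nat) (S : finType) (g : S -> R) : Prop :=
  forall r, exists a : S -> R, r = \sum_s a s ^+ q * g s.

(** The R-linear maps from F_* R to an R-module; [plin] is the case of the module R. *)
Definition power_linear (R : comNzRingType) (V : lmodType R) (q : nat) (f : R -> V) : Prop :=
  (forall r s, f (r + s) = f r + f s) /\ forall a r, f (a ^+ q * r) = a *: f r.

Section TraceComplex.
Variables (R : comNzRingType) (q' : nat).
Local Notation q := q'.+1.
Hypothesis qD : forall x y : R, (x + y) ^+ q = x ^+ q + y ^+ q.
Variables (S : finType) (g : S -> R).
Hypothesis gen : power_gen q g.
Local Notation cb := (comb q' g).
Variables (U : finType) (A : U -> S -> R).
Hypothesis relA : forall v : S -> R, cb v = 0 <-> exists c, v =1 vm c A.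
Hypothesis rA : forall k, right_exact k A.
Variable Phi : R -> R.
Hypotheses (lPhi : plin q' Phi)
  (Phi_gen : forall f, plin q' f -> exists r, forall t, f t = Phi (r * t))
  (Phi_nondeg : forall s, (forall t, Phi (s * t) = 0) -> s = 0).

Definition trace_mx (i j : S) : R := Phi (g i * g j).

Lemma plin_comb_mul z r : Phi (cb z * r) = \sum_s z s * Phi (g s * r).
Proof.
by rewrite mulr_suml (plin_sum _ lPhi); apply: eq_bigr => s _; rewrite -mulrA lPhi.2.
Qed.

(** The matrix of the trace form splices the resolution of F_* R and its dual. *)
Lemma trace_exact_left : exact_pair (fun s u => A u s) trace_mx.
Proof.
split=> [i u|w hw].
  have -> : vm (trace_mx i) (fun s u => A u s) u = Phi (cb (A u) * g i).
    rewrite plin_comb_mul; apply: eq_bigr => s _.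
    by rewrite /trace_mx mulrC [g i * g s]mulrC.
  by rewrite (comb_row relA) mul0r (plin0 lPhi).
have /relA[c hc] : cb w = 0.
  apply: Phi_nondeg => t; have [z ->] := gen t.
  rewrite mulrC -/(cb z) plin_comb_mul big1 // => s _.
  have -> : Phi (g s * cb w) = 0; last by rewrite mulr0.
  rewrite mulrC plin_comb_mul -[RHS](hw s); apply: eq_bigr => j _.
  by rewrite /trace_mx [g j * g s]mulrC; exact: mulrC.
by exists c => s; rewrite hc; apply: eq_bigr => u _; exact: mulrC.
Qed.

Lemma trace_exact_right : exact_pair trace_mx A.
Proof.
split=> [u j|w hw].
  by rewrite -[LHS](plin_comb_mul (A u) (g j)) (comb_row relA) mul0r (plin0 lPhi).
have [f [lf hf]] := plin_of_dual qD gen relA hw.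
have [r hr] := Phi_gen lf; have [y ry] := gen r; exists y => s.
have -> : w s = f (g s).
  have := hf (fun t => (t == s)%:R).
  rewrite (bigD1 s) //= eqxx mul1r big1 ?addr0 => [<-|t /negbTE ->]; last by rewrite mul0r.
  congr f; rewrite /comb (bigD1 s) //= eqxx expr1n mul1r big1 ?addr0 // => t /negbTE ->.
  by rewrite expr0n mul0r.
rewrite hr ry -/(cb y) plin_comb_mul; apply: eq_bigr => j _.
by rewrite /trace_mx [g s * g j]mulrC; exact: mulrC.
Qed.

Lemma trace_right_exact k : right_exact k.+1 trace_mx.
Proof. by exists U, A; split; [exact: trace_exact_right|exact: rA]. Qed.

Variable Q : idealr R.
Hypothesis fpdQ : finite_proj_dim (quot_lmod Q).
Local Notation RQ := {ideal_quot Q}.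
Local Notation pi := (\pi_RQ : {rmorphism R -> RQ}).

Lemma piE r s : (pi r = pi s) <-> (r - s \in Q).
Proof. by rewrite Quotient.idealrBE; split=> [->//|/eqP]. Qed.

Lemma pi_eq0 r : pi r = 0 <-> r \in Q.
Proof. by rewrite -(rmorph0 pi) piE subr0. Qed.

Lemma pi_surj (y : RQ) : exists r, pi r = y.
Proof. by exists (repr y); rewrite /= reprK. Qed.

(** The values of [f] on the generators form a column with entries in R/Q killed by the
    relations [A], so that it comes from a column by the trace matrix. *)
Lemma power_linear_quot (f : R -> quot_lmod Q) : power_linear q f ->
  exists s, forall t, f t = pi (Phi (s * t)).
Proof.
move=> [fD fZ]; have [n hn] := fpdQ.
have f0 : f 0 = 0 by have := fZ 0 0; rewrite mulr0 scale0r.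
have f_comb z : f (cb z) = lc z (f \o g).
  rewrite /comb (big_morph f fD f0); apply: eq_bigr => s _; exact: fZ.
have [|y hy] := fpd_coexact hn (ltnSn n) trace_exact_right (rA _) (w := f \o g).
  by move=> u; rewrite -[LHS](f_comb (A u)) (comb_row relA) f0.
have /choice[x hx] : forall j, exists r, pi r = y j by move=> j; exact: pi_surj.
exists (cb x) => t; have [z ->] := gen t; rewrite -/(cb z) f_comb mulrC plin_comb_mul.
rewrite rmorph_sum; apply: eq_bigr => s _; rewrite rmorphM hy.
rewrite -[LHS]/(pi (z s) * _); congr (_ * _).
rewrite mulrC plin_comb_mul rmorph_sum; apply: eq_bigr => j _.
by rewrite rmorphM /= hx mulrC /trace_mx [g j * g s]mulrC.
Qed.

(** The coordinates of [r] are killed modulo Q by the trace matrix, so that they are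
    modulo Q the coordinates of a relation. *)
Lemma trace_quot_nondegenerate r : (forall t, Phi (r * t) \in Q) ->
  exists2 z : S -> R, (forall s, z s \in Q) & r = cb z.
Proof.
move=> hr; have [n hn] := fpdQ; have [z rz] := gen r; rewrite -/(cb z) in rz.
have [|y hy] := fpd_coexact hn (ltnSn n) trace_exact_left (trace_right_exact _)
    (w := fun s => pi (z s) : quot_lmod Q).
  move=> i; have /pi_eq0 <- := hr (g i); rewrite rz plin_comb_mul rmorph_sum.
  by apply: eq_bigr => j _; rewrite rmorphM mulrC /trace_mx [g j * g i]mulrC.
have /choice[x hx] : forall j, exists r, pi r = y j by move=> j; exact: pi_surj.
exists (fun s => z s - vm x A s); last by rewrite combB // (comb_rel relA) subr0.
move=> s; apply/piE; rewrite -[LHS]/(pi (z s)) hy rmorph_sum; apply: eq_bigr => u _.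
by rewrite rmorphM /= hx mulrC.
Qed.

End TraceComplex.

(** The last two clauses say that modulo an ideal Q of finite projective dimension the
    dual of F_* R remains free on [Phi], the submodule Q F_* R being the ideal Q^[q]. *)
Theorem frobenius_trace (R : comNzRingType) (m : idealr R) (q : nat) :
  noetherian R -> local_ring m -> gorenstein R -> (0 < q)%N ->
  (forall x y : R, (x + y) ^+ q = x ^+ q + y ^+ q) ->
  (exists (S : finType) (g : S -> R), power_gen q g) ->
  exists Phi : R -> R, @power_linear R R^o q Phi /\
    (forall f : R -> R^o, power_linear q f -> exists r, forall t, f t = Phi (r * t)) /\
    forall Q : idealr R, finite_proj_dim (quot_lmod Q) ->
      (forall f : R -> quot_lmod Q, power_linear q f ->
        exists s, forall t, f t = \pi_{ideal_quot Q} (Phi (s * t))) /\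
      forall r, (forall t, Phi (r * t) \in Q) ->
        exists (S : finType) (z g : S -> R),
          (forall s, z s \in Q) /\ r = \sum_s z s ^+ q * g s.
Proof.
move=> nR lR gR; case: q => // q' _ qD [S [g gen]].
have [xs [rxs xsm soc]] := maximal_regseq m nR.
have sI : self_injective_mod (adjs [set 0] xs).
  exact: (gorenstein_self_injective nR lR gR rxs soc rxs).
have sJ : self_injective_mod (adjs [set 0] [seq x ^+ q'.+1 | x <- xs]).
  apply: (gorenstein_self_injective nR lR gR rxs soc); last by rewrite size_map.
  by apply: regseq_expr => //; exact: ideal_zero.
have [U [A relA]] := relations_exist nR qD g.
have [Phi [lPhi Phi_gen Phi_nondeg]] := trace_exists nR lR qD gen relA xsm rxs sI sJ soc.
have rA k : right_exact k A.
  apply: (coker_regseq_right_exact nR lR _ xsm rxs sI).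
  exact: (coker_regseq_rel qD gen relA rxs).
exists Phi; split; first exact: lPhi.
split; first exact: Phi_gen.
move=> Q fQ; split=> [f lf|r hr].
  exact: (power_linear_quot qD gen relA rA lPhi Phi_gen fQ lf).
have [z Qz rz] := trace_quot_nondegenerate qD gen relA rA lPhi Phi_gen Phi_nondeg fQ hr.
by exists S, z, g.
Qed.

(** * Splittings of the Frobenius *)

Section FrobeniusPushforward.
Variables (R : comNzRingType) (p : nat) (charRp : p \in [pchar R]).

Lemma prime_char : prime p. Proof. exact: pcharf_prime charRp. Qed.
Lemma q_gt0 e : (0 < p ^ e)%N. Proof. by rewrite expn_gt0 prime_gt0 // prime_char. Qed.

Lemma qpowD e (x y : R) : (x + y) ^+ (p ^ e) = x ^+ (p ^ e) + y ^+ (p ^ e).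
Proof. exact: (rmorphD (frob_iter charRp e)). Qed.

Lemma linear_power_linear e (phi : {linear Fpush charRp e -> R^o}) :
  @power_linear R R^o (p ^ e) phi.
Proof.
split=> [r s|a r]; first exact: (linearD phi r s).
exact: (linearZ_LR phi a r).
Qed.

Lemma power_linear_linear e (f : R -> R^o) : power_linear (p ^ e) f ->
  exists phi : {linear Fpush charRp e -> R^o}, forall r, phi r = f r.
Proof.
move=> [fD fZ]; have f0 : f 0 = 0 by have := fZ 0 0; rewrite mulr0 scale0r.
have fl : linear (f : Fpush charRp e -> R^o).
  by move=> a r s; rewrite -[RHS]/(a *: f r + f s) -fZ -fD.
pose F := GRing.isLinear.Build R (Fpush charRp e) R^o _ (f : Fpush charRp e -> R^o) fl.
pose phi : {linear Fpush charRp e -> R^o} := HB.pack (f : Fpush charRp e -> R^o) F.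
by exists phi.
Qed.

Lemma frob_splitsP e : splits (frob_iter charRp e : R^o -> Fpush charRp e) <->
  exists f : R -> R^o, power_linear (p ^ e) f /\ f 1 = 1.
Proof.
split=> [[phi hphi]|[f [lf f1]]].
  exists phi; split; first exact: linear_power_linear.
  by rewrite -[RHS](hphi 1) /frob_iter expr1n.
have [phi hphi] := power_linear_linear lf; exists phi => a.
by rewrite hphi /frob_iter -[X in f X]mulr1 lf.2 f1; exact: mulr1.
Qed.

Lemma elt_splitsP e (c : R) :
  splits (fun a : R^o => a *: (c : Fpush charRp e)) <->
  exists f : R -> R^o, power_linear (p ^ e) f /\ f c = 1.
Proof.
split=> [[phi hphi]|[f [lf fc]]].
  exists phi; split; first exact: linear_power_linear.
  by have := hphi 1; rewrite scale1r.
have [phi hphi] := power_linear_linear lf; exists phi => a.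
by rewrite linearZ /= hphi fc; exact: mulr1.
Qed.

(** A splitting for one exponent e yields one for every exponent: compose the splitting
    with itself, and restrict along a further power of the Frobenius. *)
Lemma F_pure_all e : F_pure charRp -> exists f : R -> R^o, power_linear (p ^ e) f /\ f 1 = 1.
Proof.
move=> [e0 [e0_gt0 /frob_splitsP[f [lf f1]]]].
have [h [lh h1]] : exists f : R -> R^o, power_linear (p ^ (e0 * e)) f /\ f 1 = 1.
  elim: e => [|e [h [lh h1]]].
    exists id; split=> //; split=> // a r.
    by rewrite muln0 expn0 expr1.
  exists (f \o h); split; last by rewrite /= h1.
  split=> [r s|a r]; first by rewrite /= lh.1 lf.1.
  by rewrite /= mulnS expnD exprM lh.2 lf.2.
have ee : (e <= e0 * e)%N by rewrite leq_pmull.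
exists (fun r => h (r ^+ (p ^ (e0 * e - e)))); split; last by rewrite expr1n.
split=> [r s|a r]; first by rewrite qpowD lh.1.
by rewrite exprMn -exprM -expnD subnKC // lh.2.
Qed.

Lemma F_finite_power_gen e : F_finite charRp ->
  exists (S : finType) (g : S -> R), power_gen (p ^ e) g.
Proof.
move=> [e0 [e0_gt0 [n [g0 hg0]]]].
have [S [g hg]] : exists (S : finType) (g : S -> R), power_gen (p ^ (e0 * e)) g.
  elim: e => [|e [S [g hg]]].
    exists unit, (fun=> 1) => r; exists (fun=> r).
    by rewrite muln0 (bigD1 tt) //= big1 ?addr0 ?mulr1 ?expr1 // => -[].
  exists ('I_n * S)%type, (fun i => g i.2 ^+ (p ^ e0) * (g0 i.1 : R)) => r.
  have [a ra] := hg0 r; have /choice[b hb] : forall i, exists b : S -> R,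
      a i = \sum_s b s ^+ (p ^ (e0 * e)) * g s by move=> i; exact: hg.
  exists (fun i => b i.1 i.2); rewrite ra.
  rewrite -(pair_bigA _ (fun i s => b i s ^+ (p ^ (e0 * e.+1)) *
    (g s ^+ (p ^ e0) * (g0 i : R)))) /=; apply: eq_bigr => i _.
  rewrite -[LHS]/(frob_iter charRp e0 (a i) * (g0 i : R)) hb rmorph_sum mulr_suml.
  apply: eq_bigr => s _; rewrite mulnS addnC expnD exprM mulrA.
  by congr (_ * _); exact: rmorphM.
have ee : (e <= e0 * e)%N by rewrite leq_pmull.
exists S, g => r; have [a ->] := hg r; exists (fun s => a s ^+ (p ^ (e0 * e - e))).
by apply: eq_bigr => s _; rewrite -exprM -expnD subnK.
Qed.

End FrobeniusPushforward.

Section QuotientSplittings.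
Variables (R : comNzRingType) (p : nat) (charRp : p \in [pchar R]) (Q : idealr R).
Local Notation RQ := {ideal_quot Q}.
Local Notation pi := (\pi_RQ : {rmorphism R -> RQ}).
Local Notation charQp := (quot_pchar Q charRp).

Lemma power_linear_descend q (f : R -> R^o) : power_linear q f ->
  (forall x, x \in Q -> f x \in Q) ->
  exists h : RQ -> RQ^o, power_linear q h /\ forall r, h (pi r) = pi (f r).
Proof.
move=> [fD fZ] fQ.
have hE r : pi (f (repr (pi r))) = pi (f r).
  apply/piE; have -> : f (repr (pi r)) - f r = f (repr (pi r) - r).
    by apply/eqP; rewrite subr_eq -fD subrK.
  by apply: fQ; apply/piE; rewrite /= reprK.
exists (fun y => pi (f (repr y))); split=> //; split=> [x y|a x].
  have [r <-] := pi_surj x; have [s <-] := pi_surj y.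
  by rewrite -rmorphD !hE fD rmorphD.
have [r <-] := pi_surj x; have [b <-] := pi_surj a.
by rewrite -rmorphXn -rmorphM !hE fZ rmorphM.
Qed.

Lemma power_linear_pull q (h : RQ -> RQ^o) : power_linear q h ->
  @power_linear R (quot_lmod Q) q (fun r => h (pi r)).
Proof.
move=> [hD hZ]; split=> r s; first by rewrite [pi (r + s)]rmorphD; exact: hD.
by rewrite [pi (_ * _)]rmorphM [pi (_ ^+ _)]rmorphXn; exact: hZ.
Qed.

Lemma quot_noetherian : noetherian R -> noetherian RQ.
Proof.
move=> nR J iJ; pose I : set R := [set r | J (pi r)].
have iI : is_ideal I.
  rewrite /I; split=> /=; first by rewrite rmorph0; exact: ideal0.
  - by move=> x y Jx Jy; rewrite rmorphD; exact: idealD.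
  - by move=> a x Jx; rewrite rmorphM; exact: idealM.
have [s Is] := nR I iI; exists (map pi s); apply/seteqP; split.
  move=> y Jy; have [r ry] := pi_surj y.
  have : I r by rewrite /I /= ry.
  rewrite Is => -[n [a [t [st rE]]]]; exists n, (pi \o a), (pi \o t); split.
    by move=> i; apply: map_f; exact: st.
  rewrite -ry rE rmorph_sum; apply: eq_bigr => i _; exact: rmorphM.
move=> _ [n [a [t [st ->]]]]; apply: ideal_sum => // i; apply: idealM => //.
have /mapP[r rs ->] := st i; have : I r; last by [].
rewrite Is; exists 1%N, (fun=> 1), (fun=> r); split=> //.
by rewrite big_ord1 mul1r.
Qed.

End QuotientSplittings.

Section StronglyFRegular.
Variables (A : comNzRingType).
Hypothesis nA : noetherian A.

(** A minimal prime consists of zero divisors: an ideal maximal among those avoiding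
    the products x^i t, with t outside the prime, is a prime ideal. *)
Lemma nzd_notin_minimal_prime (x : A) (P : prime_idealr A) :
  (forall r, x * r = 0 -> r = 0) -> minimal_prime P -> x \notin P.
Proof.
move=> nx minP; apply/negP => xP.
pose F : set (set A) := [set I | is_ideal I /\ forall i t, t \notin P -> ~ I (x ^+ i * t)].
have idF I : F I -> is_ideal I by case.
have F0 : F [set 0].
  split; first exact: ideal_zero.
  move=> i t tP /=; elim: i => [|i IH]; first by rewrite mul1r => t0; rewrite t0 idealr0 in tP.
  by rewrite exprS -mulrA => /nx.
have [I [iI FI] Imax] := noeth_max nA idF F0.
have big J : is_ideal J -> I `<=` J -> (exists2 a, J a & ~ I a) ->
    exists i t, t \notin P /\ J (x ^+ i * t).
  move=> iJ IJ [a Ja Ia]; apply: contrapT => nJ; apply: Ia; apply: (Imax J) => //.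
  by split=> // i t tP Jit; apply: nJ; exists i, t.
pose b : A -> bool := fun r => `[< I r >].
have bc : idealr_closed b.
  split; rewrite ?unfold_in; [by apply/asboolP; exact: ideal0| |].
    apply/negP => /asboolP I1; apply: (FI 0%N 1); rewrite ?idealr1 //.
    by rewrite mulr1.
  move=> a u v /asboolP Iu /asboolP Iv; apply/asboolP.
  by apply: idealD => //; exact: idealM.
have bp : prime_idealr_closed b.
  move=> u v; rewrite !unfold_in => /asboolP Iuv; apply/orP.
  have [Iu|Iu] := pselect (I u); first by left; apply/asboolP.
  right; apply/asboolP; apply: contrapT => Iv.
  have [|||i [t [tP Jt]]] := big (adj I u); [exact: adj_ideal|exact: adj_sub| |].
    by exists u => //; exact: adj_self.
  have [|||j [s [sP Js]]] := big (adj I v); [exact: adj_ideal|exact: adj_sub| |].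
    by exists v => //; exact: adj_self.
  apply: (FI (i + j)%N (t * s)).
    by rewrite prime_idealrM negb_or tP.
  have [k [c [Ik tE]]] := Jt; have [l [d [Il sE]]] := Js.
  have -> : x ^+ (i + j) * (t * s) = (x ^+ i * t) * (x ^+ j * s) by rewrite exprD; ring.
  have -> : (x ^+ i * t) * (x ^+ j * s) = (x ^+ j * s) * k + (u * c) * l + (c * d) * (u * v).
    by rewrite tE sE; ring.
  by apply: idealD; [|apply: idealD|]; try exact: idealM.
pose P' : prime_idealr A := HB.pack b (isIdealr.Build A b bc) (isPrimeIdealrClosed.Build A b bp).
have memP' r : (r \in P') = `[< I r >] by [].
have : x \in P'.
  apply: (minP P') => // r; rewrite memP' => /asboolP Ir.
  apply: contrapT => /negP rP; apply: (FI 0%N r rP); by rewrite mul1r.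
by rewrite memP' => /asboolP Ix; apply: (FI 1%N 1); rewrite ?idealr1 // expr1 mulr1.
Qed.

(** In a reduced Noetherian ring choose [d] in the annihilator of [c] with largest double
    annihilator: anything killed by [c] and [d] could be added to [d] and would make
    the double annihilator larger, so c + d is a nonzerodivisor. *)
Lemma reduced_complement (c : A) : (forall r : A, r * r = 0 -> r = 0) ->
  exists d, c * d = 0 /\ forall r, (c + d) * r = 0 -> r = 0.
Proof.
move=> red; pose aa (d : A) : set A := [set r | forall t, d * t = 0 -> r * t = 0].
pose F : set (set A) := [set I | exists2 d, c * d = 0 & I = aa d].
have idF I : F I -> is_ideal I.
  move=> [d _ ->]; split=> /=.
  - by move=> t _; rewrite mul0r.
  - by move=> r s hr hs t dt; rewrite mulrDl hr // hs // addr0.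
  - by move=> a r hr t dt; rewrite -mulrA hr // mulr0.
have F0 : F (aa 0) by exists 0; rewrite ?mulr0.
have [_ [d cd ->] dmax] := noeth_max nA idF F0.
have cdt t : c * t = 0 -> d * t = 0 -> t = 0.
  move=> ct dt.
  have split_ s : (d + t) * s = 0 -> d * s = 0 /\ t * s = 0.
    move=> h; have ds : d * s = 0.
      apply: red; have -> : d * s * (d * s) = d * s * ((d + t) * s) - (d * t) * (s * s) by ring.
      by rewrite h dt mulr0 mul0r subrr.
    by split=> //; move: h; rewrite mulrDl ds add0r.
  have Fdt : F (aa (d + t)) by exists (d + t); rewrite // mulrDr cd ct addr0.
  have aat : aa d t.
    by apply: (dmax _ Fdt) => [r hr s /split_[ds _]|s /split_[]] //; exact: hr.
  by apply: red; exact: aat.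
exists d; split=> // r h.
have cr : c * r = 0.
  apply: red; have -> : c * r * (c * r) = c * r * ((c + d) * r) - (c * d) * (r * r) by ring.
  by rewrite h cd mulr0 mul0r subrr.
by apply: cdt => //; move: h; rewrite mulrDl cr add0r.
Qed.

Variables (p : nat) (charAp : p \in [pchar A]).

(** If r^2 = 0 then r = r f(1) = f(r^q) = 0. *)
Lemma strongly_F_regular_reduced : strongly_F_regular charAp ->
  forall r : A, r * r = 0 -> r = 0.
Proof.
move=> sA r rr; have [|e [e_gt0 /elt_splitsP[f [lf f1]]]] := sA 1.
  by move=> P _; rewrite idealr1.
have rq : r ^+ (p ^ e) = 0.
  have : (1 < p ^ e)%N by rewrite -[1%N](expn0 p) ltn_exp2l ?prime_gt1 // (prime_char charAp).
  by case: (p ^ e)%N => [|[|k]] // _; rewrite !exprS mulrA rr mul0r.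
rewrite -[r]mulr1 -f1 -[_ * _]/(r *: f 1) -lf.2 rq mul0r.
by have := lf.2 0 0; rewrite mulr0 scale0r.
Qed.

(** If c d = 0 then d = d f(c) = f(c d^q) = 0, so that the zero ideal is a prime, and it
    is the only minimal one. *)
Lemma domain_strongly_F_regular :
  (forall c : A, c != 0 -> exists e, (0 < e)%N /\
     exists f : A -> A^o, power_linear (p ^ e) f /\ f c = 1) ->
  strongly_F_regular charAp.
Proof.
move=> hA; have dom (c d : A) : c * d = 0 -> (c == 0) || (d == 0).
  move=> cd; have [//|c0] := eqVneq c 0; have [e [e_gt0 [f [lf fc]]]] := hA c c0.
  have f0 : f 0 = 0 by have := lf.2 0 0; rewrite mulr0 scale0r.
  apply/eqP; rewrite -[d]mulr1 -fc -[_ * _]/(d *: f c) -lf.2.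
  case: (p ^ e)%N (q_gt0 charAp e) => // k _.
  by rewrite exprSr -mulrA [d * c]mulrC cd mulr0.
pose b : A -> bool := fun r => r == 0.
have bc : idealr_closed b.
  split; rewrite ?unfold_in; [exact: eqxx|exact: oner_neq0|].
  by move=> a u v /eqP -> /eqP ->; rewrite mulr0 addr0; exact: eqxx.
have bp : prime_idealr_closed b.
  by move=> u v; rewrite !unfold_in => /eqP /dom.
pose P : prime_idealr A := HB.pack b (isIdealr.Build A b bc) (isPrimeIdealrClosed.Build A b bp).
move=> c /(_ P) hc; have [|e [e_gt0 [f [lf fc]]]] := hA c.
  by apply: hc => P' _ r /eqP ->; exact: idealr0.
by exists e; split=> //; apply/elt_splitsP; exists f.
Qed.

End StronglyFRegular.

(** * The criteria *)

Section Criteria.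
Variables (R : comNzRingType) (p : nat) (charRp : p \in [pchar R]) (m Q : idealr R).
Hypotheses (nR : noetherian R) (lR : local_ring m) (fR : F_finite charRp).
Hypotheses (gR : gorenstein R) (fpdQ : finite_proj_dim (quot_lmod Q)).
Local Notation RQ := {ideal_quot Q}.
Local Notation pi := (\pi_RQ : {rmorphism R -> RQ}).
Local Notation charQp := (quot_pchar Q charRp).

Let iQ : is_ideal [set` Q]. Proof. exact: max_ideal_set. Qed.

Let Qm r : r \in Q -> r \in m.
Proof. by apply: (local_sub nR lR iQ); rewrite /= idealr1. Qed.

Let trace e := frobenius_trace nR lR gR (q_gt0 charRp e) (qpowD charRp e)
  (F_finite_power_gen e fR).

Lemma pi_unit_lift r s : r * pi s = 1 -> s \notin m.
Proof.
have [t <-] := pi_surj r; rewrite -rmorphM -(rmorph1 pi) => /piE/Qm h.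
apply/negP => sm; have := rpredB (idealMr t sm) h.
by rewrite opprB addrCA subrr addr0 idealr1.
Qed.

Definition fedder e := ~ (colon (frob_power p [set` Q] e) [set` Q] `<=` I_ charRp e [set` m]).

Lemma fedderP e : fedder e <->
  exists s, colon (frob_power p [set` Q] e) [set` Q] s /\
    exists f : R -> R^o, power_linear (p ^ e) f /\ f s \notin m.
Proof.
split.
  move=> h; apply: contrapT => ns; apply: h => s Qs phi /=.
  apply: contrapT => /negP sm; apply: ns; exists s; split=> //; exists phi.
  by split=> //; exact: linear_power_linear.
move=> [s [Qs [f [lf fs]]]] /(_ s Qs); have [phi hphi] := power_linear_linear charRp lf.
by move=> /(_ phi); rewrite /= hphi; exact/negP.
Qed.

Lemma descend_unit q (f : R -> R^o) s c : power_linear q f ->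
  (forall x, x \in Q -> f (s * x) \in Q) -> f (s * c) \notin m ->
  exists h : RQ -> RQ^o, power_linear q h /\ h (pi c) = 1.
Proof.
move=> [fD fZ] fQ fc; have [b bf] := local_unit nR lR fc.
have [||h [lh hh]] := @power_linear_descend R Q q (fun r => b * f (s * r)).
- split=> [r t|a r]; first by rewrite mulrDr fD mulrDr.
  rewrite (_ : s * (a ^+ q * r) = a ^+ q * (s * r)); last by ring.
  by rewrite fZ; exact: mulrCA.
- by move=> x Qx; apply: idealMr; exact: fQ.
by exists h; split=> //; rewrite hh bf rmorph1.
Qed.

Lemma fedder_F_pure e : (0 < e)%N -> fedder e -> F_pure charQp.
Proof.
move=> e_gt0 /fedderP[s [Qs [f [lf fs]]]].
have f0 : f 0 = 0 by have := lf.2 0 0; rewrite mulr0 scale0r.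
have [x Qx||h [lh h1]] := descend_unit (s := s) (c := 1) lf.
- have [n [a [t [ht ->]]]] := Qs x Qx.
  rewrite (big_morph f lf.1 f0); apply: (ideal_sum iQ) => i.
  have [y Qy <-] := ht i; rewrite mulrC lf.2 -[_ *: _]/(y * f (a i)) /=.
  by rewrite mulrC; exact: idealMr.
- by rewrite mulr1.
exists e; split=> //; apply/frob_splitsP; exists h; split=> //.
by move: h1; rewrite rmorph1.
Qed.

(** The splitting h, as a map from F_* R to R/Q, is the reduction of a map Phi(s -).  It
    kills F_* Q, so that s Q lies in Q^[q], and Phi(s) reduces to h(1) = 1. *)
Lemma F_pure_fedder e : F_pure charQp -> fedder e.
Proof.
move=> /(F_pure_all e)[h [lh h1]].
have [Phi [lPhi [Phi_gen /(_ Q fpdQ)[lift nondeg]]]] := trace e.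
have [s hs] := lift _ (power_linear_pull lh).
apply/fedderP; exists s; split; last first.
  exists Phi; split=> //; apply: (@pi_unit_lift 1).
  by have := hs 1; rewrite mulr1 rmorph1 h1 mul1r => ->.
have h0 : h 0 = 0 by have := lh.2 0 0; rewrite mulr0 scale0r.
move=> x /= Qx; have [|S [z [g [Qz ->]]]] := nondeg (s * x).
  move=> t; apply/pi_eq0; rewrite -mulrA.
  transitivity (h (pi (x * t))); first exact/esym/hs.
  by rewrite rmorphM; have /pi_eq0 -> := Qx; rewrite mul0r h0.
exists #|S|, (fun i => g (enum_val i)), (fun i => z (enum_val i) ^+ (p ^ e)); split.
  by move=> i; exists (z (enum_val i)) => //; exact: Qz.
rewrite (reindex_onto enum_val enum_rank) => [|i _]; last exact: enum_rankK.
rewrite (eq_bigl predT) => [|i]; last by rewrite /= enum_valK eqxx.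
by apply: eq_bigr => i _; rewrite mulrC.
Qed.

Definition glassbrenner e c :=
  ~ ([set c * r | r in colon (I_ charRp e [set` Q]) [set` Q]] `<=` I_ charRp e [set` m]).

Lemma glassbrennerP e c : glassbrenner e c <->
  exists s, colon (I_ charRp e [set` Q]) [set` Q] s /\
    exists f : R -> R^o, power_linear (p ^ e) f /\ f (c * s) \notin m.
Proof.
split.
  move=> h; apply: contrapT => ns; apply: h => _ [s Qs <-] phi /=.
  apply: contrapT => /negP sm; apply: ns; exists s; split=> //; exists phi.
  by split=> //; exact: linear_power_linear.
move=> [s [Qs [f [lf fs]]]] /(_ (c * s)); have [phi hphi] := power_linear_linear charRp lf.
by move=> /(_ (ex_intro2 _ _ s Qs erefl) phi); rewrite /= hphi; exact/negP.
Qed.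

Lemma glassbrenner_strongly_F_regular :
  (forall c, c \notin Q -> exists e, (0 < e)%N /\ glassbrenner e c) ->
  strongly_F_regular charQp.
Proof.
move=> hQ; apply: domain_strongly_F_regular => y y0.
have [c cy] := pi_surj y; have cQ : c \notin Q.
  by apply: contra y0 => /pi_eq0; rewrite -cy => ->; exact: eqxx.
have [e [e_gt0 /glassbrennerP[s [Qs [f [lf fs]]]]]] := hQ c cQ.
have [x Qx||h [lh h1]] := descend_unit (s := s) (c := c) lf.
- have [phi hphi] := power_linear_linear charRp lf.
  by rewrite -hphi; exact: (Qs x Qx phi).
- by rewrite mulrC.
by exists e; split=> //; exists h; rewrite -cy.
Qed.

(** Strong F-regularity gives a map sending c + d to 1, where c d = 0 and c + d is a
    nonzerodivisor modulo Q.  The images u and v of c and d satisfy u + v = 1 and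
    c v = d u = 0, so u is a unit as c is nonzero and R/Q is local. *)
Lemma strongly_F_regular_glassbrenner c : strongly_F_regular charQp -> c \notin Q ->
  exists e, (0 < e)%N /\ glassbrenner e c.
Proof.
move=> sQ cQ; have nQ := quot_noetherian (Q := Q) nR.
have [y [cy nzd]] := reduced_complement nQ (pi c) (strongly_F_regular_reduced sQ).
have [|e [e_gt0 /elt_splitsP[h [lh h1]]]] := sQ (pi c + y).
  by move=> P; exact: nzd_notin_minimal_prime.
exists e; split=> //; have [Phi [lPhi [Phi_gen /(_ Q fpdQ)[lift _]]]] := trace e.
have [s hs] := lift _ (power_linear_pull lh).
have h0 : h 0 = 0 by have := lh.2 0 0; rewrite mulr0 scale0r.
apply/glassbrennerP; exists s; split.
  move=> x /= Qx phi; have [t ht] := Phi_gen _ (linear_power_linear phi).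
  apply/pi_eq0; rewrite ht (_ : t * (s * x) = s * (x * t)); last by ring.
  transitivity (h (pi (x * t))); first exact/esym/hs.
  by rewrite rmorphM; have /pi_eq0 -> := Qx; rewrite mul0r h0.
exists Phi; split=> //; apply/negP => um.
have hc : h (pi c) = pi (Phi (c * s)) by rewrite hs mulrC.
have hy : h y = pi (1 - Phi (c * s)).
  by rewrite rmorphB rmorph1 -hc -h1 lh.1 addrAC subrr add0r.
have [b bv] : exists b, b * (1 - Phi (c * s)) = 1.
  apply: (local_unit nR lR); apply/negP => vm.
  by have := rpredD vm um; rewrite subrK idealr1.
have cv : pi c * h y = 0.
  rewrite -[_ * _]/(pi c *: h y) -lh.2.
  case: (p ^ e)%N (q_gt0 charRp e) => // k _.
  by rewrite exprSr -mulrA cy mulr0.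
move: cQ => /negP; apply; apply/pi_eq0.
by rewrite -[pi c]mulr1 -(rmorph1 pi) -bv mulrC rmorphM -hy -mulrA [h y * _]mulrC cv mulr0.
Qed.

End Criteria.

Theorem theorem2 (R : comNzRingType) (p : nat) (charRp : p \in [pchar R])
    (m : idealr R) (Q : idealr R) :
  noetherian R -> local_ring m -> F_finite charRp -> gorenstein R ->
  finite_proj_dim (quot_lmod Q) ->
  let charQp := quot_pchar Q charRp in
  let fedder (e : nat) :=
    ~ (colon (frob_power p [set` Q] e) [set` Q] `<=` I_ charRp e [set` m]) in
  [/\ F_pure charQp <-> (exists e, (0 < e)%N /\ fedder e),
      (exists e, (0 < e)%N /\ fedder e) <-> (forall e, (0 < e)%N -> fedder e)
    & strongly_F_regular charQp <->
      (forall c : R, c \notin Q -> exists e, (0 < e)%N /\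
         ~ ([set c * r | r in colon (I_ charRp e [set` Q]) [set` Q]]
              `<=` I_ charRp e [set` m]))].
Proof.
move=> nR lR fR gR fpdQ charQp fed.
have pure_fed e : F_pure charQp -> fed e by exact: F_pure_fedder.
have fed_pure e : (0 < e)%N -> fed e -> F_pure charQp by exact: fedder_F_pure.
split.
- split=> [hp|[e [e_gt0 /fed_pure]]]; last exact.
  by exists 1%N; split=> //; exact: pure_fed.
- split=> [[e [e_gt0 /(fed_pure e e_gt0) hp]] e' _|h]; first exact: pure_fed.
  by exists 1%N; split=> //; exact: h.
- split=> [sQ c cQ|]; first exact: strongly_F_regular_glassbrenner.
  exact: glassbrenner_strongly_F_regular.
Qed.
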